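(* Consider the spatially periodic modified KP-I equation $$(u_t+u_{xxx}+\partial_x(f(u)))_x-u_{yy}=0,\qquad f(u)=u^3,$$ for $(t,x,y)\in(0,\infty)\times[0,K_1]\times[0,K_2]$, with $u$ being $K_1$-periodic in $x$ and $K_2$-periodic in $y$. Let $c>0$, let $b\in(-\tfrac12c^2,0)$, let $\varphi_1>\varphi_0>0$ be the positive roots of $\tfrac{\rho^4}{2}-c\rho^2-b=0$, and put $$\kappa^2=\frac{\varphi_1^2-\varphi_0^2}{\varphi_1^2}=\frac{2\varphi_1^2-2c}{\varphi_1^2}\in(0,1),\qquad \alpha=\frac{\varphi_1}{\sqrt2},\qquad T=\frac{2K(\kappa)}{\alpha},\qquad K_1=T.$$ Let $\varphi$ be one of the two dnoidal waves (up to translation) $$\varphi(z)=\mp\varphi_1\,\mathrm{dn}(\alpha z;\kappa),$$ so that $u(t,x,y)=\varphi(x-ct)$ solves the equation. Then for every such wave (that is, for all values of the parameter $\kappa\in(0,1)$ and the corresponding $T$) there exists a period $K_2>0$, depending on the particular wave, such that the wave is spectrally unstable and linearly unstable with respect to perturbations that are $T$-periodic in $x$ and $K_2$-periodic in $y$.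
   Context: $\mathrm{dn}(\cdot;\kappa)$ is the Jacobi elliptic function of modulus $\kappa$, and $K(\kappa)$ is the complete elliptic integral of the first kind, $K(\kappa)=\int_0^1\frac{dz}{\sqrt{(1-z^2)(1-\kappa^2z^2)}}$. Linearized problem. Substituting $u(t,x,y)=\varphi(x-ct)+v(t,x-ct,y)$ and dropping terms nonlinear in $v$, one gets, for $v$ with $\int_0^{K_1}v(t,x,y)\,dx=0$, the evolution equation $v_t=\mathcal{A}v$ with $$\mathcal{A}v=\partial_x\big(-\partial_x^2+c-f'(\varphi)\big)v+\partial_x^{-1}\partial_{yy}v,\qquad f'(\varphi)=3\varphi^2 .$$ Here $\mathcal{A}$ acts on the space $X$ of complex-valued functions $v\in L^2$ that are $K_1$-periodic in $x$, $K_2$-periodic in $y$, and satisfy $\int_0^{K_1}v(x,y)\,dx=0$ for a.e. $y$, with domain $\{v\in X:\mathcal{A}v\in X\}$ ($\mathcal{A}v$ understood in the sense of periodic distributions); $\partial_x^{-1}$ denotes the mean-zero (in $x$) periodic antiderivative in $x$. $\mathcal{A}$ generates a $C_0$ semigroup $e^{t\mathcal{A}}$ on $X$. The wave is spectrally stable if $\sigma(\mathcal{A})\subset\{\lambda\in\mathbb{C}:\mathrm{Re}\,\lambda\le 0\}$, and spectrally unstable otherwise. It is linearly stable if the growth bound of the semigroup $e^{t\mathcal{A}}$ is non-positive (equivalently, every solution of $v_t=\mathcal{A}v$ with $v(0)\in X$ satisfies $\lim_{t\to\infty}e^{-\delta t}\|v(t,\cdot)\|=0$ for every $\delta>0$),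 and linearly unstable otherwise. *)

(* Defs.v *)
From HB Require Import structures.
From mathcomp Require Import all_boot all_order all_algebra.
From mathcomp Require Import all_classical all_reals all_analysis.
From mathcomp Require Import complex.

Set Implicit Arguments.
Unset Strict Implicit.
Unset Printing Implicit Defensive.

Import Order.TTheory GRing.Theory Num.Theory.
Import numFieldNormedType.Exports.
Local Open Scope classical_set_scope.
Local Open Scope ring_scope.

(* At the endpoint z = 1 the integrand is 0^-1 = 0, which does not affect the
   Lebesgue integral. *)
Definition ellK (R : realType) (kappa : R) : R :=
  \int[lebesgue_measure]_(z in `[0, 1])
    (Num.sqrt ((1 - z ^+ 2) * (1 - kappa ^+ 2 * z ^+ 2)))^-1.

(* Incomplete elliptic integral of the first kind, with amplitude p and modulus
   kappa. *)
Definition ellF (R : realType) (kappa p : R) : R :=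
  let g (t : R) := (Num.sqrt (1 - kappa ^+ 2 * sin t ^+ 2))^-1 in
  if 0 <= p then \int[lebesgue_measure]_(t in `[0, p]) g t
  else - \int[lebesgue_measure]_(t in `[p, 0]) g t.

(* For 0 <= kappa < 1, [ellF kappa] is a bijection of the real line, and the
   Jacobi amplitude is its inverse. *)
Definition jacobi_am (R : realType) (kappa z : R) : R :=
  xget 0 [set p | ellF kappa p = z].

Definition jacobi_dn (R : realType) (kappa z : R) : R :=
  Num.sqrt (1 - kappa ^+ 2 * sin (jacobi_am kappa z) ^+ 2).

(* A Hilbert space of classes of functions is given by a subspace [X] of a
   complex vector space [V] of representatives and a seminorm [nrm]; two
   elements u, v of X stand for the same class when [nrm (u - v) = 0].
   An unbounded operator is given by its graph: [A v w] means that v is in the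
   domain of A and that A v = w; such graphs are to be compatible with equality
   of classes. *)

(* lambda - A is onto X and has a bounded inverse; the bound contains
   injectivity. *)
Definition resolvent_set (R : realType) (V : lmodType R[i]) (X : set V)
    (nrm : V -> R) (A : V -> V -> Prop) : set R[i] :=
  [set lambda |
     (forall f, X f -> exists v w, A v w /\ nrm (lambda *: v - w - f) = 0) /\
     (exists M : R, forall v w, A v w -> nrm v <= M * nrm (lambda *: v - w))].

Definition spectrum (R : realType) (V : lmodType R[i]) (X : set V)
    (nrm : V -> R) (A : V -> V -> Prop) : set R[i] :=
  ~` resolvent_set X nrm A.

Definition C0_semigroup (R : realType) (V : lmodType R[i]) (X : set V)
    (nrm : V -> R) (S : R -> V -> V) : Prop :=
  [/\ forall t v, 0 <= t -> X v -> X (S t v),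
      forall t (a : R[i]) u v, 0 <= t -> X u -> X v ->
        nrm (S t (a *: u + v) - (a *: S t u + S t v)) = 0,
      forall t, 0 <= t -> exists M : R, forall v, X v -> nrm (S t v) <= M * nrm v,
      (forall v, X v -> nrm (S 0 v - v) = 0) /\
      (forall s t v, 0 <= s -> 0 <= t -> X v ->
         nrm (S (s + t) v - S s (S t v)) = 0)
    & forall v, X v -> nrm (S t v - v) @[t --> 0^'+] --> (0 : R)].

Definition is_generator (R : realType) (V : lmodType R[i]) (X : set V)
    (nrm : V -> R) (S : R -> V -> V) (A : V -> V -> Prop) : Prop :=
  forall v w, X v -> X w ->
    (A v w <->
     nrm ((h^-1)%:C%C *: (S h v - v) - w) @[h --> 0^'+] --> (0 : R)).

Definition growth_bound (R : realType) (V : lmodType R[i]) (X : set V)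
    (nrm : V -> R) (S : R -> V -> V) : \bar R :=
  ereal_inf [set omega%:E | omega in [set omega : R |
    exists M : R, forall t v, 0 <= t -> X v ->
      nrm (S t v) <= M * expR (omega * t) * nrm v]].

Definition spectrally_stable (R : realType) (V : lmodType R[i]) (X : set V)
    (nrm : V -> R) (A : V -> V -> Prop) : Prop :=
  forall lambda : R[i], spectrum X nrm A lambda -> complex.Re lambda <= 0.

(* A semigroup is determined (up to equality of classes) by its generator, so
   when A generates one this says that the growth bound of exp (t A) is at
   most 0, and its negation that this growth bound is positive. *)
Definition linearly_stable (R : realType) (V : lmodType R[i]) (X : set V)
    (nrm : V -> R) (A : V -> V -> Prop) : Prop :=
  exists S : R -> V -> V,
    [/\ C0_semigroup X nrm S, is_generator X nrm S A
      & (growth_bound X nrm S <= 0)%E].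

(* R[i]^o is R[i] viewed as a vector space over itself; functions into it form
   a complex vector space for the pointwise operations. *)
Definition cfun2 (R : realType) := (R * R)%type -> R[i]^o.

Definition periodic2 (R : realType) (T : Type) (K1 K2 : R) (v : R * R -> T) :=
  forall x y, v (x + K1, y) = v (x, y) /\ v (x, y + K2) = v (x, y).

Definition lebesgue2 (R : realType) :=
  (@lebesgue_measure R \x @lebesgue_measure R)%E.

Definition cell (R : realType) (K1 K2 : R) : set (R * R) :=
  `[0, K1] `*` `[0, K2].

Definition L2periodic (R : realType) (K1 K2 : R) : set (cfun2 R) :=
  [set v : cfun2 R | [/\ periodic2 K1 K2 v,
               measurable_fun [set: measurableTypeR R * measurableTypeR R]
                 (fun z => complex.Re (v z) : R),
               measurable_fun [set: measurableTypeR R * measurableTypeR R]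
                 (fun z => complex.Im (v z) : R)
             & (\int[@lebesgue2 R]_(z in cell K1 K2)
                  ((complex.Re (v z)) ^+ 2 + (complex.Im (v z)) ^+ 2)%:E < +oo)%E]].

Definition L2norm (R : realType) (K1 K2 : R) (v : cfun2 R) : R :=
  Num.sqrt (\int[@lebesgue2 R]_(z in cell K1 K2)
              ((complex.Re (v z)) ^+ 2 + (complex.Im (v z)) ^+ 2)).

Definition X0 (R : realType) (K1 K2 : R) : set (cfun2 R) :=
  [set v : cfun2 R | L2periodic K1 K2 v /\
     {ae @lebesgue_measure R, forall y : R,
        \int[lebesgue_measure]_(x in `[0, K1]) complex.Re (v (x, y)) = 0 /\
        \int[lebesgue_measure]_(x in `[0, K1]) complex.Im (v (x, y)) = 0}].

Definition px (R : realType) (psi : R * R -> R) : R * R -> R :=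
  'D_((1, 0) : R * R) psi.
Definition py (R : realType) (psi : R * R -> R) : R * R -> R :=
  'D_((0, 1) : R * R) psi.

Fixpoint Cn (R : realType) (n : nat) (psi : R * R -> R) : Prop :=
  continuous psi /\
  if n is m.+1 then
    [/\ forall z, derivable psi z (1, 0), forall z, derivable psi z (0, 1),
        Cn m (px psi) & Cn m (py psi)]
  else True.

Definition test_fun (R : realType) (K1 K2 : R) (psi : R * R -> R) : Prop :=
  (forall n, Cn n psi) /\ periodic2 K1 K2 psi.

(* Complex-valued periodic distributions are described by their values on
   real-valued test functions; the value of a functional outside of [test_fun]
   is irrelevant. *)
Definition functional (R : realType) := (R * R -> R) -> R[i].

Definition dist_of (R : realType) (K1 K2 : R) (v : cfun2 R) : functional R :=
  fun psi =>
    Complex (\int[@lebesgue2 R]_(z in cell K1 K2) (complex.Re (v z) * psi z))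
            (\int[@lebesgue2 R]_(z in cell K1 K2) (complex.Im (v z) * psi z)).

Definition ddx (R : realType) (U : functional R) : functional R :=
  fun psi => - U (px psi).
Definition ddy (R : realType) (U : functional R) : functional R :=
  fun psi => - U (py psi).
Definition dmul (R : realType) (g : R -> R) (U : functional R) : functional R :=
  fun psi => U (fun z => g z.1 * psi z).

(* V = dx^-1 U: V is linear, its x-derivative is U, and its mean in x vanishes,
   i.e. V annihilates the test functions of y alone.  Every test function is the
   sum of such a function of y and of the x-derivative of a test function, so
   this determines V on test functions; V is therefore continuous when U is. *)
Definition is_dxinv (R : realType) (K1 K2 : R) (U V : functional R) : Prop :=
  [/\ forall (a : R) psi chi, test_fun K1 K2 psi -> test_fun K1 K2 chi ->
        V (fun z => a * psi z + chi z) = a%:C%C * V psi + V chi,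
      forall psi, test_fun K1 K2 psi -> ddx V psi = U psi
    & forall psi, test_fun K1 K2 psi ->
        (forall x x' y, psi (x, y) = psi (x', y)) -> V psi = 0].

(* Graph of A v = dx (- dx^2 + c - f'(phi)) v + dx^-1 dyy v with f'(r) = 3 r^2,
   on the maximal domain {v in X | A v in X}, A v being a periodic
   distribution. *)
Definition linKP (R : realType) (c : R) (phi : R -> R) (K1 K2 : R)
    (v w : cfun2 R) : Prop :=
  let v' := dist_of K1 K2 v in
  [/\ X0 K1 K2 v, X0 K1 K2 w
    & exists2 V : functional R,
        is_dxinv K1 K2 (ddy (ddy v')) V &
        forall psi, test_fun K1 K2 psi ->
          dist_of K1 K2 w psi =
          ddx (fun chi => - ddx (ddx v') chi
                          + dmul (fun x => c - 3 * phi x ^+ 2) v' chi) psi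
          + V psi].

Definition spectrally_unstable (R : realType) (c : R) (phi : R -> R)
    (K1 K2 : R) : Prop :=
  ~ spectrally_stable (X0 K1 K2) (L2norm K1 K2) (linKP c phi K1 K2).

Definition linearly_unstable (R : realType) (c : R) (phi : R -> R)
    (K1 K2 : R) : Prop :=
  ~ linearly_stable (X0 K1 K2) (L2norm K1 K2) (linKP c phi K1 K2).

(* Main.v *)
Require Import Defs.
From HB Require Import structures.
From mathcomp Require Import all_boot all_order all_algebra.
From mathcomp Require Import all_classical all_reals all_analysis.
From mathcomp Require Import ring lra.
From mathcomp Require Import complex measurable_realfun.

Set Implicit Arguments.
Unset Strict Implicit.
Unset Printing Implicit Defensive.

Import Order.TTheory GRing.Theory Num.Theory.
Import numFieldNormedType.Exports.
Local Open Scope classical_set_scope.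
Local Open Scope ring_scope.

(** The instability comes from an explicit separation of variables. Up to sign
    the wave is a positive profile f with f'' = c f - f^3, and the operator
    L = - d^2/dx^2 + q with q = c - 3 f^2 is its linearization. If z is a
    T-periodic function with
      - (L z')' + sg z + lam z' = 0,   lam > 0, sg = k^2 > 0,
    then v (x, y) = z'(x) cos (k y) has period 2 pi / k in y, mean zero in x,
    and satisfies A v = lam v: the term coming from the second derivative in y
    has the antiderivative - k^2 z (x) cos (k y) in x (eigen_linKP). An
    eigenvector with a positive eigenvalue destroys both kinds of stability;
    for the semigroup one has to show that it acts on v as exp (lam t)
    (linearly_unstable_eigen).

    The function z is found by continuation (growing_mode). Put h = (f^2)'.
    For all lam and all sg > 0 the bordered problem
      - (L z')' + sg z + lam z' = m h,   <h, z> = 1,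
    in the unknowns z and m has a solution (mode_exists), and it suffices to
    make the multiplier m vanish. The key fact is that L has only one negative
    direction, and that the form of L is nonnegative on the functions
    orthogonal to 1 and f^2 (form_ge0). Indeed these two functions span an
    invariant plane of L, which contains the negative eigenfunction and another
    eigenfunction, positive for L and with two zeros per period; the latter
    gives a sum of squares by Jacobi's transformation. As <h, z> = - <f^2, z'>,
    the condition <h, z> = 0 is the orthogonality of z' to f^2, whence the
    bordered problem has at most one solution, which by linear algebra on the
    initial values of the ordinary differential equation implies that it has
    one.

    When sg = lam = 0 the solution is explicit: z' is a multiple of f^2 minus
    its mean, and m is negative because the mean of f^2 lies below c
    (mean_lt, negative_mode). Comparing with that solution, m < 0 for small
    sg = lam. With this lam fixed, m > 0 for large sg by testing the equation
    with z (multiplier_gt0), and m depends continuously on sg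
    (mode_lipschitz), so that it vanishes somewhere in between.

    The profile enters only through the properties collected in the record
    dnoidal_wave, which follow from the definition of dn as a function of the
    inverse of the elliptic integral. *)

(** * Derivatives and integrals over a period *)

Section Calculus.
Context {R : realType}.
Notation mu := (@lebesgue_measure R).
Implicit Types (f g F G : R -> R) (a b x : R).

(** Derivability is required everywhere, so that the rules below have no side
    conditions besides that of the inverse. *)
Definition D1 F f := forall x, is_derive x (1:R) F (f x).

Lemma D1_eq F f g : D1 F f -> f =1 g -> D1 F g.
Proof. by move=> + /funext <-. Qed.

Lemma D1_cst a : D1 (fun=> a) (fun=> 0).
Proof. by move=> x; exact: is_derive_cst. Qed.

Lemma D1_id : D1 (fun x => x) (fun=> 1).
Proof. by move=> x; exact: is_derive_id. Qed.

Lemma D1D F f G g : D1 F f -> D1 G g ->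
  D1 (fun x => F x + G x) (fun x => f x + g x).
Proof. by move=> Ff Gg x; exact: is_deriveD. Qed.

Lemma D1N F f : D1 F f -> D1 (fun x => - F x) (fun x => - f x).
Proof. by move=> Ff x; exact: is_deriveN. Qed.

Lemma D1M F f G g : D1 F f -> D1 G g ->
  D1 (fun x => F x * G x) (fun x => f x * G x + F x * g x).
Proof.
move=> Ff Gg x; have := @is_deriveM _ _ F G x 1 _ _ (Ff x) (Gg x).
by move/is_derive_eq; apply; rewrite /GRing.scale/= addrC; congr (_ + _); rewrite mulrC.
Qed.

Lemma D1_comp F f G g : D1 F f -> D1 G g ->
  D1 (fun x => F (G x)) (fun x => f (G x) * g x).
Proof. by move=> Ff Gg x; exact: is_derive1_comp. Qed.

Lemma D1_continuous F f : D1 F f -> continuous F.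
Proof.
by move=> Ff x; apply/differentiable_continuous/derivable1_diffP; case: (Ff x).
Qed.

Lemma D1V F f : (forall x, F x != 0) -> D1 F f ->
  D1 (fun x => (F x)^-1) (fun x => - (F x) ^- 2 * f x).
Proof. by move=> F0 Ff x; exact: is_deriveV. Qed.

Lemma D1_derive1 F f : D1 F f -> forall x, derive1 F x = f x.
Proof. by move=> Ff x; rewrite derive1E; exact: derive_val. Qed.

Lemma D1_LR F f a b : D1 F f -> derivable_oo_LRcontinuous F a b.
Proof.
move=> Ff; split; first by move=> x _; case: (Ff x).
- by apply: cvg_at_right_filter; exact: D1_continuous Ff _.
- by apply: cvg_at_left_filter; exact: D1_continuous Ff _.
Qed.

Lemma itv_integrable f a b : continuous f -> mu.-integrable `[a, b] (EFin \o f).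
Proof.
move=> cf; apply: continuous_compact_integrable; first exact: segment_compact.
exact: continuous_subspaceT.
Qed.

Lemma FTC2 F f a b : a <= b -> D1 F f -> continuous f ->
  \int[mu]_(x in `[a, b]) f x = F b - F a.
Proof.
rewrite le_eqVlt => /predU1P[<-|ab] Ff cf.
  by rewrite set_itv1 Rintegral_set1 subrr.
rewrite /Rintegral (@continuous_FTC2 _ _ F)//.
- exact: continuous_subspaceT.
- exact: D1_LR Ff.
- by move=> x _; exact: D1_derive1.
Qed.

(** Signed, so that it is a primitive on the whole line, of which the elliptic
    integral [ellF] is an instance. *)
Definition prim g (p : R) : R :=
  if 0 <= p then \int[mu]_(t in `[0, p]) g t
  else - \int[mu]_(t in `[p, 0]) g t.

Lemma prim0 g : prim g 0 = 0.
Proof. by rewrite /prim lexx set_itv1 Rintegral_set1. Qed.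

Lemma Rintegral_itv_split g a b e : continuous g -> a <= b -> b <= e ->
  \int[mu]_(t in `[a, e]) g t =
  \int[mu]_(t in `[a, b]) g t + \int[mu]_(t in `[b, e]) g t.
Proof.
move=> cg ab be; apply/eqP; rewrite addrC -subr_eq; apply/eqP.
rewrite Rintegral_itvB ?bnd_simp//; last exact: itv_integrable.
rewrite Rintegral_itv_obnd_cbnd//.
by apply: integrableS (itv_integrable b e cg) => //; exact: subset_itv_oc_cc.
Qed.

Lemma D1_prim g : continuous g -> D1 (prim g) g.
Proof.
move=> cg x; pose N := `|x| + 1.
have N0 : 0 < N by rewrite ltr_wpDl.
have xN : -N < x < N.
  by rewrite -ltr_norml ltrDl.
have N0' : - N <= 0 by rewrite oppr_le0 ltW.
have primE (y : R) : - N < y -> prim g y =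
    \int[mu]_(t in `[-N, y]) g t - \int[mu]_(t in `[-N, 0]) g t.
  move=> Ny; rewrite /prim; case: leP => y0.
    rewrite (Rintegral_itv_split cg N0' y0).
    ring.
  rewrite (Rintegral_itv_split cg (ltW Ny) (ltW y0)).
  ring.
have /andP[Nx xN'] := xN.
have [dF F'] := continuous_FTC1_closed xN' (itv_integrable (- N) N cg) Nx (cg x).
rewrite derive1E in F'.
have dI : is_derive x (1:R) (fun y => \int[mu]_(t in `[-N, y]) g t) (g x).
  exact: DeriveDef.
have := @is_deriveB _ _ _ _ _ x 1 _ _ dI
  (is_derive_cst (\int[mu]_(t in `[-N, 0]) g t) x 1).
rewrite subr0; apply: near_eq_is_derive.
by have := lt_nbhsr Nx; apply: filterS => y Ny; rewrite primE.
Qed.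

Lemma primE g a : continuous g -> 0 <= a ->
  \int[mu]_(t in `[0, a]) g t = prim g a.
Proof. by move=> cg a0; rewrite /prim a0. Qed.

Lemma D1_cst_eq F : D1 F (fun=> 0) -> forall x y, F x = F y.
Proof. by move=> F0 x y; exact: is_derive_0_is_cst. Qed.

Lemma D1_uniq F G f a : D1 F f -> D1 G f -> F a = G a -> F =1 G.
Proof.
move=> Ff Gf ea x; apply/eqP; rewrite -subr_eq0; apply/eqP.
have D0 : D1 (fun x => F x - G x) (fun=> 0).
  by apply: D1_eq (D1D Ff (D1N Gf)) _ => y; rewrite subrr.
by rewrite (D1_cst_eq D0 x a) ea subrr.
Qed.

Lemma D1_MVT F f a b : a <= b -> D1 F f ->
  exists2 e, e \in `[a, b] & F b - F a = f e * (b - a).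
Proof.
move=> ab Ff; apply: MVT_segment => // x.
by apply/continuous_subspaceT; exact: D1_continuous Ff.
Qed.

Lemma D1_le F f a b : a <= b -> D1 F f ->
  (forall x, a <= x <= b -> 0 <= f x) -> F a <= F b.
Proof.
move=> ab Ff f0; have [e] := D1_MVT ab Ff.
rewrite in_itv/= => /f0 fe0 E; rewrite -subr_ge0 E.
by rewrite mulr_ge0// subr_ge0.
Qed.

Lemma D1X F f n : D1 F f -> D1 (fun x => F x ^+ n) (fun x => (F x ^+ n.-1 *+ n) * f x).
Proof.
move=> Ff; elim: n => [|n IH].
  apply: D1_eq (D1_cst 1) _ => x; by rewrite mulr0n mul0r.
under eq_fun do rewrite exprS.
apply: D1_eq (D1M Ff IH) _ => x /=.
case: n IH => [|n] _; first by rewrite !expr0 mulr0n mulr1n; ring.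
by rewrite exprS -[in LHS]mulr_natr -[in RHS]mulr_natr -natr1 /=; ring.
Qed.

Section Continuity.
Context {U : topologicalType}.
Implicit Types h k : U -> R.

Lemma cX h n : continuous h -> continuous (fun t => h t ^+ n).
Proof.
move=> ch; elim: n => [|n IH]; first by under eq_fun do rewrite expr0; exact: cst_continuous.
by under eq_fun do rewrite exprS; move=> t; apply: cvgM; [exact: ch|exact: IH].
Qed.

Lemma cD h k : continuous h -> continuous k -> continuous (fun t => h t + k t).
Proof. by move=> ch ck t; apply: cvgD; [exact: ch|exact: ck]. Qed.

Lemma cM h k : continuous h -> continuous k -> continuous (fun t => h t * k t).
Proof. by move=> ch ck t; apply: cvgM; [exact: ch|exact: ck]. Qed.

Lemma cN h : continuous h -> continuous (fun t => - h t).
Proof. by move=> ch t; apply: cvgN; exact: ch. Qed.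
End Continuity.

Lemma c_id : continuous (fun x : R => x).
Proof. by move=> x; exact: cvg_id. Qed.

End Calculus.

(** Syntax-directed continuity of polynomial expressions in functions that are
    known to be continuous or derivable. *)
Ltac cts := lazymatch goal with
  | |- continuous (fun _ => ?c) => exact: cst_continuous
  | |- continuous (fun x => @?A x + @?B x) => apply: (@cD _ _ A B); cts
  | |- continuous (fun x => @?A x * @?B x) => apply: (@cM _ _ A B); cts
  | |- continuous (fun x => - (@?A x)) => apply: (@cN _ _ A); cts
  | |- continuous (fun x => (@?A x) ^+ ?n) => apply: (@cX _ _ A n); cts
  | |- continuous (fun x => x) => exact: c_id
  | |- continuous _ => first [eassumption
      | match goal with H : D1 ?F _ |- continuous ?F => exact: (D1_continuous H) end
      | eapply D1_continuous; eassumption | idtac ]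
  end.

(** The derivative is first computed by unification; what remains is the
    pointwise comparison with the expected derivative. *)
Ltac der := lazymatch goal with
  | |- D1 (fun _ => ?c) _ => eapply (@D1_cst _ c)
  | |- D1 (fun x => @?A x + @?B x) _ => eapply (@D1D _ A _ B _); [der|der]
  | |- D1 (fun x => @?A x * @?B x) _ => eapply (@D1M _ A _ B _); [der|der]
  | |- D1 (fun x => - (@?A x)) _ => eapply (@D1N _ A _); der
  | |- D1 (fun x => (@?A x) ^+ ?n) _ => eapply (@D1X _ A _ n); der
  | |- D1 (fun x => x) _ => eapply D1_id
  | |- D1 _ _ => first [eassumption | idtac]
  end.
Ltac derive := eapply D1_eq; [der | move=> ? /=].
Ltac derive_as := eapply D1_eq; [der | ].

Section IntegralCalculus.
Context {R : realType}.
Notation mu := (@lebesgue_measure R).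
Implicit Types (f g F G : R -> R) (a b x : R).

Variables (T : R) (T_gt0 : 0 < T).

Definition period_int f : R := \int[mu]_(x in `[0, T]) f x.
Notation I := period_int.

Lemma I_FTC F f : D1 F f -> continuous f -> I f = F T - F 0.
Proof. by move=> Ff cf; rewrite /period_int (FTC2 (F := F))// ltW. Qed.

Lemma I_prim f : continuous f -> I f = prim f T.
Proof. by move=> cf; exact: primE cf (ltW T_gt0). Qed.

Lemma eq_I f g : (forall x, 0 <= x <= T -> f x = g x) -> I f = I g.
Proof. by move=> fg; apply: eq_Rintegral => x; rewrite inE/= in_itv/= => /fg. Qed.

Lemma ID f g : continuous f -> continuous g -> I (fun x => f x + g x) = I f + I g.
Proof. by move=> cf cg; rewrite /period_int RintegralD//; exact: itv_integrable. Qed.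

Lemma IZ a f : continuous f -> I (fun x => a * f x) = a * I f.
Proof. by move=> cf; rewrite /period_int RintegralZl//; exact: itv_integrable. Qed.

Lemma IN f : continuous f -> I (fun x => - f x) = - I f.
Proof.
by move=> cf; rewrite -mulN1r -IZ//; apply: eq_I => x _; rewrite mulN1r.
Qed.

Lemma I_ge0 f : (forall x, 0 <= x <= T -> 0 <= f x) -> 0 <= I f.
Proof. by move=> f0; apply: Rintegral_ge0 => x /=; rewrite in_itv/=; exact: f0. Qed.

Lemma I_le f g : continuous f -> continuous g ->
  (forall x, 0 <= x <= T -> f x <= g x) -> I f <= I g.
Proof.
move=> cf cg fg; rewrite -subr_ge0 -IN// -ID//; last exact: cN.
by apply: I_ge0 => x /fg; rewrite subr_ge0.
Qed.

(** A function vanishing on a whole interval has a derivative vanishing there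
    too, the endpoints being limits of interior points. *)
Lemma D1_zero F f : D1 F f -> continuous f ->
  (forall x, 0 <= x <= T -> F x = 0) -> forall x, 0 <= x <= T -> f x = 0.
Proof.
move=> Ff cf P0.
have fin : forall x, 0 < x < T -> f x = 0.
  move=> x /andP[x0 xT].
  have [_ <-] := Ff x.
  have [_ <-] := @is_derive_cst R R R 0 x 1.
  apply: near_eq_derive; near=> y.
  by rewrite P0//; apply/andP; split; near: y; [exact: lt_le_nbhsr|exact: lt_le_nbhsl].
have lim (e : R) (xs : R^nat) : (forall n, 0 < xs n < T) -> xs @ \oo --> e -> f e = 0.
  move=> xs0 xse; have h1 : f (xs n) @[n --> \oo] --> f e.
    exact: (cvg_comp _ _ xse (cf e)).
  have h2 : f (xs n) @[n --> \oo] --> (0 : R).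
    by rewrite (_ : (fun n => f (xs n)) = fun=> 0); [exact: cvg_cst|apply/funext => n; rewrite fin].
  exact: (cvg_unique _ h1 h2).
have vN : T * harmonic n @[n --> \oo] --> (0:R).
  by rewrite -[X in _ --> X](mulr0 T); apply: cvgMr; exact: cvg_harmonic.
move=> x /andP[]; rewrite le_eqVlt => /predU1P[<- _|x0].
  apply: (lim 0 (fun n => T * harmonic n.+1)).
    move=> n; rewrite /harmonic/= mulr_gt0//= gtr_pMr// invf_lt1// ltr1n //.
  by rewrite (cvg_shiftS (fun n => T * harmonic n)).
rewrite le_eqVlt => /predU1P[->|xT]; last by rewrite fin// x0.
apply: (lim T (fun n => T - T * harmonic n.+1)).
  move=> n; rewrite /harmonic/= subr_gt0 gtr_pMr// invf_lt1// ltr1n /=.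
  by rewrite ltrBlDr ltrDl mulr_gt0.
rewrite -[X in _ --> X]subr0; apply: cvgB; first exact: cvg_cst.
by rewrite (cvg_shiftS (fun n => T * harmonic n)).
Unshelve. all: by end_near. Qed.

Lemma I_eq0 f : continuous f -> (forall x, 0 <= x <= T -> 0 <= f x) -> I f = 0 ->
  forall x, 0 <= x <= T -> f x = 0.
Proof.
move=> cf f0 If0; apply: (D1_zero (D1_prim cf) cf) => y /andP[y0 yT].
apply/eqP; rewrite eq_le; apply/andP; split.
  rewrite -If0 /period_int (primE cf (ltW T_gt0)).
  apply: (D1_le yT (D1_prim cf)) => z /andP[yz zT].
  by rewrite f0// zT andbT (le_trans y0).
rewrite -(prim0 f); apply: (D1_le y0 (D1_prim cf)) => z /andP[z0 zy].
by rewrite f0// z0 (le_trans zy).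
Qed.

Lemma I_parts F f G g : D1 F f -> D1 G g -> continuous f -> continuous g ->
  F T * G T = F 0 * G 0 ->
  I (fun x => f x * G x) = - I (fun x => F x * g x).
Proof.
move=> Ff Gg cf cg FG; apply/eqP; rewrite -subr_eq0 opprK -ID; [|cts..].
by rewrite (I_FTC (D1M Ff Gg)) ?FG ?subrr//; cts.
Qed.

Definition period_ip f g := I (fun x => f x * g x).
Notation ip := period_ip.

Lemma ipC f g : ip f g = ip g f.
Proof. by apply: eq_I => x _; rewrite mulrC. Qed.

Lemma ipBl f g h : continuous f -> continuous g -> continuous h ->
  ip (fun x => f x - g x) h = ip f h - ip g h.
Proof. by move=> cf cg ch; rewrite /period_ip -IN -?ID; [apply: eq_I => x _; ring|cts..]. Qed.

Lemma ipZl a f h : continuous f -> continuous h ->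
  ip (fun x => a * f x) h = a * ip f h.
Proof. by move=> cf ch; rewrite /period_ip -IZ; [apply: eq_I => x _; ring|cts]. Qed.

Lemma ip_ge0 f : 0 <= ip f f.
Proof. by apply: I_ge0 => x _; rewrite -expr2 sqr_ge0. Qed.

Lemma ip_eq0 f : continuous f -> ip f f = 0 -> forall x, 0 <= x <= T -> f x = 0.
Proof.
move=> cf ff0 x xT; have : f x * f x = 0.
  apply: (@I_eq0 (fun x => f x * f x)) => //; first by cts.
  by move=> y _; rewrite -expr2 sqr_ge0.
by move/eqP; rewrite mulf_eq0 orbb => /eqP.
Qed.

(** The weighted inequality of arithmetic and geometric means, applied with both
    signs of f. *)
Lemma ip_AMGM f g e : continuous f -> continuous g -> 0 < e ->
  2 * `|ip f g| <= e * ip f f + e^-1 * ip g g.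
Proof.
move=> cf cg e0; have eN0 : e != 0 by rewrite gt_eqF.
have h s : s ^+ 2 = 1 -> 0 <= e * ip f f + e^-1 * ip g g - 2 * s * ip f g.
  move=> s1; rewrite /period_ip -!IZ -?ID -?IN -?ID; [|by cts..].
  apply: I_ge0 => x _.
  have -> : e * (f x * f x) + e^-1 * (g x * g x) - 2 * s * (f x * g x) =
    e * (f x - s * e^-1 * g x) ^+ 2 + (1 - s ^+ 2) * e^-1 * g x ^+ 2 by field.
  by rewrite s1 subrr !mul0r addr0 mulr_ge0 ?sqr_ge0// ltW.
have h1 := h 1 (expr1n _ _); have h2 := h (-1) (sqrr_sign _ 1).
by case: (ger0P (ip f g)) => _; lra.
Qed.

Lemma ip_D1 F f G g : D1 F f -> D1 G g -> continuous f -> continuous g ->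
  F T = F 0 -> G T = G 0 -> ip f G = - ip F g.
Proof. by move=> Ff Gg cf cg FT GT; apply: I_parts; rewrite ?FT ?GT. Qed.

Lemma ip_D1_self F f : D1 F f -> continuous f -> F T = F 0 -> ip f F = 0.
Proof. by move=> Ff cf FT; have := ip_D1 Ff Ff cf cf FT FT; rewrite [ip F f]ipC; lra. Qed.

End IntegralCalculus.

(** * Linear systems of ordinary differential equations *)

Section LinearODE.
Context {R : realType}.

(** An iterated integration of this bound yields the factorials in the
    convergence of the Picard iteration. *)
Lemma D1_norm_le (F f : R -> R) (C : R) (m : nat) (x : R) :
  D1 F f -> F 0 = 0 ->
  (forall t, `|t| <= `|x| -> `|f t| <= C * `|t| ^+ m) ->
  `|F x| <= C * `|x| ^+ m.+1 / m.+1%:R.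
Proof.
wlog x0 : x F f / 0 <= x.
  move=> H Ff F0 fC; case: (leP 0 x) => x0; first exact: (H x F f).
  have := H (- x) (fun t => F (- t)) (fun t => - f (- t)).
  rewrite opprK normrN; apply.
  - by rewrite oppr_ge0 ltW.
  - by apply: D1_eq (D1_comp Ff (D1N D1_id)) _ => t /=; rewrite mulrN1.
  - by rewrite oppr0.
  - by move=> t tx; rewrite normrN -[`|t|]normrN; apply: fC; rewrite normrN.
move=> Ff F0 fC.
have DC : D1 (fun t : R => C / m.+1%:R * t ^+ m.+1) (fun t => C * t ^+ m).
  derive; rewrite mulr1 /= -mulr_natr mul0r add0r.
  have : m.+1%:R != 0 :> R by rewrite pnatr_eq0.
  by move=> mn0; field.
have fC' t : 0 <= t <= x -> - (C * t ^+ m) <= f t <= C * t ^+ m.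
  move=> /andP[t0 tx]; rewrite -ler_norml -{2}(ger0_norm t0).
  by apply: fC; rewrite !ger0_norm.
rewrite (ger0_norm x0) ler_norml; apply/andP; split.
- rewrite lerNl -subr_ge0 opprK mulrAC addrC.
  have := D1_le x0 (D1D Ff DC); rewrite /= F0 expr0n mulr0 add0r; apply=> t ht.
  by case/andP: (fC' t ht) => + _; rewrite -subr_ge0 opprK.
- rewrite -subr_ge0 mulrAC.
  have := D1_le x0 (D1D DC (D1N Ff)); rewrite /= F0 expr0n mulr0 add0r oppr0.
  by apply=> t ht; case/andP: (fC' t ht) => _; rewrite -subr_ge0.
Qed.

Variables (n : nat) (A : 'I_n -> 'I_n -> R -> R) (eta : 'I_n -> R).
Hypothesis cA : forall i j, continuous (A i j).

Definition rhs (Y : 'I_n -> R -> R) (i : 'I_n) (x : R) : R :=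
  \sum_j A i j x * Y j x.

Fixpoint picard (m : nat) (i : 'I_n) : R -> R :=
  if m is m'.+1 then fun x => eta i + prim (rhs (picard m') i) x
  else fun=> eta i.

Lemma rhs_continuous Y : (forall j, continuous (Y j)) ->
  forall i, continuous (rhs Y i).
Proof.
move=> cY i x; rewrite /rhs.
apply: (@cvg_big R _ _ _ _ _ _ _ _ (fun j t => A i j t * Y j t)) => [|j _].
  by move=> z; apply: cvgD; [exact: cvg_fst|exact: cvg_snd].
by apply: cvgM; [exact: (@cA i j)|exact: (cY j)].
Qed.

Lemma picard_continuous m i : continuous (picard m i).
Proof.
elim: m i => [|m IH] i /=; first exact: cst_continuous.
have := D1_prim (@rhs_continuous _ IH i) => H.
by cts.
Qed.

Lemma D1_picard m i : D1 (picard m.+1 i) (rhs (picard m) i).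
Proof.
have := D1_prim (@rhs_continuous _ (@picard_continuous m) i) => H.
by apply: (D1_eq (D1D (D1_cst _) H)) => x; rewrite add0r.
Qed.

Lemma picard0 m i : picard m i 0 = eta i.
Proof. by case: m => //= m; rewrite prim0 addr0. Qed.

Lemma D1_sub F f G g : D1 F f -> D1 G g ->
  D1 (fun x : R => F x - G x) (fun x => f x - g x).
Proof. by move=> Ff Gg; derive. Qed.

Lemma rhsB Y Z i x : rhs Y i x - rhs Z i x = \sum_j A i j x * (Y j x - Z j x).
Proof. by rewrite /rhs -sumrB; apply: eq_bigr => j _; rewrite mulrBr. Qed.

Lemma continuous_bounded (f : R -> R) (L : R) : continuous f ->
  exists2 K, 0 <= K & forall x, `|x| <= L -> `|f x| <= K.
Proof.
move=> cf; case: (leP 0 L) => L0; last first.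
  by exists 0 => // x xL; have := le_trans (normr_ge0 x) xL; rewrite leNgt L0.
have cn : {within `[- L, L], continuous (fun x => `|f x|)}.
  by apply: continuous_subspaceT => x; apply: cvg_norm; exact: cf.
have [|c _ cM] := EVT_max _ cn.
  by rewrite (le_trans _ L0)// oppr_le0.
exists `|f c| => // x; rewrite ler_norml => xL; apply: cM.
by rewrite in_itv.
Qed.

Lemma finite_bounded (I : finType) (f : I -> R -> R) (L : R) :
  (forall i, continuous (f i)) ->
  exists2 K, 0 <= K & forall i x, `|x| <= L -> `|f i x| <= K.
Proof.
move=> cf; have /choice[K HK] : forall i, exists K, 0 <= K /\
    forall x, `|x| <= L -> `|f i x| <= K.
  by move=> i; have [K K0 HK] := continuous_bounded L (cf i); exists K.
exists (\sum_i K i); first by apply: sumr_ge0 => i _; case: (HK i).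
move=> i x xL; rewrite (bigD1 i)//=; have [_ /(_ x xL) H] := HK i.
rewrite (le_trans H)// lerDl; apply: sumr_ge0 => j _; by case: (HK j).
Qed.

Lemma rhs_norm_le (L K C x : R) (Z : 'I_n -> R -> R) i :
  (forall i j x, `|x| <= L -> `|A i j x| <= K) -> 0 <= K ->
  `|x| <= L -> (forall j, `|Z j x| <= C) ->
  `|\sum_j A i j x * Z j x| <= n%:R * K * C.
Proof.
move=> AK K0 xL ZC; apply: (le_trans (ler_norm_sum _ _ _)).
apply: (@le_trans _ _ (\sum_(j < n) K * C)).
  apply: ler_sum => j _; rewrite normrM; apply: ler_pM => //; exact: AK.
by rewrite sumr_const card_ord -[leRHS]mulrA mulr_natl.
Qed.

(** The increments of the Picard iteration are dominated by the terms of an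
    exponential series, uniformly on each bounded interval. *)
Lemma picard_dist (L : R) : exists (e : R^nat), e @ \oo --> (0 : R) /\
  forall i x m m', `|x| <= L -> (m <= m')%N ->
    `|picard m' i x - picard m i x| <= e m.
Proof.
have [K K0 AK] := @finite_bounded _ (fun ij : 'I_n * 'I_n => A ij.1 ij.2) L
  (fun ij => @cA ij.1 ij.2).
have [M M0 HM] := @finite_bounded _ (fun i x => picard 1 i x - picard 0 i x) L
  (fun i => cD (@picard_continuous 1 i) (cN (@picard_continuous 0 i))).
have AK' i j x : `|x| <= L -> `|A i j x| <= K by exact: (AK (i, j)).
have step m i x : `|x| <= L -> `|picard m.+1 i x - picard m i x| <=
    M * (n%:R * K) ^+ m / m`!%:R * `|x| ^+ m.
  elim: m i x => [|m IH] i x xL.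
    by rewrite !expr0 fact0 divr1 !mulr1; exact: HM.
  have := @D1_norm_le _ _ (M * (n%:R * K) ^+ m.+1 / m`!%:R) m x
    (D1_sub (D1_picard m.+1 i) (D1_picard m i)).
  rewrite !picard0 subrr => /(_ erefl).
  set C := M * _ / _; set C' := M * _ / _.
  have -> : C' * `|x| ^+ m.+1 = C * `|x| ^+ m.+1 / m.+1%:R.
    rewrite /C /C' factS natrM invfM; ring.
  apply => t tx; have tL := le_trans tx xL; rewrite rhsB.
  have := @rhs_norm_le L K _ t (fun j t => picard m.+1 j t - picard m j t) i AK' K0 tL (fun j => IH j t tL).
  move/le_trans; apply.
  rewrite le_eqVlt; apply/orP; left; apply/eqP; rewrite /C exprS; ring.
case: (leP 0 L) => L0; last first.
  exists (fun=> 0); split; first exact: cvg_cst.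
  by move=> i x m m' xL; have := le_trans (normr_ge0 x) xL; rewrite leNgt L0.
pose c := n%:R * K * L; pose s := series (exp_coeff c).
have c0 : 0 <= c by rewrite /c !mulr_ge0.
have sndecr : nondecreasing_seq s.
  by apply: nondecreasing_series => m _ _; exact: exp_coeff_ge0.
have scvg : s @ \oo --> expR c by exact: is_cvg_series_exp_coeff.
have sle m : s m <= expR c.
  by rewrite -(cvg_lim _ scvg)//; apply: nondecreasing_cvgn_le => //; apply/cvg_ex; exists (expR c).
exists (fun m => M * (expR c - s m)); split.
  rewrite -[X in _ --> X](mulr0 M) -(subrr (expR c)).
  by apply: cvgMr; apply: cvgB => //; exact: cvg_cst.
move=> i x m m' xL mm'.
apply: (@le_trans _ _ (M * (s m' - s m))); last first.
  by rewrite ler_wpM2l// lerD2r.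
rewrite -(subnK mm'); elim: (m' - m)%N => [|k IH].
  by rewrite add0n !subrr normr0 mulr0.
rewrite addSn -(subrKA (picard (k + m) i x)).
apply: (le_trans (ler_normD _ _)); apply: (le_trans (lerD (step _ _ _ xL) IH)).
rewrite /s seriesS -/s [exp_coeff _ _]/exp_coeff/=.
rewrite -addrA [leRHS]mulrDr lerD2r -!mulrA ler_wpM2l//.
rewrite mulrA [_ / _ * _]mulrAC /c [in leRHS]exprMn ler_wpM2r ?invr_ge0//.
by rewrite ler_wpM2l ?exprn_ge0 ?mulr_ge0// lerXn2r ?nnegrE.
Qed.

(** The Picard iterates converge uniformly on bounded intervals, so that their
    limit is continuous and solves the integral equation. *)
Theorem linear_ode : exists Y : 'I_n -> R -> R,
  (forall i, D1 (Y i) (rhs Y i)) /\ (forall i, Y i 0 = eta i).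
Proof.
pose Y i x := limn (fun m => picard m i x).
have cY i x : (fun m => picard m i x) @ \oo --> Y i x.
  have [e [e0 He]] := picard_dist `|x|.
  suff : cvgn (fun m => picard m i x) by [].
  apply/cauchy_cvgP/cauchy_exP => eps eps0.
  have [N _ HN] := (cvgrPdist_lt _ _).1 e0 _ eps0.
  exists (picard N i x); exists N => // m Nm /=; rewrite /ball/= distrC.
  apply: (le_lt_trans (He _ _ _ _ (lexx _) Nm)).
  by have /= := HN N (leqnn N); rewrite sub0r normrN; apply: le_lt_trans; exact: ler_norm.
have unif L : exists e : R^nat, e @ \oo --> (0 : R) /\
    forall i x m, `|x| <= L -> `|Y i x - picard m i x| <= e m.
  have [e [e0 He]] := picard_dist L; exists e; split => // i x m xL.
  have h : (fun m' => `|picard m' i x - picard m i x|) @ \oo --> `|Y i x - picard m i x|.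
    by apply: cvg_norm; apply: cvgB; [exact: cY|exact: cvg_cst].
  rewrite -(cvg_lim _ h)//; apply: limr_le; first by apply/cvg_ex; eexists; exact: h.
  by exists m => // m' mm'; exact: He.
have Ycont i : continuous (Y i).
  move=> x; have [e [e0 He]] := unif (`|x| + 1).
  apply/cvgrPdist_lt => eps eps0.
  have eps3 : 0 < eps / 3 by rewrite divr_gt0.
  have [N _ HN] := (cvgrPdist_lt _ _).1 e0 _ eps3.
  have {}HN : e N < eps / 3.
    by have /= := HN N (leqnn N); rewrite sub0r normrN; apply: le_lt_trans; exact: ler_norm.
  have := (cvgrPdist_lt _ _).1 (@picard_continuous N i x) _ eps3.
  move=> /(_ _)cp; near=> t.
  have tL : `|t| <= `|x| + 1.
    rewrite -(subrK x t) (le_trans (ler_normD _ _))// addrC lerD2l.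
    rewrite distrC; near: t.
    exact: ((cvgrPdist_le _ _).1 (@cvg_id _ (nbhs x)) _ (@ltr01 R)).
  have xL : `|x| <= `|x| + 1 by rewrite lerDl.
  have H1 := He i x N xL; have H2 := He i t N tL.
  have H3 : `|picard N i x - picard N i t| < eps / 3 by near: t; exact: cp.
  rewrite (_ : Y i x - Y i t = (Y i x - picard N i x) +
    (picard N i x - picard N i t) + - (Y i t - picard N i t)); last by ring.
  apply: (le_lt_trans (ler_normD _ _)); rewrite normrN.
  apply: (le_lt_trans (lerD (ler_normD _ _) (lexx _))).
  lra.
exists Y; split; last first.
  move=> i; apply/esym; have := cY i 0; under eq_fun do rewrite picard0.
  move=> h; apply: (cvg_unique _ _ h) => //; exact: cvg_cst.
move=> i; have cr := @rhs_continuous _ Ycont i.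
have DZ : D1 (fun x => eta i + prim (rhs Y i) x) (rhs Y i).
  by have H := D1_prim cr; derive; rewrite add0r.
suff -> : Y i = fun x => eta i + prim (rhs Y i) x by [].
apply/funext => x.
have [e [e0 He]] := unif `|x|.
have [K K0 AK] := @finite_bounded _ (fun ij : 'I_n * 'I_n => A ij.1 ij.2) `|x|
  (fun ij => @cA ij.1 ij.2).
have AK' i' j t : `|t| <= `|x| -> `|A i' j t| <= K by exact: (AK (i', j)).
have c1 : (fun m => picard m.+1 i x) @ \oo --> Y i x.
  by rewrite (cvg_shiftS (fun m => picard m i x)); exact: cY.
apply: (cvg_unique _ c1) => //.
have h : (fun m => n%:R * K * e m * `|x|) @ \oo --> (0 : R).
  rewrite -[X in _ --> X](mul0r `|x|); apply: cvgMl.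
  by rewrite -[X in _ --> X](mulr0 (n%:R * K)); exact: cvgMr.
apply/cvgrPdist_lt => eps eps0.
have := (cvgrPdist_lt _ _).1 h _ eps0 => /(_ _); apply: filterS => m.
rewrite sub0r normrN; apply: le_lt_trans; rewrite (le_trans _ (ler_norm _))//.
have := @D1_norm_le _ _ (n%:R * K * e m) 0 x (D1_sub DZ (D1_picard m i)).
rewrite prim0 picard0 addr0 subrr => /(_ erefl) H.
rewrite -[leRHS]divr1 -[`|x| in leRHS]expr1; apply: H => t tx; rewrite expr0 mulr1 rhsB.
apply: (@rhs_norm_le `|x| K (e m) t (fun j t => Y j t - picard m j t)) => // j.
exact: He.
Unshelve. all: by end_near. Qed.

End LinearODE.

(** * The elliptic functions and the dnoidal profile *)

Section Elliptic.
Context {R : realType}.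
Variable kappa : R.
Hypothesis kappa01 : 0 < kappa < 1.
Notation mu := (@lebesgue_measure R).

Lemma D1_sqrt (F f : R -> R) : D1 F f -> (forall x, 0 < F x) ->
  D1 (fun x => Num.sqrt (F x)) (fun x => (2 * Num.sqrt (F x))^-1 * f x).
Proof.
move=> Ff F0 x; apply: (@is_derive1_comp R Num.sqrt F); last exact: Ff.
exact: is_derive1_sqrt.
Qed.

Lemma D1_sin : D1 (@sin R) cos. Proof. by move=> x; exact: is_derive_sin. Qed.
Lemma D1_cos : D1 (@cos R) (fun x => - sin x).
Proof. by move=> x; exact: is_derive_cos. Qed.

Definition Delta (t : R) : R := 1 - kappa ^+ 2 * sin t ^+ 2.

Lemma kappa2 : 0 < kappa ^+ 2 < 1.
Proof. by case/andP: kappa01 => k0 k1; rewrite exprn_gt0//= expr_lt1// ltW. Qed.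

Lemma Delta_gt0 t : 0 < Delta t.
Proof.
have /andP[k0 k1] := kappa2; rewrite /Delta sin2cos2.
have := sqr_ge0 (cos t); have := cos2Dsin2 t; have := sqr_ge0 (sin t); nra.
Qed.

Lemma Delta_le1 t : Delta t <= 1.
Proof.
have /andP[k0 k1] := kappa2; rewrite /Delta gerBl mulr_ge0 ?sqr_ge0//.
Qed.

Definition ellg (t : R) : R := (Num.sqrt (Delta t))^-1.

Lemma sqrtDelta_gt0 t : 0 < Num.sqrt (Delta t).
Proof. by rewrite sqrtr_gt0 Delta_gt0. Qed.

Lemma D1_Delta : D1 Delta (fun t => - (2 * kappa ^+ 2 * sin t * cos t)).
Proof.
have H := D1_sin; rewrite /Delta; derive.
by rewrite mulr2n; ring.
Qed.

Lemma ellg_continuous : continuous ellg.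
Proof.
move=> t; apply: cvgV; first by rewrite gt_eqF ?sqrtDelta_gt0.
exact: (D1_continuous (D1_sqrt D1_Delta Delta_gt0)).
Qed.

Lemma ellg_ge1 t : 1 <= ellg t.
Proof.
rewrite /ellg invf_ge1 ?sqrtDelta_gt0//.
by rewrite -[leRHS]sqrtr1 ler_sqrt// Delta_le1.
Qed.

Lemma ellFE : ellF kappa = prim ellg.
Proof. by []. Qed.

Lemma D1_ellF : D1 (ellF kappa) ellg.
Proof. by rewrite ellFE; exact: (D1_prim ellg_continuous). Qed.

Lemma ellF0 : ellF kappa 0 = 0.
Proof. by rewrite ellFE prim0. Qed.

Lemma ellFN p : ellF kappa (- p) = - ellF kappa p.
Proof.
have h1 : D1 (fun p => ellF kappa (- p)) (fun p => - ellg p).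
  apply: D1_eq (D1_comp D1_ellF (D1N D1_id)) _ => t /=.
  by rewrite /ellg /Delta sinN sqrrN mulrN1.
by apply: (D1_uniq (a := 0) h1 (D1N D1_ellF)); rewrite oppr0 ellF0 oppr0.
Qed.

(** The integrand is at least 1; this makes the elliptic integral injective and
    unbounded, hence bijective. *)
Lemma ellF_expand a b : a <= b -> b - a <= ellF kappa b - ellF kappa a.
Proof.
move=> ab; have [e _ ->] := D1_MVT ab D1_ellF.
by rewrite ler_peMl ?subr_ge0// ellg_ge1.
Qed.

Lemma ellF_lt a b : a < b -> ellF kappa a < ellF kappa b.
Proof.
move=> ab; rewrite -subr_gt0 (lt_le_trans _ (ellF_expand (ltW ab)))//.
by rewrite subr_gt0.
Qed.

Lemma ellF_inj : injective (ellF kappa).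
Proof.
move=> a b ab; case: (ltgtP a b) => // /ellF_lt; by rewrite ab ltxx.
Qed.

Lemma ellF_surj z : exists p, ellF kappa p = z.
Proof.
have h := ellF_expand (normr_ge0 z); rewrite ellF0 !subr0 in h.
have zz : - `|z| <= `|z| by rewrite ge0_cp.
have [||p _ <-] := @IVT R (ellF kappa) (- `|z|) `|z| z zz _ _; last by exists p.
  by apply: continuous_subspaceT; exact: D1_continuous D1_ellF.
rewrite ellFN minElt maxElt.
have h0 : 0 <= ellF kappa `|z| by rewrite (le_trans _ h).
have := ler_norm z; have := ler_norm (- z); rewrite normrN.
by case: ifPn => ?; move=> ? ?; apply/andP; split; lra.
Qed.

Lemma amK z : ellF kappa (jacobi_am kappa z) = z.
Proof. exact: (@xgetPex _ 0 [set p | ellF kappa p = z] (ellF_surj z)). Qed.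

Lemma ellFK p : jacobi_am kappa (ellF kappa p) = p.
Proof. by apply: ellF_inj; rewrite amK. Qed.

Lemma dnE z : jacobi_dn kappa z = Num.sqrt (Delta (jacobi_am kappa z)).
Proof. by []. Qed.

Lemma D1_am : D1 (jacobi_am kappa) (jacobi_dn kappa).
Proof.
move=> z; rewrite dnE -[Num.sqrt _]invrK -/(ellg _) -{1}(amK z).
apply: (@is_derive_inverse R (ellF kappa)).
- by near=> p; exact: ellFK.
- by near=> p; exact: (D1_continuous D1_ellF).
- exact: D1_ellF.
- by rewrite gt_eqF// (lt_le_trans ltr01)// ellg_ge1.
Unshelve. all: by end_near. Qed.

Lemma D1_dn : D1 (jacobi_dn kappa) (fun z =>
  - (kappa ^+ 2 * sin (jacobi_am kappa z) * cos (jacobi_am kappa z))).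
Proof.
have H := D1_sqrt (D1_comp D1_Delta D1_am) (fun x => Delta_gt0 (jacobi_am kappa x)).
apply: (D1_eq H) => z /=; rewrite dnE.
have := sqrtDelta_gt0 (jacobi_am kappa z); set s := Num.sqrt _ => s0.
have sN0 : s != 0 by rewrite gt_eqF.
by field.
Qed.

Lemma dn_gt0 z : 0 < jacobi_dn kappa z.
Proof. by rewrite dnE sqrtDelta_gt0. Qed.

Lemma dn2 z : jacobi_dn kappa z ^+ 2 = 1 - kappa ^+ 2 * sin (jacobi_am kappa z) ^+ 2.
Proof. by rewrite dnE sqr_sqrtr// ltW// Delta_gt0. Qed.

(** By the substitution z = sin t; the singular endpoint is reached as a limit of the
    intervals [0, sin t] with t < pi / 2. *)
Lemma ellK_ellF : ellK kappa = ellF kappa (pi / 2).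
Proof.
pose G (z : R) := (Num.sqrt ((1 - z ^+ 2) * (1 - kappa ^+ 2 * z ^+ 2)))^-1.
have pi2 : 0 < pi / 2 :> R by rewrite divr_gt0 ?pi_gt0.
pose t (n : nat) : R := pi / 2 - pi / 2 * harmonic n.
have h01 n : 0 < (harmonic n : R) <= 1.
  by rewrite /harmonic/= invr_gt0 ltr0n/= invf_le1 ?ltr0n// ler1n.
have t0 n : 0 <= t n by have := h01 n; rewrite /t; nra.
have tpi n : t n < pi / 2 by have := h01 n; rewrite /t; nra.
have tcvg : t @ \oo --> (pi / 2 : R).
  rewrite -[X in _ --> X]subr0; apply: cvgB; first exact: cvg_cst.
  by rewrite -[X in _ --> X](mulr0 (pi / 2)); apply: cvgMr; exact: cvg_harmonic.
have tnd : nondecreasing_seq t.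
  move=> n m nm; rewrite /t lerD2l lerN2 ler_wpM2l ?(ltW pi2)//.
  by rewrite /harmonic/= lef_pV2 ?posrE ?ltr0n// ler_nat ltnS.
have itvP' (x : R) : 0 <= x <= pi / 2 -> x \in `[- (pi / 2), pi / 2].
  by move=> /andP[x0 x1]; rewrite in_itv/= x1 andbT (le_trans _ x0)// oppr_le0 ltW.
have sin_le (x y : R) : 0 <= x -> x <= y -> y <= pi / 2 -> sin x <= sin y.
  move=> x0; rewrite le_eqVlt => /predU1P[->//|xy] y1; rewrite ltW// ltr_sin//.
    by apply: itvP'; rewrite x0 (le_trans (ltW xy)).
  by apply: itvP'; rewrite y1 (le_trans x0 (ltW xy)).
have sin_lt (x y : R) : 0 <= x -> x < y -> y <= pi / 2 -> sin x < sin y.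
  move=> x0 xy y1; rewrite ltr_sin//.
    by apply: itvP'; rewrite x0 (le_trans (ltW xy)).
  by apply: itvP'; rewrite y1 (le_trans x0 (ltW xy)).
have sint1 n : sin (t n) < 1 by rewrite -sin_pihalf sin_lt.
have sint0 n : 0 <= sin (t n) by rewrite -sin0 sin_le// ltW.
have /andP[k0 k1] := kappa2.
have Gpos (z : R) : -1 < z < 1 -> 0 < (1 - z ^+ 2) * (1 - kappa ^+ 2 * z ^+ 2).
  move=> /andP[z1 z2]; have h1 : 0 < (1 - z) * (1 + z) by rewrite mulr_gt0//; lra.
  have h2 : 0 < 1 - z ^+ 2 by lra.
  by have h3 := mulr_gt0 k0 h2; rewrite mulr_gt0//; lra.
have pc : continuous (fun z : R => (1 - z ^+ 2) * (1 - kappa ^+ 2 * z ^+ 2)) by cts.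
have Gc (z : R) : -1 < z < 1 -> {for z, continuous G}.
  move=> z1; apply: cvgV; first by rewrite gt_eqF// sqrtr_gt0; exact: Gpos.
  exact: (continuous_comp (pc z) (@sqrt_continuous R _)).
have GE (x : R) n : 0 <= x -> x <= t n -> G (sin x) * cos x = ellg x.
  move=> x0 x1; rewrite /G /ellg /Delta -cos2sin2.
  have cx : 0 < cos x.
    apply: cos_gt0_pihalf; rewrite (le_lt_trans x1)// andbT.
    by rewrite (lt_le_trans _ x0)// oppr_lt0.
  rewrite sqrtrM ?sqr_ge0// sqrtr_sqr gtr0_norm//.
  by rewrite invfM mulrAC mulVf ?mul1r// gt_eqF.
have sin' : derive1 (@sin R) = cos.
  by apply/funext => x; rewrite derive1E; exact: derive_val.
have subst n : (\int[mu]_(z in `[0%R, sin (t n)]) (G z)%:E)%E = (ellF kappa (t n))%:E.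
  rewrite -{1}(@sin0 R) integration_by_substitution_increasing//.
  - rewrite sin' ellFE -primE//; last exact: ellg_continuous.
    rewrite /Rintegral fineK; last first.
      by apply: integrable_fin_num => //; exact: itv_integrable ellg_continuous.
    apply: eq_integral => x; rewrite inE/= in_itv/= => /andP[x0 x1].
    by rewrite -(GE x n x0 x1).
  - move=> x y; rewrite !in_itv/= => /andP[x0 _] /andP[_ y1] xy.
    by apply: sin_lt => //; rewrite (le_trans y1)// ltW.
  - by move=> x _; rewrite sin'; exact: continuous_cos.
  - by rewrite sin'; apply/cvg_ex; exists (cos 0); apply: cvg_at_right_filter; exact: continuous_cos.
  - by rewrite sin'; apply/cvg_ex; exists (cos (t n)); apply: cvg_at_left_filter; exact: continuous_cos.
  - exact: D1_LR D1_sin.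
  - rewrite sin0; apply/subspace_continuousP => z /=; rewrite in_itv/= => /andP[z0 z1].
    apply: cvg_within_filter; apply: Gc.
    by rewrite (le_lt_trans z1 (sint1 n)) andbT (lt_le_trans _ z0)// oppr_lt0.
have cup : \bigcup_n `[0, sin (t n)]%classic = `[0, 1[%classic :> set R.
  apply/seteqP; split=> z /=.
    by move=> [n _ /=]; rewrite !in_itv/= => /andP[-> z1]; rewrite (le_lt_trans z1).
  rewrite in_itv/= => /andP[z0 z1].
  have sc : sin (t n) @[n --> \oo] --> (1 : R).
    by rewrite -sin_pihalf; apply: (cvg_comp _ _ tcvg (@continuous_sin R _)).
  have [N _ HN] := (cvgr_gt _ sc) _ z1.
  by exists N => //=; rewrite in_itv/= z0 ltW//; exact: (HN N (leqnn N)).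
have mG : measurable_fun (`[0, 1[%classic : set R) G.
  apply: (@measurable_funS _ _ _ _ (`]-1, 1[%classic : set R)) => //.
    by move=> z /=; rewrite !in_itv/= => /andP[z0 ->]; rewrite (lt_le_trans _ z0)// oppr_lt0.
  apply: open_continuous_measurable_fun; first exact: interval_open.
  by move=> z; rewrite inE/= in_itv/=; exact: Gc.
have lim1 : (ellF kappa (t n))%:E @[n --> \oo] --> (ellF kappa (pi / 2))%:E.
  apply: cvg_EFin; first exact: nearW.
  by apply: (cvg_comp _ _ tcvg); exact: (D1_continuous D1_ellF).
have lim2 : (\int[mu]_(z in `[0%R, sin (t n)]) (G z)%:E)%E @[n --> \oo] -->
    (\int[mu]_(z in `[0%R, 1%R[) (G z)%:E)%E.
  rewrite -cup; apply: ge0_nondecreasing_set_cvg_integral.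
  - move=> n m nm; rewrite subsetEset => z /=; rewrite !in_itv/= => /andP[-> z1].
    by rewrite (le_trans z1)// sin_le// ?tnd// ltW.
  - by move=> n; exact: measurable_itv.
  - move=> n; apply/measurable_EFinP; apply: measurable_funS mG => //.
    by move=> z /=; rewrite !in_itv/= => /andP[-> z1]; rewrite (le_lt_trans z1).
  - by move=> n z _; rewrite lee_fin invr_ge0 sqrtr_ge0.
rewrite /ellK /Rintegral -integral_itv_bndo_bndc; last exact/measurable_EFinP.
have E : (fun n => \int[mu]_(z in `[0%R, sin (t n)]) (G z)%:E)%E =
    fun n => (ellF kappa (t n))%:E by apply/funext => n; exact: subst.
rewrite E in lim2.
by rewrite -/(G _) (cvg_unique _ lim2 lim1).
Qed.

Lemma ellF_reflect p : ellF kappa (pi - p) = 2 * ellK kappa - ellF kappa p.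
Proof.
have h1 : D1 (fun p => ellF kappa (pi - p)) (fun p => - ellg p).
  have D : D1 (fun p : R => pi - p) (fun=> -1) by derive; rewrite add0r.
  apply: D1_eq (D1_comp D1_ellF D) _ => t /=.
  by rewrite /ellg /Delta sinB sinpi cospi mul0r sub0r mulN1r opprK mulrN1.
have h2 : D1 (fun p => 2 * ellK kappa - ellF kappa p) (fun p => - ellg p).
  by apply: D1_eq (D1D (D1_cst _) (D1N D1_ellF)) _ => t /=; rewrite add0r.
apply: (D1_uniq (a := pi / 2) h1 h2); rewrite ellK_ellF.
by have -> : pi - pi / 2 = pi / 2 :> R by [field]; ring.
Qed.

Lemma am_reflect z : jacobi_am kappa (2 * ellK kappa - z) = pi - jacobi_am kappa z.
Proof. by apply: ellF_inj; rewrite amK ellF_reflect amK. Qed.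

Lemma am0 : jacobi_am kappa 0 = 0.
Proof. by apply: ellF_inj; rewrite amK ellF0. Qed.

Lemma am_le a b : a <= b -> jacobi_am kappa a <= jacobi_am kappa b.
Proof. by move=> ab; apply: (D1_le ab D1_am) => x _; rewrite ltW// dn_gt0. Qed.

Lemma ellK_gt0 : 0 < ellK kappa.
Proof.
by rewrite ellK_ellF -ellF0 ellF_lt// divr_gt0 ?pi_gt0.
Qed.

Lemma am_2K : jacobi_am kappa (2 * ellK kappa) = pi.
Proof. by rewrite -(subr0 (2 * _)) am_reflect am0 subr0. Qed.

Section Profile.
Variables phi1 alpha T : R.
Hypothesis phi1_gt0 : 0 < phi1.
Hypothesis alphaE : alpha = phi1 / Num.sqrt 2.
Hypothesis TE : T = 2 * ellK kappa / alpha.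

Definition dnoidal (x : R) : R := phi1 * jacobi_dn kappa (alpha * x).
Definition dnoidal' (x : R) : R := - (phi1 * alpha * kappa ^+ 2 *
  sin (jacobi_am kappa (alpha * x)) * cos (jacobi_am kappa (alpha * x))).
Let theta x := jacobi_am kappa (alpha * x).

Lemma alpha_gt0 : 0 < alpha.
Proof. by rewrite alphaE divr_gt0// sqrtr_gt0. Qed.

Lemma alpha2 : alpha ^+ 2 = phi1 ^+ 2 / 2.
Proof. by rewrite alphaE exprMn exprVn sqr_sqrtr. Qed.

Lemma alphaT : alpha * T = 2 * ellK kappa.
Proof. by rewrite TE mulrC mulfVK// gt_eqF// alpha_gt0. Qed.

Lemma period_gt0 : 0 < T.
Proof. by rewrite TE divr_gt0 ?alpha_gt0// mulr_gt0// ellK_gt0. Qed.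

(** All symmetries of the profile come from this symmetry of the amplitude. *)
Lemma theta_reflect x : theta (T - x) = pi - theta x.
Proof. by rewrite /theta mulrBr alphaT am_reflect. Qed.

Lemma dnoidal_gt0 x : 0 < dnoidal x.
Proof. by rewrite mulr_gt0// dn_gt0. Qed.

Lemma D1_scale : D1 (fun x => alpha * x) (fun=> alpha).
Proof. by derive; rewrite mul0r add0r mulr1. Qed.

Lemma D1_theta : D1 theta (fun x => alpha * jacobi_dn kappa (alpha * x)).
Proof. by apply: D1_eq (D1_comp D1_am D1_scale) _ => x /=; rewrite mulrC. Qed.

Lemma D1_dnoidal : D1 dnoidal dnoidal'.
Proof.
apply: D1_eq (D1M (D1_cst phi1) (D1_comp D1_dn D1_scale)) _ => x /=.
rewrite /dnoidal'; ring.
Qed.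

Lemma dnoidal2 x : dnoidal x ^+ 2 = phi1 ^+ 2 * (1 - kappa ^+ 2 * sin (theta x) ^+ 2).
Proof. by rewrite exprMn dn2. Qed.

Lemma dnoidal_T : dnoidal T = dnoidal 0.
Proof. by rewrite /dnoidal !dnE alphaT am_2K mulr0 am0 /Delta sinpi sin0. Qed.

Lemma dnoidal'_T : dnoidal' T = dnoidal' 0.
Proof. by rewrite /dnoidal' alphaT am_2K mulr0 am0 sinpi sin0 !mulr0 !mul0r. Qed.

Lemma dnoidal_reflect x : dnoidal (T - x) = dnoidal x.
Proof.
rewrite /dnoidal !dnE -/(theta (T - x)) -/(theta x) theta_reflect /Delta.
by rewrite sinB sinpi cospi mul0r sub0r mulN1r opprK.
Qed.

Lemma dnoidal'_reflect x : dnoidal' (T - x) = - dnoidal' x.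
Proof.
rewrite /dnoidal' -/(theta (T - x)) -/(theta x) theta_reflect.
by rewrite sinB cosB sinpi cospi; ring.
Qed.

Lemma D1_dnoidal' : D1 dnoidal'
  (fun x => alpha ^+ 2 * (2 - kappa ^+ 2) * dnoidal x - dnoidal x ^+ 3).
Proof.
have hs := D1_comp D1_sin D1_theta; have hc := D1_comp D1_cos D1_theta.
have h := D1N (D1M (D1M (D1_cst (phi1 * alpha * kappa ^+ 2)) hs) hc).
apply: (D1_eq h) => x /=; rewrite [dnoidal x ^+ 3]exprS dnoidal2 /dnoidal.
have -> : phi1 ^+ 2 = 2 * alpha ^+ 2 by rewrite alpha2; field.
rewrite -/(theta x).
have := cos2Dsin2 (theta x); set s := sin _; set c := cos _ => cs.
set d := jacobi_dn _ _; apply/eqP; rewrite -subr_eq0; apply/eqP.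
transitivity (- (phi1 * alpha ^+ 2 * kappa ^+ 2 * d) * (c ^+ 2 + s ^+ 2 - 1)); first by ring.
by rewrite cs subrr mulr0.
Qed.

Lemma dnoidal'_sqr x : dnoidal' x ^+ 2 = - (dnoidal x ^+ 4 / 2) +
  alpha ^+ 2 * (2 - kappa ^+ 2) * dnoidal x ^+ 2 - (1 - kappa ^+ 2) * phi1 ^+ 4 / 2.
Proof.
rewrite (exprM (dnoidal x) 2 2) dnoidal2 /dnoidal' -/(theta x) (exprM phi1 2 2).
have -> : phi1 ^+ 2 = 2 * alpha ^+ 2 by rewrite alpha2; field.
rewrite sqrrN !exprMn [cos _ ^+ 2]cos2sin2.
have -> : phi1 ^+ 2 = 2 * alpha ^+ 2 by rewrite alpha2; field.
by field.
Qed.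

(** On [0, T] the amplitude runs through [0, pi], where sin^2 takes a value
    l between 0 and 1 only at p0 = asin (sqrt l) and at pi - p0. *)
Lemma dnoidal_level v : phi1 ^+ 2 * (1 - kappa ^+ 2) < v < phi1 ^+ 2 ->
  exists x0, [/\ 0 <= x0 <= T - x0, dnoidal x0 ^+ 2 = v, dnoidal' x0 != 0 &
    forall x, 0 <= x <= T -> dnoidal x ^+ 2 = v -> x = x0 \/ x = T - x0].
Proof.
move=> /andP[v0 v1]; have /andP[k0 k1] := kappa2.
have p2 : 0 < phi1 ^+ 2 by rewrite exprn_gt0.
pose l := (1 - v / phi1 ^+ 2) / kappa ^+ 2.
have vE : v = phi1 ^+ 2 * (1 - kappa ^+ 2 * l).
  have kN : kappa != 0 by case/andP: kappa01 => h _; rewrite gt_eqF.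
  by rewrite /l; field; rewrite kN gt_eqF.
have l0 : 0 < l by rewrite divr_gt0// subr_gt0 ltr_pdivrMr// mul1r.
have l1 : l < 1.
  rewrite /l ltr_pdivrMr// mul1r ltrBlDr -ltrBlDl ltr_pdivlMr//.
  by rewrite mulrC.
pose r := Num.sqrt l; have r0 : 0 < r by rewrite sqrtr_gt0.
have r1 : r < 1 by rewrite -sqrtr1 ltr_sqrt.
have rI : r \in `[-1, 1] by rewrite in_itv/=; lra.
pose p0 := asin r.
have sp : sin p0 = r by rewrite asinK.
have p0lt : p0 < pi / 2 by apply: asin_ltpi2; lra.
have p0gt : - (pi / 2) < p0 by apply: asin_gtNpi2; lra.
have cp : 0 < cos p0 by apply: cos_gt0_pihalf; rewrite p0gt.
have pi0 := @pi_gt0 R.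
have p0_gt0 : 0 < p0.
  rewrite -ltr_sin ?sin0 ?sp// in_itv/=; apply/andP; split; lra.
have a0 := alpha_gt0.
pose x0 := ellF kappa p0 / alpha.
have ax0 : alpha * x0 = ellF kappa p0 by rewrite /x0 mulrC mulfVK// gt_eqF.
have tx0 : theta x0 = p0 by rewrite /theta ax0 ellFK.
have x00 : 0 < x0 by rewrite divr_gt0// -ellF0 ellF_lt.
have x0T : x0 <= T - x0.
  rewrite -(ler_pM2l a0) mulrBr alphaT ax0 ellK_ellF.
  have := ellF_lt p0lt; lra.
exists x0; split.
- by rewrite ltW.
- by rewrite dnoidal2 tx0 sp sqr_sqrtr ?ltW.
- rewrite /dnoidal' -/(theta x0) tx0 sp oppr_eq0.
  exact: lt0r_neq0 (mulr_gt0 (mulr_gt0 (mulr_gt0 (mulr_gt0 phi1_gt0 a0) k0) r0) cp).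
move=> x /andP[xge0 xT]; rewrite dnoidal2 vE => h.
have st : sin (theta x) ^+ 2 = l.
  apply: (mulfI (lt0r_neq0 k0)); have := mulfI (lt0r_neq0 p2) h; lra.
have th0 : 0 <= theta x.
  by rewrite -am0 am_le// mulr_ge0// ltW.
have thpi : theta x <= pi.
  by rewrite -am_2K am_le// -alphaT ler_pM2l.
have c2 : cos (theta x) ^+ 2 = cos p0 ^+ 2.
  by rewrite !cos2sin2 st sp sqr_sqrtr// ltW.
have thI : theta x \in `[0, pi] by rewrite in_itv/= th0.
have theta_inj y z : theta y = theta z -> y = z.
  move=> /(congr1 (ellF kappa)); rewrite !amK; exact: (mulfI (lt0r_neq0 a0)).
move: c2 => /eqP; rewrite eqf_sqr => /orP[] /eqP c2; [left|right]; apply: theta_inj.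
  rewrite tx0; apply: cos_inj => //; rewrite in_itv/=; lra.
rewrite theta_reflect tx0; apply: cos_inj => //; first by rewrite in_itv/=; lra.
by rewrite c2 cosB cospi sinpi; ring.
Qed.

End Profile.
End Elliptic.

(** * The quadratic form of the linearized operator *)

Section Jacobi.
Context {R : realType}.
Variables (T : R) (T_gt0 : 0 < T).
Notation I := (period_int T).

(** Jacobi's transformation: where the solution [psi] does not vanish, the
    integrand below is the derivative of [psi' u^2 / psi] plus a square.  At a
    simple zero of [psi] where u vanishes too, that boundary term extends
    continuously by 0, which is also its value under the convention 0^-1 = 0. *)
Section BoundaryTerm.
Variables (k u u' psi psi' : R -> R).
Hypotheses (ck : continuous k) (cu' : continuous u').
Hypotheses (Du : D1 u u') (Dpsi : D1 psi psi').
Hypothesis Dpsi' : D1 psi' (fun x => k x * psi x).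

Let F x := psi' x * u x ^+ 2 * (psi x)^-1.

Lemma boundary_continuous x : (psi x = 0 -> u x = 0 /\ psi' x != 0) ->
  {for x, continuous F}.
Proof.
move=> zx; have cpsi := D1_continuous Dpsi; have cpsi' := D1_continuous Dpsi'.
have cu := D1_continuous Du.
have [px|px] := eqVneq (psi x) 0; last first.
  apply: cvgM; last by apply: cvgV => //; exact: cpsi.
  have : continuous (fun x => psi' x * u x ^+ 2) by cts.
  by apply.
have [ux p'x] := zx px.
have [g1 [E1 c1 _]] := (is_derive1_caratheodory u x (u' x)).1 (Du x).
have [g2 [E2 c2 g2x]] := (is_derive1_caratheodory psi x (psi' x)).1 (Dpsi x).
have -> : F = fun z => psi' z * (g1 z * g1 z) * (z - x) * (g2 z)^-1.
  apply/funext => z; rewrite /F.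
  have -> : u z = g1 z * (z - x) by rewrite -E1 ux subr0.
  have -> : psi z = g2 z * (z - x) by rewrite -E2 px subr0.
  have [->|zxn] := eqVneq z x; first by rewrite subrr !mulr0 !mul0r expr0n mulr0 mul0r.
  rewrite invfM; have h : z - x != 0 by rewrite subr_eq0.
  by move: (g2 z)^-1 => i; field.
apply: cvgM; last by apply: cvgV => //; rewrite g2x.
apply: cvgM; last by apply: cvgB; [exact: cvg_id|exact: cvg_cst].
apply: cvgM; first exact: cpsi'.
by apply: cvgM.
Qed.

Lemma boundary_derive x : psi x != 0 -> is_derive x (1 : R) F
  ((k x * u x ^+ 2 + 2 * psi' x * u x * u' x / psi x) - psi' x ^+ 2 * u x ^+ 2 / psi x ^+ 2).
Proof.
move=> px.
have h1 : D1 (fun x => psi' x * u x ^+ 2)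
    (fun x => k x * psi x * u x ^+ 2 + 2 * psi' x * u x * u' x).
  by derive; rewrite mulr2n; ring.
have h2 := is_deriveV px (Dpsi x).
have := @is_deriveM R R (fun x => psi' x * u x ^+ 2) (fun x => (psi x)^-1) x 1 _ _ (h1 x) h2.
move/is_derive_eq; apply; rewrite /GRing.scale/=.
by field.
Qed.

Let G x := prim (fun x => u' x ^+ 2 + k x * u x ^+ 2) x - F x.

(** The derivative of G is a square where psi does not vanish. *)
Lemma jacobi_monotone a b : a <= b ->
  (forall x, a <= x <= b -> psi x = 0 -> u x = 0 /\ psi' x != 0) ->
  (forall x, a < x < b -> psi x != 0) -> G a <= G b.
Proof.
move=> ab z0 nz.
have cint : continuous (fun x => u' x ^+ 2 + k x * u x ^+ 2).
  by have cu := D1_continuous Du; cts.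
have dG x : psi x != 0 -> is_derive x (1 : R) G ((u' x - psi' x * u x / psi x) ^+ 2).
  move=> px; have := is_deriveB (D1_prim cint x) (boundary_derive px).
  by move/is_derive_eq; apply; field.
apply: (@ger0_derive1_ndecr R G a b) => // [x|x|].
- by rewrite in_itv/= => /nz /dG [].
- by rewrite in_itv/= => /nz /dG H; rewrite derive1E derive_val sqr_ge0.
apply/subspace_continuousP => x; rewrite /= in_itv/= => xab.
apply: cvg_within_filter; apply: cvgB; first exact: (D1_continuous (D1_prim cint)).
by apply: boundary_continuous; exact: z0.
Qed.

Lemma jacobi_ge0 x0 x1 : 0 <= x0 -> x0 <= x1 -> x1 <= T ->
  u x0 = 0 -> u x1 = 0 ->
  (forall x, 0 <= x <= T -> psi x = 0 -> x = x0 \/ x = x1) ->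
  psi' x0 != 0 -> psi' x1 != 0 ->
  u T = u 0 -> psi T = psi 0 -> psi' T = psi' 0 ->
  0 <= I (fun x => u' x ^+ 2 + k x * u x ^+ 2).
Proof.
move=> x00 x01 x1T ux0 ux1 zeros px0 px1 uT psiT psi'T.
have cint : continuous (fun x => u' x ^+ 2 + k x * u x ^+ 2).
  by have cu := D1_continuous Du; cts.
have zP x : 0 <= x <= T -> psi x = 0 -> u x = 0 /\ psi' x != 0.
  by move=> xT /(zeros x xT) [] ->.
have H1 : G 0 <= G x0.
  apply: jacobi_monotone => // x /andP[h1 h2].
    by apply: zP; rewrite h1 (le_trans h2)// (le_trans x01).
  have xT : 0 <= x <= T by lra.
  by apply/eqP => px; have [E|E] := zeros x xT px; move: h1 h2; rewrite E; lra.
have H2 : G x0 <= G x1.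
  apply: jacobi_monotone => // x /andP[h1 h2].
    by apply: zP; rewrite (le_trans x00 h1) (le_trans h2).
  have xT : 0 <= x <= T by lra.
  by apply/eqP => px; have [E|E] := zeros x xT px; move: h1 h2; rewrite E; lra.
have H3 : G x1 <= G T.
  apply: jacobi_monotone => // x /andP[h1 h2].
    by apply: zP; rewrite h2 (le_trans _ h1)// (le_trans x00).
  have xT : 0 <= x <= T by lra.
  by apply/eqP => px; have [E|E] := zeros x xT px; move: h1 h2; rewrite E; lra.
have := le_trans H1 (le_trans H2 H3).
rewrite /G /F uT psiT psi'T prim0 /I (primE cint (ltW T_gt0)); lra.
Qed.
End BoundaryTerm.
End Jacobi.

(** The properties of the profile on which the stability analysis rests. In
    [wave_level] the hypothesis says that v lies strictly between the extreme
    values of f^2, by [wave_energy]. *)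
Record dnoidal_wave {R : realType} (T c b : R) (f f' : R -> R) : Prop := DnoidalWave {
  wave_T : 0 < T;
  wave_c : 0 < c;
  wave_b : - (2^-1 * c ^+ 2) < b < 0;
  wave_D1 : D1 f f';
  wave_D1' : D1 f' (fun x => c * f x - f x ^+ 3);
  wave_energy : forall x, f' x ^+ 2 = - (f x ^+ 4 / 2) + c * f x ^+ 2 + b;
  wave_gt0 : forall x, 0 < f x;
  wave_period : f T = f 0;
  wave_period' : f' T = f' 0;
  wave_reflect : forall x, f (T - x) = f x;
  wave_reflect' : forall x, f' (T - x) = - f' x;
  wave_level : forall v, v ^+ 2 / 2 - c * v - b < 0 ->
    exists x0, [/\ 0 <= x0 <= T - x0, f x0 ^+ 2 = v, f' x0 != 0 &
      forall x, 0 <= x <= T -> f x ^+ 2 = v -> x = x0 \/ x = T - x0]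
}.

Section Wave.
Context {R : realType}.
Variables (T c b : R) (f f' : R -> R).
Hypothesis W : dnoidal_wave T c b f f'.
Notation I := (period_int T).
Notation ip := (period_ip T).
Let T_gt0 := wave_T W.
Let c_gt0 := wave_c W.
Let b_range := wave_b W.
Let Df := wave_D1 W.
Let Df' := wave_D1' W.
Let f'2 := wave_energy W.
Let f_gt0 := wave_gt0 W.
Let fT := wave_period W.
Let f'T := wave_period' W.
Let f'_reflect := wave_reflect' W.
Let f_reflect := wave_reflect W.
Let level := wave_level W.

Let cf := D1_continuous Df.
Let cf' := D1_continuous Df'.

(** In what follows, L = - d^2/dx^2 + q. *)
Definition potential x := c - 3 * f x ^+ 2.
Notation q := potential.

Lemma q_continuous : continuous q.
Proof. by rewrite /q; cts. Qed.
Let cq := q_continuous.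

Definition chi a x := f x ^+ 2 + a.
Definition chi' x := 2 * f x * f' x.

Lemma D1_chi a : D1 (chi a) chi'.
Proof. by rewrite /chi /chi'; derive; rewrite mulr2n; ring. Qed.

(** By the energy identity, L 1 = c - 3 f^2 and L f^2 = - 2 b - 3 c f^2, so that
    L maps the span of 1 and f^2 to itself; the two equations on a and m say
    that f^2 + a is an eigenfunction for the eigenvalue m. *)
Lemma D1_chi' a m : m = - 3 * (a + c) -> m * a = c * a - 2 * b ->
  D1 chi' (fun x => (q x - m) * chi a x).
Proof.
move=> mE mE2; rewrite /chi'; derive_as => x /=.
have h := f'2 x; rewrite /q /chi; move: mE2; rewrite mE; lra.
Qed.

(** f' is in the kernel of L. *)
Lemma D1_f'' : D1 (fun x => c * f x - f x ^+ 3) (fun x => q x * f' x).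
Proof. by rewrite /q; derive; ring. Qed.

Lemma I_D1_periodic F g : D1 F g -> continuous g -> F T = F 0 -> I g = 0.
Proof. by move=> Fg cg FT; rewrite (I_FTC T_gt0 Fg cg) FT subrr. Qed.

(** The form of L is unchanged by the addition of e except for the terms that
    come from k = L e. *)
Lemma form_shift w p e e' k : D1 w p -> continuous p -> D1 e e' ->
  D1 e' (fun x => q x * e x - k x) -> continuous k ->
  w T = w 0 -> e T = e 0 -> e' T = e' 0 ->
  I (fun x => (p x + e' x) ^+ 2 + q x * (w x + e x) ^+ 2) =
  I (fun x => p x ^+ 2 + q x * w x ^+ 2) + 2 * I (fun x => k x * w x) +
  I (fun x => k x * e x).
Proof.
move=> Dw cp De De' ck wT eT e'T.
have cw := D1_continuous Dw; have ce := D1_continuous De.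
have ce' := D1_continuous De'.
pose g x := 2 * (p x * e' x + w x * (q x * e x - k x)) +
  (e' x * e' x + e x * (q x * e x - k x)).
have cg : continuous g by rewrite /g; cts.
have Dg : D1 (fun x => 2 * (w x * e' x) + e x * e' x) g.
  by rewrite /g; derive; ring.
have g0 : I g = 0.
  by apply: (I_D1_periodic Dg cg) => /=; rewrite wT eT e'T.
rewrite -[RHS]addr0 -g0 -IZ; last by cts.
rewrite -!ID//; try by cts.
by apply: eq_I => x _; rewrite /g; ring.
Qed.

(** L has a single negative direction on periodic functions: its negative
    eigenfunction is a combination of 1 and f^2, and w is orthogonal to both.
    Adding to w multiples of that eigenfunction and of f' (in the kernel of L)
    does not increase the form of L, and makes w vanish at the two zeros of the
    next eigenfunction f^2 + a, for which Jacobi's transformation applies. *)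
Lemma form_ge0 w p : D1 w p -> continuous p -> w T = w 0 ->
  I w = 0 -> I (fun x => f x ^+ 2 * w x) = 0 ->
  0 <= I (fun x => p x ^+ 2 + q x * w x ^+ 2).
Proof.
move=> Dw cp wT w0 w1.
have cw := D1_continuous Dw.
have /andP[b1 b0] := b_range.
have disc : 0 < 4 * c ^+ 2 + 6 * b by nra.
(* The eigenvalues of L on the span of 1 and f^2 are - c - s and s - c. *)
pose s := Num.sqrt (4 * c ^+ 2 + 6 * b).
have s2 : s ^+ 2 = 4 * c ^+ 2 + 6 * b by rewrite sqr_sqrtr// ltW.
have s0 : 0 < s by rewrite sqrtr_gt0.
have sc : c < s.
  by rewrite -(@ltr_pXn2r _ 2%N)// ?nnegrE ?(ltW s0) ?(ltW c_gt0)//; nra.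
pose ap := (- 2 * c - s) / 3; pose an := (- 2 * c + s) / 3.
have Dp : D1 chi' (fun x => (q x - (s - c)) * chi ap x).
  by apply: D1_chi'; rewrite /ap; [field|lra].
have Dn : D1 chi' (fun x => (q x - (- c - s)) * chi an x).
  by apply: D1_chi'; rewrite /an; [field|lra].
have [] := @level (- ap).
  have h1 : c * c < c * - ap by rewrite ltr_pM2l// /ap; lra.
  have h2 : (- ap) ^+ 2 = (4 * c * - ap + 2 * b) / 3 by rewrite /ap; lra.
  by rewrite h2; lra.
move=> x0 [/andP[x00 x01] fx0 f'x0 zeros].
have x1T : T - x0 <= T by lra.
pose d := 2 * s / 3.
have d0 : d != 0 by rewrite gt_eqF// /d; lra.
have chin x : f x ^+ 2 = - ap -> chi an x = d.
  by move=> E; rewrite /chi E /ap /an /d; field.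
(* f' takes opposite values at x0 and T - x0, and the negative eigenfunction the
   same value d, which determines a and a'. *)
pose a := - (w x0 + w (T - x0)) / (2 * d).
pose a' := - (w x0 + a * d) / f' x0.
pose e x := a * chi an x + a' * f' x.
pose e' x := a * chi' x + a' * (c * f x - f x ^+ 3).
pose k x := a * (- c - s) * chi an x.
have Dchi := D1_chi an; have D3 := D1_f''.
have De : D1 e e' by rewrite /e /e'; derive; ring.
have De' : D1 e' (fun x => q x * e x - k x).
  by rewrite /e' /e /k; derive; rewrite /q; ring.
have cchi := D1_continuous Dchi.
have ck : continuous k by rewrite /k; cts.
have ce := D1_continuous De; have ce' := D1_continuous De'.
have chiT z : chi z T = chi z 0 by rewrite /chi fT.
have chi'T : chi' T = chi' 0 by rewrite /chi' fT f'T.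
have eT : e T = e 0 by rewrite /e chiT f'T.
have e'T : e' T = e' 0 by rewrite /e' chi'T fT.
have E := form_shift Dw cp De De' ck wT eT e'T.
have kw : I (fun x => k x * w x) = 0.
  rewrite (_ : I _ = I (fun x => a * (- c - s) * (f x ^+ 2 * w x + an * w x))); last first.
    by apply: eq_I => x _; rewrite /k /chi; ring.
  by rewrite IZ ?ID ?IZ ?w0 ?w1 ?mulr0 ?addr0 ?mulr0//; cts.
have ke : I (fun x => k x * e x) <= 0.
  have c1 : I (fun x => chi an x * f' x) = 0.
    apply: (@I_D1_periodic (fun x => f x ^+ 3 / 3 + an * f x)); [|by cts|by rewrite fT].
    by rewrite /chi; derive; field.
  rewrite (_ : I _ = I (fun x => a ^+ 2 * (- c - s) * chi an x ^+ 2 +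
      a * a' * (- c - s) * (chi an x * f' x))); last first.
    by apply: eq_I => x _; rewrite /k /e; ring.
  rewrite ID ?IZ ?c1 ?mulr0 ?addr0; [|by cts..].
  have i0 : 0 <= I (fun x => chi an x ^+ 2) by apply: I_ge0 => x _; exact: sqr_ge0.
  have m0 : - c - s <= 0 by rewrite -opprD oppr_le0 addr_ge0// ltW.
  exact: (mulr_le0_ge0 (mulr_ge0_le0 (sqr_ge0 a) m0) i0).
pose u x := w x + e x; pose u' x := p x + e' x.
have Du : D1 u u' by rewrite /u /u'; derive.
have cu' : continuous u' by rewrite /u'; cts.
have cu := D1_continuous Du.
have J : 0 <= I (fun x => u' x ^+ 2 + (q x - (s - c)) * u x ^+ 2).
  apply: (jacobi_ge0 T_gt0 (k := fun x => q x - (s - c)) (x0 := x0) (x1 := T - x0) _ cu' Du (D1_chi ap) Dp) => //.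
  - by cts.
  - rewrite /u /e (chin _ fx0) /a' divfK//; ring.
  - rewrite /u /e chin ?f_reflect// f'_reflect /a' mulrN divfK// /a; field.
    by [].
  - by move=> x xT /eqP; rewrite addr_eq0 => /eqP; exact: zeros.
  - by rewrite /chi' mulf_neq0// mulf_neq0// gt_eqF.
  - by rewrite /chi' f'_reflect f_reflect mulrN oppr_eq0 mulf_neq0// mulf_neq0// gt_eqF.
  - by rewrite /u wT eT.
have U0 : 0 <= I (fun x => u' x ^+ 2 + q x * u x ^+ 2).
  apply: (le_trans J); apply: I_le; [by cts..|move=> x _].
  by have := sqr_ge0 (u x); nra.
move: U0; rewrite /u /u' E kw mulr0 addr0; lra.
Qed.

Let h := chi'.

(** For w = z' the two orthogonality conditions become periodicity of z and
    <h, z> = 0, as h is the derivative of f^2. *)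
Lemma form_ge0_primitive z w p : D1 z w -> D1 w p -> continuous p ->
  z T = z 0 -> w T = w 0 -> ip h z = 0 ->
  0 <= I (fun x => p x ^+ 2 + q x * w x ^+ 2).
Proof.
move=> Dz Dw cp zT wT hz; have cw := D1_continuous Dw.
have Dh := D1_chi 0; have ch : continuous chi' by rewrite /chi'; cts.
apply: (form_ge0 Dw cp wT); first exact: (I_D1_periodic Dz cw zT).
have := ip_D1 T_gt0 Dh Dz ch cw _ zT; rewrite /chi fT hz => /(_ erefl) H.
rewrite (_ : I _ = ip (fun x => f x ^+ 2 + 0) w); last by apply: eq_I => x _; rewrite addr0.
lra.
Qed.
End Wave.

(** * Periodic modes with a multiplier *)

Section Modes.
Context {R : realType}.
Variables (T c b : R) (f f' : R -> R).
Hypothesis W : dnoidal_wave T c b f f'.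
Notation I := (period_int T).
Notation ip := (period_ip T).
Notation sqn g := (period_ip T g g).
Notation q := (potential c f).
Notation h := (chi' f f').
Let T_gt0 := wave_T W.
Let c_gt0 := wave_c W.
Let b_range := wave_b W.
Let Df := wave_D1 W.
Let Df' := wave_D1' W.
Let fT := wave_period W.
Let f'T := wave_period' W.
Let cf := D1_continuous Df.
Let cf' := D1_continuous Df'.
Let cq : continuous q. Proof. exact: q_continuous W. Qed.
Let Dh : D1 (fun x => f x ^+ 2) h.
Proof. by rewrite /chi'; derive; ring. Qed.
Let ch : continuous h. Proof. by rewrite /chi'; cts. Qed.

(** T-periodic solutions of [- (L z')' + sg z + lam z' = m h], as a first-order
    system in z, w = z', p = w', r = L w.  For m = 0 and lam, sg > 0 these are
    the growing modes sought; the multiplier m allows to prescribe [ip h z]. *)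
Record forced_mode (sg lam m : R) (z w p r : R -> R) : Prop := ForcedMode {
  mode_z : D1 z w;
  mode_w : D1 w p;
  mode_p : D1 p (fun x => q x * w x - r x);
  mode_r : D1 r (fun x => sg * z x + lam * w x - m * h x);
  mode_zT : z T = z 0; mode_wT : w T = w 0; mode_pT : p T = p 0; mode_rT : r T = r 0
}.

(** The bilinear form of [- d/dx L d/dx], in terms of w = z' and p = z''. *)
Definition bf w1 p1 w2 p2 : R := I (fun x => p1 x * p2 x + q x * (w1 x * w2 x)).

Lemma bfC w1 p1 w2 p2 : bf w1 p1 w2 p2 = bf w2 p2 w1 p1.
Proof. by apply: eq_I => x _; ring. Qed.

Lemma bfBl w1 p1 w2 p2 w p : continuous w1 -> continuous p1 -> continuous w2 ->
  continuous p2 -> continuous w -> continuous p ->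
  bf (fun x => w1 x - w2 x) (fun x => p1 x - p2 x) w p = bf w1 p1 w p - bf w2 p2 w p.
Proof.
by move=> *; rewrite /bf -IN -?ID; [apply: eq_I => x _; ring|cts..].
Qed.

Lemma bf_ge0 z w p : D1 z w -> D1 w p -> continuous p -> z T = z 0 -> w T = w 0 ->
  ip h z = 0 -> 0 <= bf w p w p.
Proof.
move=> Dz Dw cp zT wT hz; have := form_ge0_primitive W Dz Dw cp zT wT hz.
by rewrite /bf; under eq_fun do rewrite !expr2.
Qed.

Section WeakForm.
Variables (sg lam m : R) (z w p r : R -> R).
Hypothesis M : forced_mode sg lam m z w p r.

Lemma mode_continuous : [/\ continuous z, continuous w, continuous p & continuous r].
Proof.
split; [exact: D1_continuous (mode_z M)|exact: D1_continuous (mode_w M)|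
  exact: D1_continuous (mode_p M)|exact: D1_continuous (mode_r M)].
Qed.

Lemma weak_form z2 w2 p2 : D1 z2 w2 -> D1 w2 p2 -> continuous p2 ->
  z2 T = z2 0 -> w2 T = w2 0 ->
  m * ip h z2 = bf w p w2 p2 + sg * ip z z2 + lam * ip w z2.
Proof.
move=> Dz2 Dw2 cp2 z2T w2T; have [cz cw cp cr] := mode_continuous.
have cz2 := D1_continuous Dz2; have cw2 := D1_continuous Dw2.
have Dp := mode_p M; have Dr := mode_r M.
pose g x := (p x * p2 x + q x * (w x * w2 x)) + sg * (z x * z2 x) +
  lam * (w x * z2 x) - m * (h x * z2 x).
have cg : continuous g by rewrite /g; cts.
have Dg : D1 (fun x => r x * z2 x + p x * w2 x) g.
  by rewrite /g; derive; ring.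
have := I_D1_periodic W Dg cg; rewrite (mode_rT M) (mode_pT M) z2T w2T => /(_ erefl).
rewrite /g !ID ?IN ?IZ //; try by cts.
by move=> E; rewrite /ip /bf ID; [lra|cts..].
Qed.

Lemma mode_ip_w : ip w z = 0.
Proof.
have [cz cw _ _] := mode_continuous.
exact: ip_D1_self (mode_z M) cw (mode_zT M).
Qed.
End WeakForm.

Lemma mode_sub sg1 lam1 m1 z1 w1 p1 r1 sg2 lam2 m2 z2 w2 p2 r2 :
  forced_mode sg1 lam1 m1 z1 w1 p1 r1 -> forced_mode sg2 lam2 m2 z2 w2 p2 r2 ->
  [/\ D1 (fun x => z1 x - z2 x) (fun x => w1 x - w2 x),
      D1 (fun x => w1 x - w2 x) (fun x => p1 x - p2 x),
      z1 T - z2 T = z1 0 - z2 0 & w1 T - w2 T = w1 0 - w2 0].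
Proof.
move=> M1 M2; split.
- exact: D1_sub (mode_z M1) (mode_z M2).
- exact: D1_sub (mode_w M1) (mode_w M2).
- by rewrite (mode_zT M1) (mode_zT M2).
- by rewrite (mode_wT M1) (mode_wT M2).
Qed.

Lemma h_neq0 : exists2 x, 0 <= x <= T & h x != 0.
Proof.
have /andP[b1 b0] := b_range.
have [|x [/andP[x0 xT] _ f'x _]] := @wave_level _ _ _ _ _ _ W c; first by lra.
exists x; first by apply/andP; split; lra.
by rewrite /chi' !mulf_neq0// gt_eqF// (wave_gt0 W).
Qed.

(** Testing the equation with z gives sg |z|^2 + <L w, w> = m <h, z> = 0, where
    both terms on the left are nonnegative. *)
Lemma mode_uniq sg lam m z w p r : 0 < sg -> forced_mode sg lam m z w p r ->
  ip h z = 0 -> [/\ z 0 = 0, w 0 = 0, p 0 = 0, r 0 = 0 & m = 0].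
Proof.
move=> sg0 M hz; have [cz cw cp cr] := mode_continuous M.
have Q := bf_ge0 (mode_z M) (mode_w M) cp (mode_zT M) (mode_wT M) hz.
have := weak_form M (mode_z M) (mode_w M) cp (mode_zT M) (mode_wT M).
rewrite hz mulr0 (mode_ip_w M) mulr0 addr0 => E.
have zz := ip_ge0 T z.
have zz0 : ip z z = 0 by apply/eqP; rewrite eq_le zz andbT; nra.
have z0 := ip_eq0 T_gt0 cz zz0.
have w0 := D1_zero T_gt0 (mode_z M) cw z0.
have p0 := D1_zero T_gt0 (mode_w M) cp w0.
have cpr : continuous (fun x => q x * w x - r x) by cts.
have r0 x : 0 <= x <= T -> r x = 0.
  move=> xT; have := D1_zero T_gt0 (mode_p M) cpr p0 xT.
  by rewrite (w0 x xT) mulr0 sub0r => /eqP; rewrite oppr_eq0 => /eqP.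
have crr : continuous (fun x => sg * z x + lam * w x - m * h x) by cts.
have I0 : (0 : R) <= 0 <= T by rewrite lexx (ltW T_gt0).
split; [exact: z0|exact: w0|exact: p0|exact: r0|].
have [x xT hx] := h_neq0.
have := D1_zero T_gt0 (mode_r M) crr r0 xT.
rewrite (z0 x xT) (w0 x xT) !mulr0 add0r sub0r => /eqP.
by rewrite oppr_eq0 mulf_eq0 (negbTE hx) orbF => /eqP.
Qed.

Lemma D1_sum n (a : 'I_n -> R) (F g : 'I_n -> R -> R) : (forall j, D1 (F j) (g j)) ->
  D1 (fun x => \sum_j a j * F j x) (fun x => \sum_j a j * g j x).
Proof.
elim: n a F g => [|n IH] a F g Fg.
  by apply: D1_eq; [under eq_fun do rewrite big_ord0; exact: D1_cst|move=> x; rewrite big_ord0].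
under eq_fun do rewrite big_ord_recl.
have h1 := IH (fun j => a (lift ord0 j)) (fun j => F (lift ord0 j)) _ (fun j => Fg _).
have h2 := Fg ord0.
apply: D1_eq; first exact: (D1D (D1M (D1_cst (a ord0)) h2) h1).
by move=> x /=; rewrite big_ord_recl mul0r add0r.
Qed.

Lemma continuous_sum n (a : 'I_n -> R) (F : 'I_n -> R -> R) :
  (forall j, continuous (F j)) -> continuous (fun x => \sum_j a j * F j x).
Proof.
elim: n a F => [|n IH] a F cF; first by under eq_fun do rewrite big_ord0; exact: cst_continuous.
under eq_fun do rewrite big_ord_recl.
apply: (cD (h := fun x => a ord0 * F ord0 x)).
  by apply: (cM (h := fun=> a ord0)); [exact: cst_continuous|exact: cF].
by apply: IH => j; exact: cF.
Qed.

Lemma I_sum n (a : 'I_n -> R) (F : 'I_n -> R -> R) : (forall j, continuous (F j)) ->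
  I (fun x => \sum_j a j * F j x) = \sum_j a j * I (F j).
Proof.
elim: n a F => [|n IH] a F cF.
  rewrite big_ord0 (_ : I _ = I (fun x => 0 * 0)); last first.
    by apply: eq_I => x _; rewrite big_ord0 mul0r.
  by rewrite IZ ?mul0r//; exact: cst_continuous.
rewrite big_ord_recl -IH//.
rewrite -IZ// -ID; first by apply: eq_I => x _; rewrite big_ord_recl.
- by apply: (cM (h := fun=> a ord0)); [exact: cst_continuous|exact: cF].
- exact: (@continuous_sum n (fun j => a (lift ord0 j)) (fun j => F (lift ord0 j))).
Qed.

(** A linear boundary value problem that only has the trivial solution is
    solvable for any data: the fourth-order equation has a four-dimensional
    space of solutions, to which the multiplier adds one unknown, and there are
    four periodicity conditions besides the normalization. *)
Lemma mode_exists sg lam : 0 < sg ->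
  exists m z w p r, forced_mode sg lam m z w p r /\ ip h z = 1.
Proof.
move=> sg0.
(* The multiplier is a fifth component, with derivative zero. *)
pose rows x : seq (seq R) := [:: [:: 0; 1; 0; 0; 0]; [:: 0; 0; 1; 0; 0];
  [:: 0; q x; 0; - 1; 0]; [:: sg; lam; 0; 0; - h x]; [::]].
pose A (i j : 'I_5) x := nth 0 (nth [::] (rows x) i) j.
have cA i j : continuous (A i j).
  have cnh : continuous (fun x => - h x) by cts.
  rewrite /A; case: i => [[|[|[|[|[|]]]]] //= ?]; case: j => [[|[|[|[|[|]]]]] //= ?];
    by try exact: cst_continuous.
have /choice[Y HY] : forall j : 'I_5, exists Y : 'I_5 -> R -> R,
    (forall i, D1 (Y i) (rhs A Y i)) /\ forall i, Y i 0 = (i == j)%:R.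
  by move=> j; exact: (linear_ode (fun i => (i == j)%:R) cA).
have DY j i : D1 (Y j i) (rhs A (Y j) i) by case: (HY j).
have cY j i : continuous (Y j i) := D1_continuous (DY j i).
pose S (e : 'rV[R]_5) i x := \sum_j e 0 j * Y j i x.
have DS e i : D1 (S e i) (rhs A (S e) i).
  apply: D1_eq; first exact: (D1_sum (fun j => e 0 j) (fun j => DY j i)).
  move=> x; rewrite /rhs /S; under eq_bigr do rewrite mulr_sumr.
  rewrite exchange_big; apply: eq_bigr => k _; rewrite mulr_sumr.
  by apply: eq_bigr => j _; ring.
have S0 e i : S e i 0 = e 0 i.
  rewrite /S (bigD1 i)//= (HY i).2 eqxx mulr1 big1 ?addr0// => j ji.
  by rewrite (HY j).2 eq_sym (negbTE ji) mulr0.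
pose o (k : nat) : 'I_5 := inord k.
have rhsE e i x : rhs A (S e) i x = nth 0 [:: S e (o 1%N) x; S e (o 2%N) x;
    q x * S e (o 1%N) x - S e (o 3%N) x;
    sg * S e (o 0%N) x + lam * S e (o 1%N) x - S e (o 4%N) x * h x; 0] i.
  have sum5 (F : 'I_5 -> R) : \sum_j F j =
      F (o 0%N) + F (o 1%N) + F (o 2%N) + F (o 3%N) + F (o 4%N).
    rewrite !big_ord_recl big_ord0 addr0 !addrA.
    by congr (F _ + F _ + F _ + F _ + F _); apply/val_inj; rewrite /= inordK.
  rewrite /rhs sum5 /A !inordK//.
  by case: i => [[|[|[|[|[|]]]]] //= ?]; ring.
have S4 e x : S e (o 4%N) x = e 0 (o 4%N).
  rewrite -S0; apply: D1_cst_eq => t; apply: is_derive_eq (DS e (o 4%N) t) _.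
  by rewrite rhsE inordK.
pose mode (e : 'rV[R]_5) := forced_mode sg lam (e 0 (o 4%N)) (S e (o 0%N)) (S e (o 1%N)) (S e (o 2%N)) (S e (o 3%N)).
pose g (j i : 'I_5) : R := if i == o 4%N then ip h (Y j (o 0%N)) else Y j i T - Y j i 0.
pose B : 'M[R]_5 := \matrix_(j, i) g j i.
have BE e i : (e *m B) 0 i = if i == o 4%N then ip h (S e (o 0%N)) else S e i T - S e i 0.
  rewrite mxE; under eq_bigr do rewrite mxE /g.
  case: ifP => _; last first.
    by rewrite /S -sumrB; apply: eq_bigr => j _; rewrite mulrBr.
  rewrite /ip /S; under [in RHS]eq_fun do rewrite mulr_sumr.
  rewrite (_ : I _ = I (fun x => \sum_j e 0 j * (h x * Y j (o 0%N) x))); last first.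
    by apply: eq_I => x _; apply: eq_bigr => j _; ring.
  by rewrite (I_sum (fun j => e 0 j)) // => j; have := cY j (o 0%N) => ?; cts.
have modeP e : (forall i, i != o 4%N -> (e *m B) 0 i = 0) -> mode e.
  move=> per.
  have perT i : i != o 4%N -> S e i T = S e i 0.
    by move=> i4; have := per i i4; rewrite BE (negbTE i4) => /eqP; rewrite subr_eq0 => /eqP.
  have ne k : (k < 4)%N -> o k != o 4%N.
    by move=> k4; apply/eqP => /(congr1 val); rewrite /= !inordK// 1?ltnW// => E; rewrite E in k4.
  have DE k : (k < 5)%N -> D1 (S e (o k)) (fun x => nth 0 [:: S e (o 1%N) x; S e (o 2%N) x;
    q x * S e (o 1%N) x - S e (o 3%N) x;
    sg * S e (o 0%N) x + lam * S e (o 1%N) x - S e (o 4%N) x * h x; 0] k).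
    by move=> k5; apply: D1_eq (DS e (o k)) _ => x; rewrite rhsE inordK.
  split; try (apply: perT; exact: ne).
  - exact: (DE 0%N).
  - exact: (DE 1%N).
  - exact: (DE 2%N).
  - by apply: D1_eq (DE 3%N _) _ => // x /=; rewrite S4.
have Bfull : row_full B.
  rewrite row_full_unit -row_free_unit -kermx_eq0; apply/rowV0P => e /sub_kermxP eB.
  have M : mode e by apply: modeP => i _; rewrite eB mxE.
  have hz : ip h (S e (o 0%N)) = 0 by have := BE e (o 4%N); rewrite eqxx eB mxE.
  have [z0 w0 p0 r0 m0] := mode_uniq sg0 M hz.
  apply/rowP => i; rewrite mxE.
  have -> : i = o i by rewrite /o inord_val.
  move: z0 w0 p0 r0 m0; rewrite !S0.
  by case: i => [[|[|[|[|[|]]]]] //= ?].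
have /submxP[e eE] : ((delta_mx 0 (o 4%N) : 'rV[R]_5) <= B)%MS by exact: submx_full.
have M : mode e.
  by apply: modeP => i i4; rewrite -eE mxE eqxx (negbTE i4).
exists (e 0 (o 4%N)), (S e (o 0%N)), (S e (o 1%N)), (S e (o 2%N)), (S e (o 3%N)).
by split => //; have := BE e (o 4%N); rewrite eqxx -eE mxE !eqxx => <-.
Qed.

(** f''/f = c - f^2 has the same integral as (f'/f)^2, which is positive. *)
Lemma mean_lt : I (fun x => f x ^+ 2) < c * T.
Proof.
have fN x : f x != 0 by rewrite gt_eqF// (wave_gt0 W).
pose g x := f' x * (f x)^-1.
have Dg : D1 g (fun x => c - f x ^+ 2 - g x * g x).
  apply: D1_eq (D1M Df' (D1V fN Df)) _ => x /=; rewrite /g.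
  by have := fN x => ?; field.
have cg := D1_continuous Dg.
have cI : continuous (fun x => c - f x ^+ 2 - g x * g x) by cts.
have := I_D1_periodic W Dg cI; rewrite /g fT f'T -/g => /(_ erefl).
rewrite -[fun x => _ - _]/(fun x => c - f x ^+ 2 - g x * g x).
rewrite !ID ?IN; [|by cts..].
have -> : I (fun=> c) = c * T.
  have D : D1 (fun x => c * x) (fun=> c) by derive; ring.
  by rewrite (I_FTC T_gt0 D) ?mulr0 ?subr0//; cts.
have gg := ip_ge0 T g; rewrite -/(ip g g).
move=> E; suff : ip g g != 0 by move=> gN; have : 0 < ip g g by [rewrite lt0r gN]; lra.
apply/eqP => g0; have g00 := ip_eq0 T_gt0 cg g0.
have [x xT] := h_neq0; have := g00 x xT.
rewrite /g /chi' => /eqP; rewrite mulf_eq0 invr_eq0 (negbTE (fN x)) orbF => /eqP ->.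
by rewrite mulr0 eqxx.
Qed.

(** f^2 minus its mean is a direction of mean zero along which the form of L is
    negative; it is even an exact mode, as the span of 1 and f^2 is invariant. *)
Lemma negative_mode : exists m z w p r,
  [/\ m < 0, forced_mode 0 0 m z w p r & ip h z = 1].
Proof.
pose a := I (fun x => f x ^+ 2) / T.
have ac : a < c by rewrite ltr_pdivrMr//; exact: mean_lt.
pose w0 x := f x ^+ 2 - a.
have cw0 : continuous w0 by rewrite /w0; cts.
have Iw0 : I w0 = 0.
  have D : D1 (fun x => a * x) (fun=> a) by derive; ring.
  rewrite /w0 ID ?IN; [|by cts..].
  rewrite (I_FTC T_gt0 D); last by cts.
  by rewrite /a mulr0 subr0 divfK ?subrr// gt_eqF.
have DP := D1_prim cw0; have cP := D1_continuous DP.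
have PT : prim w0 T = prim w0 0 by rewrite prim0 -Iw0 (I_prim T_gt0 cw0).
pose V := ip w0 w0.
have V0 : 0 < V.
  rewrite lt0r ip_ge0 andbT; apply/eqP => E; have E0 := ip_eq0 T_gt0 cw0 E.
  have /andP[b1 b0] := b_range.
  have [|x [/andP[x0 xT] fx _ _]] := @wave_level _ _ _ _ _ _ W c; first by lra.
  have xT' : 0 <= x <= T by apply/andP; split; lra.
  by have := E0 x xT'; rewrite /w0 fx; lra.
have VN : V != 0 by rewrite gt_eqF.
have hP : ip h (prim w0) = - V.
  rewrite (ip_D1 T_gt0 Dh DP ch cw0) ?fT//; congr (- _).
  have cf2 : continuous (fun x => f x ^+ 2) by cts.
  have := @ipBl _ T (fun x => f x ^+ 2) (fun=> a) w0 cf2 (@cst_continuous _ _ a) cw0.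
  rewrite -/w0 -/V => ->.
  have -> : ip (fun=> a) w0 = a * I w0 by rewrite -IZ.
  by rewrite Iw0 mulr0 subr0.
exists (3 * (a - c) / V), (fun x => - V^-1 * prim w0 x), (fun x => - V^-1 * w0 x),
  (fun x => - V^-1 * h x),
  (fun x => - V^-1 * (3 * (a - c) * f x ^+ 2 - 2 * b - a * c)); split.
- by rewrite pmulr_llt0 ?invr_gt0//; lra.
- split.
  + by derive; ring.
  + by rewrite /w0; derive; rewrite /chi'; ring.
  + rewrite /chi'; derive_as => x /=; have e := wave_energy W x.
    have -> : forall y, q x * (- V^-1 * w0 x) - y = - V^-1 * (q x * w0 x) - y by move=> y; ring.
    rewrite /potential /w0 -mulrBr.
    by move: e => /(congr1 (fun y => - V^-1 * (2 * y))) e; lra.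
  + by derive; rewrite /chi'; ring.
  + by rewrite PT.
  + by rewrite /w0 fT.
  + by rewrite /chi' fT f'T.
  + by rewrite fT.
- rewrite [LHS]ipC ipZl// [X in _ * X]ipC hP; by field.
Qed.

Section Compare.
Variables (m0 : R) (z0 w0 p0 r0 : R -> R).
Hypothesis M0 : forced_mode 0 0 m0 z0 w0 p0 r0.
Hypothesis n0 : ip h z0 = 1.

(** The form is symmetric: the equation of each mode is tested with the other
    mode, and the two results are compared. *)
Lemma multiplierE sg lam m z w p r : forced_mode sg lam m z w p r -> ip h z = 1 ->
  m = m0 + sg * ip z z0 - lam * ip z w0.
Proof.
move=> M n; have [cz cw cp cr] := mode_continuous M.
have [cz0 cw0 cp0 cr0] := mode_continuous M0.
have E0 := weak_form M0 (mode_z M) (mode_w M) cp (mode_zT M) (mode_wT M).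
have E := weak_form M (mode_z M0) (mode_w M0) cp0 (mode_zT M0) (mode_wT M0).
rewrite n0 (ip_D1 T_gt0 (mode_z M) (mode_z M0) cw cw0 (mode_zT M) (mode_zT M0)) bfC in E.
move: E0 E; rewrite n; lra.
Qed.

(** The bound does not depend on sg, because sg = lam multiplies the whole lower
    order part of the equation. The difference of the two equations is tested
    with the difference of the modes. *)
Lemma mode_dist sg m z w p r : 0 < sg -> forced_mode sg sg m z w p r -> ip h z = 1 ->
  sqn (fun x => z x - z0 x) <= sqn (fun x => z0 x + w0 x).
Proof.
move=> sg0 M n; pose d x := z x - z0 x; pose g x := z0 x + w0 x.
rewrite -/d -/g; have [cz cw cp cr] := mode_continuous M.
have [cz0 cw0 cp0 cr0] := mode_continuous M0.
have [Dd Dd' dT d'T] := mode_sub M M0.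
have cd' : continuous (fun x => w x - w0 x) by cts.
have cd'' : continuous (fun x => p x - p0 x) by cts.
have cd : continuous d by rewrite /d; cts.
have cg : continuous g by rewrite /g; cts.
have hd : ip h d = 0 by rewrite ipC ipBl// ![ip _ h]ipC n n0 subrr.
have Q := bf_ge0 Dd Dd' cd'' dT d'T hd.
have E0 := weak_form M0 Dd Dd' cd'' dT d'T.
have E := weak_form M Dd Dd' cd'' dT d'T.
rewrite bfBl// in Q; rewrite -/d hd in E0 E.
have dd : ip (fun x => w x - w0 x) d = 0 := ip_D1_self T_gt0 Dd cd' dT.
rewrite ipBl// in dd.
have wd : ip w d = ip w0 d by lra.
rewrite wd in E.
have zd : ip d d = ip z d - ip z0 d by rewrite {1}/d ipBl.
have gd : ip g d = ip z0 d + ip w0 d.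
  by rewrite /period_ip -ID; [apply: eq_I => x _; rewrite /g; ring|cts..].
have H : ip d d + ip g d <= 0.
  rewrite -(pmulr_rle0 _ sg0) zd gd; lra.
have := ip_AMGM T cg cd (@ltr01 R); rewrite invr1 !mul1r.
have := ler_norm (- ip g d); rewrite normrN; lra.
Qed.
End Compare.

(** As in [mode_dist], the difference d of the two modes satisfies <h, d> = 0 and
    is tested with itself. *)
Lemma mode_lipschitz lam sg1 m1 z1 w1 p1 r1 sg2 m2 z2 w2 p2 r2 : 0 < sg1 ->
  forced_mode sg1 lam m1 z1 w1 p1 r1 -> ip h z1 = 1 ->
  forced_mode sg2 lam m2 z2 w2 p2 r2 -> ip h z2 = 1 ->
  sqn (fun x => z1 x - z2 x) <= (sg1 - sg2) ^+ 2 / sg1 ^+ 2 * sqn z2.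
Proof.
move=> sg0 M1 n1 M2 n2; pose d x := z1 x - z2 x.
rewrite -/d; have [cz1 cw1 cp1 cr1] := mode_continuous M1.
have [cz2 cw2 cp2 cr2] := mode_continuous M2.
have [Dd Dd' dT d'T] := mode_sub M1 M2.
have cd' : continuous (fun x => w1 x - w2 x) by cts.
have cd'' : continuous (fun x => p1 x - p2 x) by cts.
have cd : continuous d by rewrite /d; cts.
have hd : ip h d = 0 by rewrite ipC ipBl// ![ip _ h]ipC n1 n2 subrr.
have Q := bf_ge0 Dd Dd' cd'' dT d'T hd.
have E1 := weak_form M1 Dd Dd' cd'' dT d'T.
have E2 := weak_form M2 Dd Dd' cd'' dT d'T.
rewrite bfBl// in Q; rewrite -/d hd in E1 E2.
have dd : ip (fun x => w1 x - w2 x) d = 0 := ip_D1_self T_gt0 Dd cd' dT.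
rewrite ipBl// in dd.
have zd : ip d d = ip z1 d - ip z2 d by rewrite {1}/d ipBl.
have H : sg1 * ip d d <= - (sg1 - sg2) * ip z2 d.
  rewrite zd; have wd : ip w1 d = ip w2 d by lra.
  by move: E1 E2; rewrite wd; lra.
have [s12|s12] := eqVneq sg1 sg2.
  have H0 : sg1 * ip d d <= 0 by move: H; rewrite s12; lra.
  by rewrite s12 subrr expr0n/= !mul0r -(pmulr_rle0 _ sg0).
have e0 : 0 < sg1 / `|sg1 - sg2| by rewrite divr_gt0// normr_gt0 subr_eq0.
have := ip_AMGM T cd cz2 e0; rewrite [ip d z2]ipC.
set e := sg1 / _; set N := `|sg1 - sg2| => AM.
have N0 : 0 < N by rewrite normr_gt0 subr_eq0.
have H2 : sg1 * ip d d <= N * `|ip z2 d|.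
  by apply: (le_trans H); rewrite /N -normrM -normrN -mulNr ler_norm.
have -> : (sg1 - sg2) ^+ 2 = N ^+ 2 by rewrite /N real_normK// num_real.
have eE : N * e = sg1 by rewrite /e mulrC divfK// gt_eqF.
have eV : N * e^-1 = N ^+ 2 / sg1 by rewrite /e invf_div -/N mulrA expr2.
have H3 : N * (2 * `|ip z2 d|) <= sg1 * ip d d + N ^+ 2 / sg1 * ip z2 z2.
  clearbody e; have := AM; rewrite -(ler_pM2l N0) => /le_trans; apply.
  by rewrite mulrDr !mulrA eE eV.
have H4 : sg1 * ip d d <= N ^+ 2 / sg1 * ip z2 z2 by lra.
rewrite -(ler_pM2l sg0); apply: (le_trans H4); rewrite le_eqVlt; apply/orP; left.
by apply/eqP; field; rewrite gt_eqF.
Qed.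

Lemma sqn_gt0 z : continuous z -> ip h z = 1 -> 0 < sqn z.
Proof.
move=> cz n; rewrite lt0r ip_ge0 andbT; apply/eqP => E.
have z0 := ip_eq0 T_gt0 cz E; move: n.
rewrite (_ : ip h z = 0 * ip h h); first by rewrite mul0r => /eqP; rewrite eq_sym oner_eq0.
rewrite /period_ip -IZ; last by cts.
by apply: eq_I => x xT; rewrite z0// mulr0 mul0r.
Qed.

(** Testing with z gives m = <L w, w> + sg |z|^2. With q >= - K the first term is
    at least |p|^2 - K |w|^2, and |w|^2 = - <z, p> is bounded by a small multiple of
    |p|^2 plus a multiple of |z|^2. *)
Lemma multiplier_gt0 : exists S, forall sg lam m z w p r,
  S < sg -> forced_mode sg lam m z w p r -> ip h z = 1 -> 0 < m.
Proof.
have [K K0 HK] := continuous_bounded T cq.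
pose A := K + 1; have A0 : 0 < A by rewrite ltr_wpDl.
exists (A ^+ 2 / 4) => sg lam m z w p r Ssg M n.
have [cz cw cp cr] := mode_continuous M.
have := weak_form M (mode_z M) (mode_w M) cp (mode_zT M) (mode_wT M).
rewrite n (mode_ip_w M) mulr1 mulr0 addr0 => ->.
have zz := sqn_gt0 cz n.
have H1 : sqn p - A * sqn w <= bf w p w p.
  rewrite /period_ip -IZ -?IN -?ID; [|by cts..].
  apply: I_le; [by cts..|move=> x /andP[x0 xT]].
  have : `|q x| <= K by apply: HK; rewrite ger0_norm.
  rewrite ler_norml => /andP[qK _]; have := sqr_ge0 (w x); rewrite expr2 => w2.
  have : 0 <= (q x + A) * (w x * w x) by rewrite mulr_ge0// /A; lra.
  lra.
have H2 : sqn w = - ip z p := ip_D1 T_gt0 (mode_z M) (mode_w M) cw cp (mode_zT M) (mode_wT M).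
have A2 : 0 < A / 2 by rewrite divr_gt0.
have := ip_AMGM T cz cp A2; rewrite invf_div => H3.
have := ler_norm (- ip z p); rewrite normrN => H4.
have H5 : A * sqn w <= A ^+ 2 / 4 * sqn z + sqn p.
  rewrite H2; apply: (@le_trans _ _ (A / 2 * (2 * `|ip z p|))).
    by rewrite mulrA divfK// ler_pM2l.
  apply: (@le_trans _ _ (A / 2 * (A / 2 * sqn z + 2 / A * sqn p))); first by rewrite ler_pM2l.
  rewrite le_eqVlt; apply/orP; left; apply/eqP; field.
  by rewrite gt_eqF.
have : A ^+ 2 / 4 * sqn z < sg * sqn z by rewrite ltr_pM2r.
lra.
Qed.

(** The Lipschitz constant may depend on x, as the bound of [mode_lipschitz] does
    through one of the two modes. *)
Lemma lipschitz_within (g : R -> R) a b' :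
  (forall x, a <= x <= b' -> exists C, forall y, a <= y <= b' -> `|g x - g y| <= C * `|x - y|) ->
  {within `[a, b'], continuous g}.
Proof.
move=> H; apply/subspace_continuousP => x; rewrite /= in_itv/= => xab.
have [C HC] := H x xab.
pose D := `|C| + 1; have D0 : 0 < D by rewrite ltr_wpDl.
apply/cvgrPdist_lt => eps eps0; rewrite near_withinE.
have h : \forall y \near x, `|x - y| < eps / D.
  exact: ((cvgrPdist_lt _ _).1 (@cvg_id _ (nbhs x)) _ (divr_gt0 eps0 D0)).
near=> y; rewrite /= in_itv/= => yab.
apply: (le_lt_trans (HC y yab)); apply: (@le_lt_trans _ _ (D * `|x - y|)).
  by rewrite ler_wpM2r// /D (le_trans (ler_norm _))// lerDl.
by rewrite mulrC -ltr_pdivlMr//; near: y.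
Unshelve. all: by end_near. Qed.

(** The multiplier vanishes for some sg: it is negative when sg = lam is small,
    positive when sg is large, and depends continuously on sg. *)
Theorem growing_mode : exists lam sg z w p r,
  [/\ 0 < lam, 0 < sg, forced_mode sg lam 0 z w p r & ip h z = 1].
Proof.
have [m0 [z0 [w0 [p0 [r0 [m00 M0 n0]]]]]] := negative_mode.
have [cz0 cw0 cp0 cr0] := mode_continuous M0.
pose g x := z0 x - w0 x.
have cg : continuous g by rewrite /g; cts.
pose C := sqn z0 + 2^-1 * sqn (fun x => z0 x + w0 x) + 2^-1 * sqn g.
have C0 : 0 <= C by rewrite /C !addr_ge0 ?mulr_ge0 ?ip_ge0 ?invr_ge0.
(* For sg = lam = sg1 the multiplier is at most m0 + sg1 * C < 0. *)
pose sg1 := - m0 / (C + 1).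
have C1 : 0 < C + 1 by lra.
have sg10 : 0 < sg1 by rewrite divr_gt0// oppr_gt0.
have neg m z w p r : forced_mode sg1 sg1 m z w p r -> ip h z = 1 -> m < 0.
  move=> M n; have [cz cw cp cr] := mode_continuous M.
  have D := mode_dist M0 n0 sg10 M n.
  have cd : continuous (fun x => z x - z0 x) by cts.
  have := ip_AMGM T cd cg (@ltr01 R); rewrite invr1 !mul1r => AM.
  have := ler_norm (ip (fun x => z x - z0 x) g) => no.
  rewrite (multiplierE M0 n0 M n).
  have z0w0 : ip z0 w0 = 0.
    by rewrite ipC; exact: mode_ip_w M0.
  have e1 : ip (fun x => z x - z0 x) g = ip z g - ip z0 g by rewrite ipBl.
  have e2 : ip z g = ip z z0 - ip z w0.
    by rewrite ipC /g ipBl// ![ip _ z]ipC.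
  have e3 : ip z0 g = sqn z0.
    by rewrite ipC /g ipBl// [ip w0 _]ipC z0w0 subr0.
  have : ip z z0 - ip z w0 <= C by rewrite /C; lra.
  move=> H; have : sg1 * (ip z z0 - ip z w0) <= sg1 * C by rewrite ler_pM2l.
  have : sg1 * (C + 1) = - m0 by rewrite /sg1 divfK// gt_eqF.
  lra.
have [S HS] := multiplier_gt0.
pose sg2 := Num.max S sg1 + 1.
have sg12 : sg1 <= sg2 by rewrite /sg2 (@le_trans _ _ (Num.max S sg1))// ?lerDl// le_max lexx orbT.
have Ssg2 : S < sg2 by rewrite /sg2 (@le_lt_trans _ _ (Num.max S sg1))// ?ltrDl// le_max lexx.
have /choice[mf Hmf] : forall s, exists m, 0 < s -> exists z w p r,
    forced_mode s sg1 m z w p r /\ ip h z = 1.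
  move=> s; case: (ltP 0 s) => s0; last by exists 0.
  by have [m [z [w [p [r H]]]]] := mode_exists sg1 s0; exists m => _; exists z, w, p, r.
have mfc : {within `[sg1, sg2], continuous mf}.
  apply: lipschitz_within => s2 /andP[s21 s22].
  have [z2 [w2 [p2 [r2 [M2 n2]]]]] := Hmf s2 (lt_le_trans sg10 s21).
  have [cz2 cw2 cp2 cr2] := mode_continuous M2.
  pose B := sqn z2 / sg1 ^+ 2.
  exists (sg2 * (B + sqn z0) + sg1 * (B + sqn w0) + `|ip z2 z0|) => s /andP[s1 s3].
  have [<-|ss] := eqVneq s2 s.
    by rewrite !subrr normr0 mulr0.
  have s0 := lt_le_trans sg10 s1.
  have [z [w [p [r [M n]]]]] := Hmf s s0.
  have [cz cw cp cr] := mode_continuous M.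
  pose d x := z x - z2 x; have cd : continuous d by rewrite /d; cts.
  have := mode_lipschitz s0 M n M2 n2; rewrite -/d.
  pose N := `|s2 - s|; have N0 : 0 < N by rewrite normr_gt0 subr_eq0.
  have NN : (s - s2) ^+ 2 = N ^+ 2 by rewrite /N real_normK ?num_real//; ring.
  rewrite NN => Hd.
  have Hd' : sqn d <= N ^+ 2 * B.
    apply: (le_trans Hd); rewrite /B -mulrA; apply: ler_wpM2l; first exact: sqr_ge0.
    rewrite mulrC ler_wpM2l ?ip_ge0// lef_pV2 ?posrE ?exprn_gt0//.
    by rewrite lerXn2r ?nnegrE// ltW.
  have amg k : continuous k -> `|ip d k| <= N * (B + sqn k).
    move=> ck; have NV : 0 < N^-1 by rewrite invr_gt0.
    have := ip_AMGM T cd ck NV; rewrite invrK => AM.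
    have : N^-1 * sqn d <= N * B.
      by rewrite -(ler_pM2l N0) mulrA mulfV ?gt_eqF// mul1r mulrA -expr2.
    have := ip_ge0 T k; have : 0 <= N * B.
      by rewrite mulr_ge0 ?(ltW N0)// /B divr_ge0 ?ip_ge0// sqr_ge0.
    move=> NB k0; have : 0 <= N * sqn k by rewrite mulr_ge0// ltW.
    by rewrite mulrDr; lra.
  rewrite -/N (multiplierE M0 n0 M n) (multiplierE M0 n0 M2 n2).
  have dz0 : ip d z0 = ip z z0 - ip z2 z0 by rewrite /d ipBl.
  have dw0 : ip d w0 = ip z w0 - ip z2 w0 by rewrite /d ipBl.
  have -> : m0 + s2 * ip z2 z0 - sg1 * ip z2 w0 - (m0 + s * ip z z0 - sg1 * ip z w0)
     = (s2 - s) * ip z2 z0 - s * ip d z0 + sg1 * ip d w0 by rewrite dz0 dw0; ring.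
  apply: (le_trans (ler_normD _ _)); apply: (le_trans (lerD (ler_normB _ _) (lexx _))).
  rewrite (normrM (s2 - s)) (normrM s) (normrM sg1) -/N (gtr0_norm s0) (gtr0_norm sg10).
  have h1 : s * `|ip d z0| <= sg2 * (N * (B + sqn z0)).
    by apply: ler_pM => //; [exact: ltW|exact: amg].
  have h2 : sg1 * `|ip d w0| <= sg1 * (N * (B + sqn w0)).
    by rewrite ler_pM2l//; exact: amg.
  lra.
have lo : mf sg1 < 0.
  by have [z [w [p [r [M n]]]]] := Hmf sg1 sg10; exact: neg M n.
have hi : 0 < mf sg2.
  have [z [w [p [r [M n]]]]] := Hmf sg2 (lt_le_trans sg10 sg12).
  exact: HS Ssg2 M n.
have [|s] := @IVT R mf sg1 sg2 0 sg12 mfc.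
  by rewrite ge_min le_max (ltW lo) (ltW hi) orbT.
rewrite in_itv/= => /andP[s1 _] ms0.
have s0 := lt_le_trans sg10 s1.
have [z [w [p [r [M n]]]]] := Hmf s s0.
by exists sg1, s, z, w, p, r; split => //; rewrite -ms0.
Qed.

End Modes.

(** * Instability from an eigenvector *)

Section Semigroup.
Context {R : realType} (V : lmodType R[i]) (X : set V) (nrm : V -> R).
Hypothesis Xlin : forall (a : R[i]) u v, X u -> X v -> X (a *: u + v).
Hypothesis nrm_ge0 : forall u, 0 <= nrm u.
Hypothesis nrmD : forall u v, X u -> X v -> nrm (u + v) <= nrm u + nrm v.
Hypothesis nrmZ : forall (t : R) u, X u -> nrm (t%:C%C *: u) = `|t| * nrm u.
Variables (A : V -> V -> Prop) (lam : R) (v : V).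
Hypotheses (lam_gt0 : 0 < lam) (Xv : X v) (nv : 0 < nrm v).
Hypothesis Av : A v (lam%:C%C *: v).

Lemma nrm0 : nrm 0 = 0.
Proof. by rewrite -(scale0r v) -[0 in LHS](rmorph0 (real_complex R)) nrmZ// normr0 mul0r. Qed.

Lemma eigenvalue_spectrum : spectrum X nrm A lam%:C%C.
Proof.
move=> [_ [M HM]]; have := HM v _ Av; rewrite subrr nrm0 mulr0.
by rewrite leNgt nv.
Qed.

Lemma spectrally_unstable_eigen : ~ spectrally_stable X nrm A.
Proof. by move=> /(_ _ eigenvalue_spectrum) /=; rewrite leNgt lam_gt0. Qed.

Lemma XZ (a : R[i]) u : X u -> X (a *: u).
Proof.
move=> Xu; have X0 : X 0 by have := Xlin (-1) Xv Xv; rewrite scaleN1r addNr.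
by have := Xlin a Xu X0; rewrite addr0.
Qed.

Lemma XD u w : X u -> X w -> X (u + w).
Proof. by move=> Xu Xw; have := Xlin 1 Xu Xw; rewrite scale1r. Qed.

Lemma XB u w : X u -> X w -> X (u - w).
Proof. by move=> Xu Xw; apply: XD => //; rewrite -scaleN1r; exact: XZ. Qed.

Lemma nrm_tri u w y : X u -> X w -> X y -> nrm (u - y) <= nrm (u - w) + nrm (w - y).
Proof. by move=> Xu Xw Xy; rewrite -(subrKA w); apply: nrmD; exact: XB. Qed.

Section Eigenvector.
Variable S : R -> V -> V.
Hypotheses (S0 : C0_semigroup X nrm S) (SA : is_generator X nrm S A).

Let E (t : R) : V := (expR (lam * t))%:C%C *: v.

Let XE t : X (E t). Proof. exact: XZ. Qed.
Let XS t u : 0 <= t -> X u -> X (S t u). Proof. by case: S0 => + _ _ _ _; apply. Qed.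

(** S h v and exp (lam h) v have the same derivative lam v at h = 0, the former
    because v is in the domain of the generator. *)
Lemma step_defect eps : 0 < eps -> exists2 d, 0 < d &
  forall h, 0 < h < d -> nrm (S h v - E h) <= eps * h.
Proof.
move=> eps0.
have := (SA Xv (XZ lam%:C%C Xv)).1 Av => G.
have e2 : 0 < eps / 2 by rewrite divr_gt0.
have [d1 /= d10 H1] := (cvgrPdist_lt _ _).1 G _ e2.
have De : is_derive 0 (1 : R) (fun h => expR (lam * h)) lam.
  have Dl : D1 (fun h => lam * h) (fun=> lam) by derive; ring.
  have := D1_comp (fun x => is_derive_expR x) Dl 0.
  by move/is_derive_eq; apply; rewrite mulr0 expR0 mul1r.
have [g [gE gc g0]] := (is_derive1_caratheodory _ _ _).1 De.
have e3 : 0 < eps / 2 / nrm v by rewrite divr_gt0.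
have [d2 /= d20 H2] := (cvgrPdist_lt _ _).1 gc _ e3.
exists (Num.min d1 d2); first by rewrite lt_min d10.
move=> h /andP[h0]; rewrite lt_min => /andP[hd1 hd2].
have hN : h != 0 by rewrite gt_eqF.
have Xh : X (S h v) by apply: XS => //; exact: ltW.
pose a := h^-1%:C%C *: (S h v - v) - lam%:C%C *: v.
have Xa : X a by apply: XB; apply: XZ => //; exact: XB.
have b1 : nrm a < eps / 2.
  have := H1 h; rewrite /ball_/= sub0r normrN gtr0_norm// => /(_ hd1 h0).
  by rewrite sub0r normrN ger0_norm.
have b2 : `|lam - g h| < eps / 2 / nrm v.
  by have := H2 h; rewrite /ball_/= sub0r normrN gtr0_norm// g0; apply.
have eh : expR (lam * h) = 1 + h * g h.
  by have := gE h; rewrite mulr0 expR0 subr0 => /eqP; rewrite subr_eq => /eqP ->; ring.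
have -> : S h v - E h = h%:C%C *: a + (h * (lam - g h))%:C%C *: v.
  rewrite /a /E eh scalerBr scalerA -rmorphM/= mulfV// scale1r.
  rewrite scalerA -rmorphM/= mulrBr rmorphB scalerBl rmorphD rmorph1 scalerDl scale1r.
  by rewrite addrA subrK opprD addrA.
apply: (le_trans (nrmD (XZ _ Xa) (XZ _ Xv))); rewrite !nrmZ// normrM gtr0_norm//.
have : `|lam - g h| * nrm v <= eps / 2 by rewrite -ler_pdivlMr// ltW.
move=> b3; have : h * nrm a <= h * (eps / 2) by rewrite ler_pM2l// ltW.
have : h * (`|lam - g h| * nrm v) <= h * (eps / 2) by rewrite ler_pM2l.
rewrite mulrA; lra.
Qed.

Variables (omega M : R).
Hypotheses (omega_ge0 : 0 <= omega) (omega_lt : omega < lam).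
Hypothesis growth : forall t u, 0 <= t -> X u -> nrm (S t u) <= M * expR (omega * t) * nrm u.

Lemma M_ge0 : 0 <= M.
Proof.
have := le_trans (nrm_ge0 _) (growth (lexx 0) Xv).
by rewrite mulr0 expR0 mulr1 pmulr_lge0.
Qed.

(** S (t + h) v - E (t + h) is exp (lam h) times the defect at time t plus the
    image under S t of the defect of one step. *)
Lemma defect_steps h n : 0 <= h ->
  nrm (S (n%:R * h) v - E (n%:R * h)) <=
  n%:R * (M * expR (lam * (n%:R * h)) * nrm (S h v - E h)).
Proof.
move=> h0; have [_ Slin _ [S1 Sadd] _] := S0.
have M0 := M_ge0.
set rho := nrm (S h v - E h); have rho0 : 0 <= rho by exact: nrm_ge0.
elim: n => [|n IH].
  by rewrite !mul0r /E mulr0 expR0 rmorph1 scale1r S1.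
set t := n%:R * h in IH *.
have t0 : 0 <= t by rewrite mulr_ge0.
have tS : n.+1%:R * h = t + h by rewrite -natr1 mulrDl mul1r.
rewrite tS.
have Xh := XS h0 Xv; have Xr : X (S h v - E h) := XB Xh (XE h).
have th0 : 0 <= t + h by rewrite addr_ge0.
pose e := expR (lam * h).
have shE : S h v = e%:C%C *: v + (S h v - E h) by rewrite /E -/e addrC subrK.
have X1 := XS th0 Xv; have X2 := XS t0 Xh.
pose w := e%:C%C *: S t v + S t (S h v - E h).
have Xw : X w by apply: Xlin; [exact: XS|exact: XS].
have n1 : nrm (S (t + h) v - w) <= 0.
  apply: (le_trans (nrm_tri X1 X2 Xw)); rewrite Sadd// add0r.
  by rewrite {1}shE Slin.
have n2 : nrm (w - E (t + h)) <= e * nrm (S t v - E t) + M * expR (omega * t) * rho.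
  have -> : w - E (t + h) = e%:C%C *: (S t v - E t) + S t (S h v - E h).
    rewrite /w scalerBr addrAC; congr (_ - _ + _).
    by rewrite /E scalerA -rmorphM/= mulrDr expRD mulrC.
  apply: (le_trans (nrmD (XZ _ (XB (XS t0 Xv) (XE t))) (XS t0 Xr))).
  rewrite nrmZ; last exact: XB (XS t0 Xv) (XE t).
  by rewrite gtr0_norm ?expR_gt0// lerD2l growth.
apply: (le_trans (nrm_tri X1 Xw (XE _))).
have e0 : 0 < e by exact: expR_gt0.
have eth : expR (lam * (t + h)) = e * expR (lam * t) by rewrite mulrDr expRD mulrC.
have h1 : e * nrm (S t v - E t) <= e * (n%:R * (M * expR (lam * t) * rho)).
  by rewrite ler_pM2l.
have h2 : M * expR (omega * t) * rho <= M * expR (lam * (t + h)) * rho.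
  rewrite ler_wpM2r// ler_wpM2l// ler_expR.
  by apply: ler_pM => //; [exact: ltW|rewrite lerDl].
have : n.+1%:R * (M * expR (lam * (t + h)) * rho) =
  e * (n%:R * (M * expR (lam * t) * rho)) + M * expR (lam * (t + h)) * rho.
  by rewrite -natr1 eth; ring.
lra.
Qed.

(** The n defects of steps t / n are o(t / n) each, so their sum tends to 0. *)
Lemma semigroup_eigen t : 0 < t -> nrm (S t v - E t) = 0.
Proof.
move=> t0; apply/eqP; rewrite eq_le nrm_ge0 andbT; apply/ler_addgt0Pl => eps eps0.
rewrite addr0; have M0 := M_ge0.
pose K := M * expR (lam * t) * t + 1.
have K0 : 0 < K by rewrite ltr_wpDl// !mulr_ge0// ?expR_ge0// ltW.
have [d d0 Hd] := step_defect (divr_gt0 eps0 K0).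
pose n := (Num.truncn (t / d)).+1.
have nd : t / d < n%:R.
  by have := truncn_itv (ltW (divr_gt0 t0 d0)) => /andP[_].
have n0 : 0 < n%:R :> R by rewrite ltr0n.
pose h := t / n%:R.
have h0 : 0 < h by rewrite divr_gt0.
have nh : n%:R * h = t by rewrite /h mulrC divfK// gt_eqF.
have hd : h < d by rewrite /h ltr_pdivrMr// mulrC -ltr_pdivrMr.
have := defect_steps n (ltW h0); rewrite nh => /le_trans; apply.
have := Hd h; rewrite h0 hd => /(_ isT) H.
apply: (@le_trans _ _ (n%:R * (M * expR (lam * t) * (eps / K * h)))).
  by rewrite ler_pM2l// ler_wpM2l// mulr_ge0// expR_ge0.
have -> : n%:R * (M * expR (lam * t) * (eps / K * h)) = (M * expR (lam * t) * t) * (eps / K).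
  transitivity (M * expR (lam * t) * (n%:R * h) * (eps / K)); first by ring.
  by rewrite nh.
apply: (@le_trans _ _ (K * (eps / K))).
  by rewrite ler_pM2r ?divr_gt0// /K lerDl.
by rewrite mulrC divfK// gt_eqF.
Qed.

(** exp ((lam - omega) t) is unbounded. *)
Lemma growth_absurd : False.
Proof.
pose M1 := M + 1; have M10 : 0 < M1 by rewrite /M1; have := M_ge0; lra.
have dl : 0 < lam - omega by rewrite subr_gt0.
pose t := M1 / (lam - omega); have t0 : 0 < t by rewrite divr_gt0.
have Xt := XS (ltW t0) Xv.
have h1 : nrm (E t) <= nrm (S t v).
  have -> : E t = S t v - (S t v - E t) by rewrite subKr.
  have XB' := XB Xt (XE t).
  apply: (le_trans (nrmD Xt _)); first by rewrite -scaleN1r; exact: XZ.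
  have -> : - (S t v - E t) = (-1)%:C%C *: (S t v - E t).
    by rewrite rmorphN rmorph1 scaleN1r.
  by rewrite nrmZ// semigroup_eigen// mulr0 addr0.
have := le_trans h1 (growth (ltW t0) Xv).
rewrite /E nrmZ// gtr0_norm ?expR_gt0// ler_pM2r//.
have -> : lam * t = M1 + omega * t.
  by rewrite -[lam](subrK omega) mulrDl /t mulrC divfK// gt_eqF.
rewrite expRD ler_pM2r ?expR_gt0// leNgt.
by rewrite (@lt_le_trans _ _ M1)// ?/M1 ?ltrDl// (le_trans _ (expR_ge1Dx _))// lerDr.
Qed.
End Eigenvector.

(** A semigroup generated by A acts on v as exp (lam t), so that its growth bound
    is at least lam. *)
Lemma linearly_unstable_eigen : ~ linearly_stable X nrm A.
Proof.
move=> [S [S0 SA]]; rewrite /growth_bound => gb.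
have l2 : (0 < (lam / 2)%:E)%E by rewrite lte_fin divr_gt0.
have /ereal_inf_lt [_ [om [M HM] <-]] := le_lt_trans gb l2.
rewrite lte_fin => om_lt.
have om2 : lam / 2 < lam by rewrite ltr_pdivrMr// ltr_pMr// ltr1n.
apply: (@growth_absurd S S0 SA (lam / 2) `|M|); rewrite ?divr_ge0 ?(ltW lam_gt0)//.
move=> t u t0 Xu; apply: (le_trans (HM t u t0 Xu)).
rewrite ler_wpM2r//; apply: (@le_trans _ _ (`|M| * expR (om * t))).
  by rewrite ler_wpM2r ?expR_ge0// ler_norm.
by rewrite ler_wpM2l// ler_expR ler_wpM2r// ltW.
Qed.

End Semigroup.

(** * The space of perturbations *)

Section Translation.
Context {R : realType}.
Notation mu := (@lebesgue_measure R).

Lemma lebesgue_measure_shift (t : R) (A : set R) : measurable A ->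
  pushforward mu ((fun x => x + t) : _ -> measurableTypeR R) A = mu A.
Proof.
have mf : measurable_fun [set: measurableTypeR R] ((fun x => x + t) : _ -> measurableTypeR R).
  by apply: measurable_funD; [exact: measurable_id|exact: measurable_cst].
move=> mA; apply/esym/lebesgue_measure_unique => //= _ [[a b]] _ <-.
rewrite /pushforward (_ : _ @^-1` _ = `]a - t, b - t]%classic); last first.
  by apply/seteqP; split => x /=; rewrite !in_itv/= ltrBlDr lerBrDr.
rewrite !lebesgue_measure_itv/= !lte_fin ltrD2r; case: ifPn => // _.
by rewrite -!EFinB; congr (_%:E); ring.
Qed.

Lemma negligible_shift (t : R) (B : set R) : mu.-negligible B ->
  mu.-negligible [set y | B (y + t)].
Proof.
move=> [A [mA A0 BA]]; exists [set y | A (y + t)]; split.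
- rewrite -[X in measurable X]setTI.
  have mf : measurable_fun [set: measurableTypeR R] ((fun x => x + t) : _ -> measurableTypeR R).
    by apply: measurable_funD; [exact: measurable_id|exact: measurable_cst].
  exact: mf.
- by have := lebesgue_measure_shift t mA; rewrite A0.
- by move=> y /=; exact: BA.
Qed.

(** The exceptional set is covered by countably many translates of a negligible
    subset of [0, K]. *)
Lemma ae_periodic (K : R) (P : R -> Prop) : 0 < K ->
  (forall y, P (y + K) <-> P y) ->
  {ae mu, forall y, 0 <= y <= K -> P y} -> {ae mu, forall y, P y}.
Proof.
move=> K0 per; rewrite /prop_near1 /nbhs /= /almost_everywhere => H.
set B := ~` _ in H.
have pern n y : P (y + n%:R * K) <-> P y.
  elim: n => [|n IH]; first by rewrite mul0r addr0.
  by rewrite -IH -(per (y + n%:R * K)) -natr1 mulrDl mul1r addrA.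
pose U := \bigcup_n ([set y | B (y + n%:R * K)] `|` [set y | B (y + - (n%:R * K))]).
have nU : mu.-negligible U.
  by apply: negligible_bigcup => n; apply: negligibleU; exact: negligible_shift.
suff sub : ~` [set x | P x] `<=` U by
  have [N [mN N0 UN]] := nU; exists N; split => //; exact: subset_trans sub UN.
move=> y /= nP.
have [m mK] : exists m : int, 0 <= y - m%:~R * K <= K.
  exists (Num.floor (y / K)); have /andP[f1 f2] := mem_rg1_floor (y / K).
  rewrite subr_ge0 -ler_pdivlMr// f1 /= lerBlDr -[X in _ <= X + _]mul1r -mulrDl addrC.
  by rewrite -ler_pdivrMr// ltW.
have inB y0 : 0 <= y0 <= K -> ~ P y0 -> B y0.
  by move=> y0K nP0; rewrite /B /= => h; apply: nP0; apply: h.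
case: (intP m) mK => [|n|n] mK.
- exists 0%N => //; left => /=; rewrite mul0r addr0; apply: inB => //.
  by move: mK; rewrite mul0r subr0.
- exists n.+1 => //; right => /=; apply: inB => // h; apply: nP.
  by have := (pern n.+1 _).2 h; rewrite subrK.
- exists n.+1 => //; left => /=; apply: inB; last by rewrite pern.
  by move: mK; rewrite mulrNz mulNr opprK.
Qed.
End Translation.

Lemma Re_lin (R : realType) (a x y : R[i]) :
  complex.Re (a * x + y) = complex.Re a * complex.Re x - complex.Im a * complex.Im x + complex.Re y.
Proof. by case: a x y => ? ? [? ?] [? ?]. Qed.

Lemma Im_lin (R : realType) (a x y : R[i]) :
  complex.Im (a * x + y) = complex.Re a * complex.Im x + complex.Im a * complex.Re x + complex.Im y.
Proof. by case: a x y => ? ? [? ?] [? ?]. Qed.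

Section L2Space.
Context {R : realType}.
Variables (K1 K2 : R) (K10 : 0 < K1) (K20 : 0 < K2).
Notation mu := (@lebesgue_measure R).
Notation mu2 := (@lebesgue2 R).
Notation R2 := (measurableTypeR R * measurableTypeR R)%type.
Notation C := (cell K1 K2 : set R2).

Definition sqm (v : cfun2 R) (z : R2) : R :=
  complex.Re (v z) ^+ 2 + complex.Im (v z) ^+ 2.

Lemma measurable_cell : measurable C.
Proof. by apply: measurableX; exact: measurable_itv. Qed.

Lemma cell_fin : (mu2 C < +oo)%E.
Proof.
rewrite /lebesgue2 product_measure1E; [|exact: measurable_itv|exact: measurable_itv].
by rewrite /= !lebesgue_measure_itv/= !lte_fin K10 K20 -!EFinB -EFinM ltry.
Qed.

Lemma sqm_measurable v : L2periodic K1 K2 v -> measurable_fun [set: R2] (sqm v).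
Proof.
by move=> [_ mre mim _]; apply: measurable_funD; apply: measurable_funX.
Qed.

Lemma sqm_ge0 v z : 0 <= sqm v z.
Proof. by rewrite addr_ge0 ?sqr_ge0. Qed.

Lemma sqm_integrable v : L2periodic K1 K2 v -> mu2.-integrable C (EFin \o sqm v).
Proof.
move=> Lv; apply/integrableP; split.
  apply/measurable_EFinP; apply: measurable_funS (sqm_measurable Lv) => //.
case: Lv => _ _ _; apply: le_lt_trans; rewrite le_eqVlt; apply/orP; left; apply/eqP.
by apply: eq_integral => z _ /=; rewrite ger0_norm ?sqm_ge0.
Qed.

Definition N2 v := \int[mu2]_(z in C) sqm v z.

Lemma L2normE v : L2norm K1 K2 v = Num.sqrt (N2 v).
Proof. by []. Qed.

Lemma N2_ge0 v : 0 <= N2 v.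
Proof. by apply: Rintegral_ge0 => z _; exact: sqm_ge0. Qed.

Lemma sqm_lin (a : R[i]) (u v : cfun2 R) z :
  sqm (a *: u + v) z <= 2 * (complex.Re a ^+ 2 + complex.Im a ^+ 2) * sqm u z + 2 * sqm v z.
Proof.
rewrite /sqm -subr_ge0.
have -> : (a *: u + v) z = a * u z + v z by [].
case: a => ra ia; case: (u z) => ru iu; case: (v z) => rv iv /=.
set x := ra * ru - ia * iu; set y := ra * iu + ia * ru.
have -> : 2 * (ra ^+ 2 + ia ^+ 2) * (ru ^+ 2 + iu ^+ 2) + 2 * (rv ^+ 2 + iv ^+ 2) -
  ((x + rv) ^+ 2 + (y + iv) ^+ 2) = (x - rv) ^+ 2 + (y - iv) ^+ 2.
  by rewrite /x /y; ring.
by rewrite addr_ge0 ?sqr_ge0.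
Qed.

Lemma L2periodic_lin (a : R[i]) (u v : cfun2 R) : L2periodic K1 K2 u -> L2periodic K1 K2 v ->
  L2periodic K1 K2 (a *: u + v).
Proof.
move=> Lu Lv; have [pu mru miu fu] := Lu; have [pv mrv miv fv] := Lv.
have mRe : measurable_fun [set: R2] (fun z => complex.Re ((a *: u + v) z) : R).
  have -> : (fun z => complex.Re ((a *: u + v) z)) = fun z : R2 =>
    complex.Re a * complex.Re (u z) - complex.Im a * complex.Im (u z) + complex.Re (v z).
    by apply/funext => z; exact: Re_lin.
  apply: measurable_funD => //; apply: measurable_funB; apply: measurable_funM => //; exact: measurable_cst.
have mIm : measurable_fun [set: R2] (fun z => complex.Im ((a *: u + v) z) : R).
  have -> : (fun z => complex.Im ((a *: u + v) z)) = fun z : R2 =>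
    complex.Re a * complex.Im (u z) + complex.Im a * complex.Re (u z) + complex.Im (v z).
    by apply/funext => z; exact: Im_lin.
  apply: measurable_funD => //; apply: measurable_funD; apply: measurable_funM => //; exact: measurable_cst.
split => //.
- move=> x y; have [u1 u2] := pu x y; have [v1 v2] := pv x y.
  split; first by transitivity (a * u (x + K1, y) + v (x + K1, y)); [by []|rewrite u1 v1].
  by transitivity (a * u (x, y + K2) + v (x, y + K2)); [by []|rewrite u2 v2].
set c := 2 * (complex.Re a ^+ 2 + complex.Im a ^+ 2).
have int : mu2.-integrable C (fun z => (c * sqm u z + 2 * sqm v z)%:E).
  have -> : (fun z => (c * sqm u z + 2 * sqm v z)%:E) =
    (fun z => c%:E * (EFin \o sqm u) z + 2%:E * (EFin \o sqm v) z)%E.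
    by apply/funext => z; rewrite /= EFinD !EFinM.
  have mC := measurable_cell.
  by apply: integrableD => //; apply: integrableZl => //; exact: sqm_integrable.
have /integrableP[_] := int; apply: le_lt_trans.
have mC := measurable_cell.
apply: ge0_le_integral => //.
- by move=> z _; rewrite lee_fin; exact: sqm_ge0.
- apply/measurable_EFinP; apply: (@measurable_funS _ _ _ _ setT) => //.
  by apply: measurable_funD; apply: measurable_funX.
- by apply: measurableT_comp => //; case/integrableP: int.
- move=> z _; rewrite lee_fin (le_trans (sqm_lin a u v z))// ler_norm//.
Qed.

(** Minkowski's inequality, from the inequality
    [|u + v|^2 <= (1 + t) |u|^2 + (1 + 1 / t) |v|^2]. *)
Lemma L2norm_triangle u v : L2periodic K1 K2 u -> L2periodic K1 K2 v ->
  L2norm K1 K2 (u + v) <= L2norm K1 K2 u + L2norm K1 K2 v.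
Proof.
move=> Lu Lv; rewrite !L2normE.
have Luv : L2periodic K1 K2 (u + v) by rewrite -[u]scale1r; exact: L2periodic_lin.
have mC := measurable_cell.
have H t : 0 < t -> N2 (u + v) <= (1 + t) * N2 u + (1 + t^-1) * N2 v.
  move=> t0; rewrite /N2 -!RintegralZl//; [|exact: sqm_integrable..].
  have iu : mu2.-integrable C (fun z => ((1 + t) * sqm u z)%:E).
    by under eq_fun do rewrite EFinM; apply: integrableZl => //; exact: sqm_integrable.
  have iv : mu2.-integrable C (fun z => ((1 + t^-1) * sqm v z)%:E).
    by under eq_fun do rewrite EFinM; apply: integrableZl => //; exact: sqm_integrable.
  rewrite -RintegralD//; apply: le_Rintegral => //.
  - exact: sqm_integrable.
  - exact: (integrableD mC iu iv).
  move=> z _; rewrite /sqm -subr_ge0.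
  have -> : (u + v) z = u z + v z by [].
  case: (u z) => ru iu'; case: (v z) => rv iv' /=.
  have tN : t != 0 by rewrite gt_eqF.
  have -> : (1 + t) * (ru ^+ 2 + iu' ^+ 2) + (1 + t^-1) * (rv ^+ 2 + iv' ^+ 2) -
    ((ru + rv) ^+ 2 + (iu' + iv') ^+ 2) = t * ((ru - t^-1 * rv) ^+ 2 + (iu' - t^-1 * iv') ^+ 2).
    by field.
  by rewrite mulr_ge0 ?addr_ge0 ?sqr_ge0// ltW.
(* The optimal t is |v| / |u|; the shift by d avoids a division by zero. *)
set a := Num.sqrt (N2 u); set b := Num.sqrt (N2 v).
have a0 : 0 <= a by rewrite sqrtr_ge0.
have b0 : 0 <= b by rewrite sqrtr_ge0.
have a2 : N2 u = a ^+ 2 by rewrite sqr_sqrtr// N2_ge0.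
have b2 : N2 v = b ^+ 2 by rewrite sqr_sqrtr// N2_ge0.
apply/ler_addgt0Pr => e e0; pose d := e / 2; have d0 : 0 < d by rewrite divr_gt0.
have ad : 0 < a + d by rewrite ltr_wpDl.
have bd : 0 < b + d by rewrite ltr_wpDl.
have t0 : 0 < (b + d) / (a + d) by rewrite divr_gt0.
have := H _ t0; rewrite a2 b2 invf_div => {}H.
have -> : a + b + e = (a + d) + (b + d) by rewrite /d; field.
rewrite -(ger0_norm (ltW (addr_gt0 ad bd))) -sqrtr_sqr ler_wsqrtr//.
apply: (le_trans H).
have aN : a + d != 0 by rewrite gt_eqF.
have bN : b + d != 0 by rewrite gt_eqF.
have -> : (a + d + (b + d)) ^+ 2 = (1 + (b + d) / (a + d)) * (a + d) ^+ 2 +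
  (1 + (a + d) / (b + d)) * (b + d) ^+ 2 by field; rewrite aN bN.
apply: lerD; apply: ler_wpM2l.
- by rewrite addr_ge0// ltW.
- by rewrite lerXn2r ?nnegrE ?lerDl// ?(ltW ad)// ltW.
- by rewrite addr_ge0// ltW// divr_gt0.
- by rewrite lerXn2r ?nnegrE ?lerDl// ?(ltW bd)// ltW.
Qed.

Lemma L2normZ (t : R) u : L2periodic K1 K2 u ->
  L2norm K1 K2 (t%:C%C *: u) = `|t| * L2norm K1 K2 u.
Proof.
move=> Lu; rewrite !L2normE -sqrtr_sqr -sqrtrM ?sqr_ge0//; congr Num.sqrt.
have mC := measurable_cell.
rewrite /N2 -RintegralZl//; last exact: sqm_integrable.
apply: eq_Rintegral => z _; rewrite /sqm.
have -> : (t%:C%C *: u) z = t%:C%C * u z by [].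
by case: (u z) => ru iu /=; ring.
Qed.

(** Needed for the stability under sums of the condition on the means of the
    slices. Fubini's theorem applies on the cell, where g is integrable, and
    periodicity in y does the rest. *)
Lemma ae_slice_integrable (g : R2 -> R) (v : cfun2 R) : L2periodic K1 K2 v ->
  measurable_fun [set: R2] g -> (forall z, g z ^+ 2 <= sqm v z) ->
  (forall x y, g (x, y + K2) = g (x, y)) ->
  {ae mu, forall y : R, mu.-integrable `[0, K1] (fun x => (g (x, y))%:E)}.
Proof.
move=> Lv mg gv gper; have mC := measurable_cell.
have ig : mu2.-integrable C (EFin \o g).
  apply: (@le_integrable _ _ _ _ _ mC _ (fun z => (1 + sqm v z)%:E)).
  - by apply/measurable_EFinP; exact: measurable_funS mg.
  - move=> z _; rewrite lee_fin [leRHS]ger0_norm; last exact: (addr_ge0 ler01 (sqm_ge0 v z)).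
    have := gv z; have := sqr_ge0 (`|g z| - 1); rewrite -[g z ^+ 2]real_normK ?num_real//.
    have := normr_ge0 (g z); nra.
  - have i1 : mu2.-integrable C (fun=> 1%:E).
      apply/integrableP; split; first exact: measurable_cst.
      by under eq_integral do rewrite /= normr1; rewrite integral_cst// mul1e cell_fin.
    exact: (integrableD mC i1 (sqm_integrable Lv)).
apply: (@ae_periodic R K2) => //.
  by move=> y; rewrite (_ : (fun x => (g (x, y + K2))%:E) = (fun x => (g (x, y))%:E))//;
    apply/funext => x; rewrite gper.
have ir : mu2.-integrable setT ((EFin \o g) \_ C) by apply/integrable_restrict => //; rewrite setTI.
have := ae_integrable2 ir; apply: filterS => y /= iy yK.
have := iy; rewrite (_ : (fun x => _) = ((fun x => (g (x, y))%:E) \_ `[0, K1])); last first.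
  apply/funext => x; rewrite !patchE /cell; congr (if _ then _ else _).
  apply/idP/idP; rewrite !inE /= !in_itv/=; first by case.
  by move=> xK; rewrite xK; split.
move=> h; rewrite -(setTI `[0, K1]%classic).
by apply/integrable_restrict => //; exact: measurable_itv.
Qed.

Lemma X0_lin (a : R[i]) (u v : cfun2 R) : X0 K1 K2 u -> X0 K1 K2 v -> X0 K1 K2 (a *: u + v).
Proof.
move=> [Lu u0] [Lv v0]; split; first exact: L2periodic_lin.
have [pu mru miu fu] := Lu; have [pv mrv miv fv] := Lv.
have leRe (w : cfun2 R) (z : R2) : complex.Re (w z) ^+ 2 <= sqm w z by rewrite lerDl sqr_ge0.
have leIm (w : cfun2 R) (z : R2) : complex.Im (w z) ^+ 2 <= sqm w z by rewrite lerDr sqr_ge0.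
have iru := ae_slice_integrable Lu mru (leRe u) (fun x y => congr1 (@complex.Re R) (pu x y).2).
have iiu := ae_slice_integrable Lu miu (leIm u) (fun x y => congr1 (@complex.Im R) (pu x y).2).
have irv := ae_slice_integrable Lv mrv (leRe v) (fun x y => congr1 (@complex.Re R) (pv x y).2).
have iiv := ae_slice_integrable Lv miv (leIm v) (fun x y => congr1 (@complex.Im R) (pv x y).2).
have FF : Filter (nbhs (almost_everywhere mu)) := ae_filter_ringOfSetsType mu.
near=> y.
have [ru iu] : \int[mu]_(x in `[0, K1]) complex.Re (u (x, y)) = 0 /\
        \int[mu]_(x in `[0, K1]) complex.Im (u (x, y)) = 0 by near: y.
have [rv iv] : \int[mu]_(x in `[0, K1]) complex.Re (v (x, y)) = 0 /\
        \int[mu]_(x in `[0, K1]) complex.Im (v (x, y)) = 0 by near: y.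
have j1 : mu.-integrable `[0, K1] (fun x => (complex.Re (u (x, y)))%:E) by near: y.
have j2 : mu.-integrable `[0, K1] (fun x => (complex.Im (u (x, y)))%:E) by near: y.
have j3 : mu.-integrable `[0, K1] (fun x => (complex.Re (v (x, y)))%:E) by near: y.
have j4 : mu.-integrable `[0, K1] (fun x => (complex.Im (v (x, y)))%:E) by near: y.
have iZ r (f : R -> R) : mu.-integrable `[0, K1] (fun x => (f x)%:E) ->
    mu.-integrable `[0, K1] (fun x => (r * f x)%:E).
  move=> h; have -> : (fun x => (r * f x)%:E) = (fun x => r%:E * (f x)%:E)%E.
    by apply/funext => x; rewrite EFinM.
  by apply: integrableZl.
have iD (f h : R -> R) : mu.-integrable `[0, K1] (fun x => (f x)%:E) ->
    mu.-integrable `[0, K1] (fun x => (h x)%:E) -> mu.-integrable `[0, K1] (fun x => (f x + h x)%:E).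
  move=> h1 h2; have -> : (fun x => (f x + h x)%:E) = (fun x => (f x)%:E + (h x)%:E)%E.
    by apply/funext => x; rewrite EFinD.
  by apply: integrableD.
split.
- rewrite (_ : \int[mu]_(x in _) _ = \int[mu]_(x in `[0, K1])
    (complex.Re a * complex.Re (u (x, y)) + (- complex.Im a) * complex.Im (u (x, y)) + complex.Re (v (x, y)))); last first.
    apply: eq_Rintegral => x _; have -> : (a *: u + v) (x, y) = a * u (x, y) + v (x, y) by [].
    by rewrite ?Re_lin ?Im_lin ?mulNr.
  rewrite !RintegralD ?RintegralZl//; try (by apply: iZ); try (by apply: iD; apply: iZ).
  by rewrite ru iu rv !mulr0 !addr0.
- rewrite (_ : \int[mu]_(x in _) _ = \int[mu]_(x in `[0, K1])
    (complex.Re a * complex.Im (u (x, y)) + complex.Im a * complex.Re (u (x, y)) + complex.Im (v (x, y)))); last first.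
    apply: eq_Rintegral => x _; have -> : (a *: u + v) (x, y) = a * u (x, y) + v (x, y) by [].
    by rewrite ?Re_lin ?Im_lin ?mulNr.
  rewrite !RintegralD ?RintegralZl//; try (by apply: iZ); try (by apply: iD; apply: iZ).
  by rewrite ru iu iv !mulr0 !addr0.
Unshelve. all: by end_near. Qed.
End L2Space.

(** * Integrals over the period cell and test functions *)

Section Periodize.
Context {R : realType}.
Variables (T : R) (T_gt0 : 0 < T).

(** The T-periodic function that agrees with g on [0, T[. *)
Definition periodize (g : R -> R) (x : R) : R := g (x - (Num.floor (x / T))%:~R * T).

Lemma periodize_periodic g x : periodize g (x + T) = periodize g x.
Proof.
rewrite /periodize mulrDl divff ?gt_eqF// floorDrz ?rpred1// floor1.
by rewrite intrD mulrDl mul1r opprD addrACA subrr addr0.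
Qed.

Lemma periodizeE g x : g T = g 0 -> 0 <= x <= T -> periodize g x = g x.
Proof.
move=> gT /andP[x0]; rewrite /periodize le_eqVlt => /predU1P[->|xT].
  by rewrite divff ?gt_eqF// floor1 mul1r subrr gT.
have -> : Num.floor (x / T) = 0.
  by apply/eqP; rewrite floor_eq/= divr_ge0 ?(ltW T_gt0)//= ltr_pdivrMr// add0r mul1r.
by rewrite mul0r subr0.
Qed.

Lemma measurable_floor_scale (a : R) : 0 <= a ->
  measurable_fun [set: measurableTypeR R] (fun x : R => (Num.floor (x * a))%:~R : R).
Proof.
move=> a0; apply: nondecreasing_measurable => // x y xy.
by rewrite ler_int; apply: le_floor; rewrite ler_wpM2r.
Qed.

Lemma measurable_periodize g : continuous g ->
  measurable_fun [set: measurableTypeR R] (periodize g).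
Proof.
move=> cg; apply: (@measurableT_comp _ _ _ _ _ _ g); first exact: continuous_measurable_fun.
apply: measurable_funB; first exact: measurable_id.
apply: measurable_funM; last exact: measurable_cst.
by apply: measurable_floor_scale; rewrite invr_ge0 ltW.
Qed.
End Periodize.

Section Continuous2.
Context {R : realType}.
Notation R2 := (measurableTypeR R * measurableTypeR R)%type.
Implicit Types F : R * R -> R.

Lemma cvg_pairR (U : Type) (FF : set_system U) {FFF : Filter FF} (f g : U -> R) (a b : R) :
  f @ FF --> a -> g @ FF --> b -> (fun t => (f t, g t)) @ FF --> ((a, b) : R * R).
Proof. by move=> fa gb; exact: (@cvg_pair _ _ _ FF (nbhs a) (nbhs b) _ _ _ f g fa gb). Qed.

Lemma slice1_continuous F y : continuous F -> continuous (fun x => F (x, y)).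
Proof.
move=> cF x; apply: (cvg_comp (fun x : R => (x, y)) F _ (cF (x, y))).
by apply: (@cvg_pairR _ (nbhs x)); [exact: cvg_id|exact: cvg_cst].
Qed.

Lemma slice2_continuous F x : continuous F -> continuous (fun y => F (x, y)).
Proof.
move=> cF y; apply: (cvg_comp (fun y : R => (x, y)) F _ (cF (x, y))).
by apply: (@cvg_pairR _ (nbhs y)); [exact: cvg_cst|exact: cvg_id].
Qed.

(** F is the limit of F (floor (n x) / n, y), which is measurable since its first
    argument takes countably many values. *)
Lemma continuous2_measurable F : continuous F -> measurable_fun [set: R2] (F : R2 -> R).
Proof.
move=> cF.
pose s (n : nat) (x : R) : R := (Num.floor (x * n.+1%:R))%:~R / n.+1%:R.
have n0 n : 0 < n.+1%:R :> R by rewrite ltr0n.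
apply: (@measurable_fun_cvg _ _ _ _ (fun n (z : R2) => F (s n z.1, z.2))).
- move=> n _ B mB; rewrite setTI.
  pose fl (x : measurableTypeR R) : measurableTypeR R := (Num.floor (x * n.+1%:R))%:~R.
  have mfl : measurable_fun setT fl by apply: measurable_floor_scale; rewrite ltW.
  pose G (m : int) : set R2 := (fl @^-1` [set m%:~R]) `*` [set y | B (F (m%:~R / n.+1%:R, y))].
  have mG m : measurable (G m).
    apply: measurableX; first by rewrite -[X in measurable X]setTI; exact: mfl.
    rewrite -[X in measurable X]setTI.
    have : measurable_fun setT (fun y : measurableTypeR R => F (m%:~R / n.+1%:R, y) : measurableTypeR R).
      by apply: continuous_measurable_fun; exact: slice2_continuous.
    by apply.
  have -> : (fun z : R2 => F (s n z.1, z.2)) @^-1` B = \bigcup_i (G (Posz i) `|` G (Negz i)).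
    apply/seteqP; split => [[x y] /= Bxy|[x y] /= [i _ []] /= [fx]]; last first.
    + by rewrite /s -/(fl x) fx.
    + by rewrite /s -/(fl x) fx.
    case E : (Num.floor (x * n.+1%:R)) => [i|i]; exists i => //; [left|right].
    + by split => /=; rewrite /fl ?E//; move: Bxy; rewrite /s E.
    + by split => /=; rewrite /fl ?E//; move: Bxy; rewrite /s E.
  by apply: bigcupT_measurable => i; exact: measurableU.
- move=> [x y] _ /=.
  have sx : s n x @[n --> \oo] --> x.
    apply/cvgrPdist_le => eps eps0.
    have := (cvgrPdist_lt _ _).1 (@cvg_harmonic R) _ eps0 => /(_ _).
    apply: filterS => n; rewrite sub0r normrN gtr0_norm ?invr_gt0// => /ltW; apply: le_trans.
    have /andP[f1 f2] := mem_rg1_floor (x * n.+1%:R).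
    rewrite /s ger0_norm; last by rewrite subr_ge0 ler_pdivrMr.
    rewrite lerBlDr -[X in X + _]mul1r /harmonic/= -mulrDl addrC ler_pdivlMr// ltW//.
  apply: (cvg_comp (fun n => (s n x, y)) F _ (cF (x, y))).
  by apply: (@cvg_pairR _ \oo); [exact: sx|exact: cvg_cst].
Qed.
End Continuous2.

Section Fubini.
Context {R : realType}.
Variables (K1 K2 : R) (K10 : 0 < K1) (K20 : 0 < K2).
Notation mu := (@lebesgue_measure R).
Notation mu2 := (@lebesgue2 R).
Notation R2 := (measurableTypeR R * measurableTypeR R)%type.
Notation C := (cell K1 K2 : set R2).
Implicit Types F : R * R -> R.

Lemma cell_compact : compact (cell K1 K2).
Proof. by apply: compact_setX; exact: segment_compact. Qed.

Lemma cell_integrable F : continuous F -> mu2.-integrable C (fun z => (F z)%:E).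
Proof.
move=> cF; have mC := @measurable_cell R K1 K2.
have mF := continuous2_measurable cF.
have : compact (F @` cell K1 K2).
  by apply: continuous_compact; [exact: continuous_subspaceT|exact: cell_compact].
move=> /compact_bounded [M [_ HM]].
have HM' := HM (`|M| + 1) (ltr_pwDr ltr01 (ler_norm M)).
apply: (@le_integrable _ _ _ _ _ mC _ (fun=> (`|M| + 1)%:E)).
- by apply/measurable_EFinP; exact: measurable_funS mF.
- move=> z Cz; rewrite lee_fin [leRHS]ger0_norm ?addr_ge0//.
  by apply: HM'; exists z.
- apply/integrableP; split; first exact: measurable_cst.
  have -> : (\int[mu2]_(z in C) `|(`|M| + 1)%:E| = `|(`|M| + 1)%:E| * mu2 C)%E.
    by rewrite -integral_cst.
  by rewrite lte_mul_pinfty// ?cell_fin.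
Qed.

Lemma patch_cell F x y : ((fun z => (F z)%:E) \_ C) (x, y) =
  if (x \in `[0, K1]) && (y \in `[0, K2]) then (F (x, y))%:E else 0%E.
Proof.
rewrite patchE; congr (if _ then _ else _); apply/idP/idP.
  by rewrite inE /cell /= => -[-> ->].
by move=> /andP[h1 h2]; rewrite inE; split.
Qed.

Lemma itv_Rintegral_fin (g : R -> R) a b : continuous g ->
  (\int[mu]_(x in `[a, b]) (g x)%:E)%E = (\int[mu]_(x in `[a, b]) g x)%:E.
Proof.
move=> cg; rewrite fineK//; apply: integrable_fin_num => //.
exact: (itv_integrable a b cg).
Qed.

Lemma cell_integral21 F : continuous F -> \int[mu2]_(z in C) F z =
  \int[mu]_(y in `[0, K2]) \int[mu]_(x in `[0, K1]) F (x, y).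
Proof.
move=> cF; have mC := @measurable_cell R K1 K2.
have iF : mu2.-integrable setT ((fun z => (F z)%:E) \_ C).
  by apply/integrable_restrict => //; rewrite setTI; exact: cell_integrable.
rewrite /Rintegral integral_mkcond -(integral21_prod_meas1 iF); congr fine.
rewrite [RHS]integral_mkcond; apply: eq_integral => y _; rewrite /fubini_G patchE.
case: ifPn => [|yn].
  rewrite inE => yK; rewrite -itv_Rintegral_fin; last exact: slice1_continuous.
  rewrite [RHS]integral_mkcond; apply: eq_integral => x _.
  rewrite patch_cell patchE (_ : y \in `[0, K2])// andbT; congr (if _ then _ else _).
  by apply/idP/idP; rewrite inE.
apply: integral0_eq => x _; rewrite patch_cell (_ : (y \in `[0, K2]) = false) ?andbF//.
by apply/negbTE; apply: contraNN yn => h; rewrite inE.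
Qed.

Lemma cell_integral12 F : continuous F -> \int[mu2]_(z in C) F z =
  \int[mu]_(x in `[0, K1]) \int[mu]_(y in `[0, K2]) F (x, y).
Proof.
move=> cF; have mC := @measurable_cell R K1 K2.
have iF : mu2.-integrable setT ((fun z => (F z)%:E) \_ C).
  by apply/integrable_restrict => //; rewrite setTI; exact: cell_integrable.
rewrite /Rintegral integral_mkcond -(integral12_prod_meas1 iF); congr fine.
rewrite [RHS]integral_mkcond; apply: eq_integral => x _; rewrite /fubini_F patchE.
case: ifPn => [|xn].
  rewrite inE => xK; rewrite -itv_Rintegral_fin; last exact: slice2_continuous.
  rewrite [RHS]integral_mkcond; apply: eq_integral => y _.
  rewrite patch_cell patchE (_ : x \in `[0, K1])//; congr (if _ then _ else _).
  by apply/idP/idP; rewrite inE.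
apply: integral0_eq => y _; rewrite patch_cell (_ : (x \in `[0, K1]) = false)//.
by apply/negbTE; apply: contraNN xn => h; rewrite inE.
Qed.

Definition cell_int F : R := \int[mu2]_(z in C) F z.
Notation J := cell_int.

Lemma JD F G : continuous F -> continuous G -> J (fun z => F z + G z) = J F + J G.
Proof.
move=> cF cG; rewrite /J RintegralD//; [exact: measurable_cell|exact: cell_integrable..].
Qed.

Lemma JZ a F : continuous F -> J (fun z => a * F z) = a * J F.
Proof.
move=> cF; rewrite /J RintegralZl//; [exact: measurable_cell|exact: cell_integrable].
Qed.

Lemma eq_J F G : (forall x y, 0 <= x <= K1 -> 0 <= y <= K2 -> F (x, y) = G (x, y)) ->
  J F = J G.
Proof.
move=> FG; apply: eq_Rintegral => -[x y]; rewrite inE /cell /= !in_itv/= => -[h1 h2].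
exact: FG.
Qed.

Lemma J0_x F : continuous F ->
  (forall y, \int[mu]_(x in `[0, K1]) F (x, y) = 0) -> J F = 0.
Proof.
move=> cF F0; rewrite /J cell_integral21//.
rewrite (_ : (fun y => \int[mu]_(x in `[0, K1]) F (x, y)) = (fun=> 0)); last exact/funext.
by rewrite /Rintegral integral0.
Qed.

Lemma J0_y F : continuous F ->
  (forall x, \int[mu]_(y in `[0, K2]) F (x, y) = 0) -> J F = 0.
Proof.
move=> cF F0; rewrite /J cell_integral12//.
rewrite (_ : (fun x => \int[mu]_(y in `[0, K2]) F (x, y)) = (fun=> 0)); last exact/funext.
by rewrite /Rintegral integral0.
Qed.
End Fubini.

Section TestFunctions.
Context {R : realType}.
Implicit Types psi : R * R -> R.

Lemma slice1_D1 psi : (forall z, derivable psi z (1, 0)) ->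
  forall y, D1 (fun x => psi (x, y)) (fun x => px psi (x, y)).
Proof.
move=> dpsi y x; have := dpsi (x, y).
have E : (fun h => h^-1 *: ((psi \o shift (x, y)) (h *: (1, 0)) - psi (x, y))) =
  (fun h => h^-1 *: (((fun x => psi (x, y)) \o shift x) (h *: (1 : R)) - psi (x, y))).
  apply/funext => h /=; congr (_ *: (psi _ - _)).
  transitivity ((h *: (1 : R) + x, h *: (0 : R) + y) : R * R); first by [].
  by rewrite scaler0 add0r.
rewrite /px; split; first by rewrite /derivable -E; exact: (dpsi (x, y)).
by rewrite /derive -E.
Qed.

Lemma slice2_D1 psi : (forall z, derivable psi z (0, 1)) ->
  forall x, D1 (fun y => psi (x, y)) (fun y => py psi (x, y)).
Proof.
move=> dpsi x y; have := dpsi (x, y).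
have E : (fun h => h^-1 *: ((psi \o shift (x, y)) (h *: (0, 1)) - psi (x, y))) =
  (fun h => h^-1 *: (((fun y => psi (x, y)) \o shift y) (h *: (1 : R)) - psi (x, y))).
  apply/funext => h /=; congr (_ *: (psi _ - _)).
  transitivity ((h *: (0 : R) + x, h *: (1 : R) + y) : R * R); first by [].
  by rewrite scaler0 add0r.
rewrite /py; split; first by rewrite /derivable -E; exact: (dpsi (x, y)).
by rewrite /derive -E.
Qed.

(** Used to see that the derivatives of a test function are test functions. *)
Lemma D1_periodic (K : R) (F f : R -> R) : D1 F f -> (forall x, F (x + K) = F x) ->
  forall x, f (x + K) = f x.
Proof.
move=> Ff per x.
have h : D1 (fun x => F (x + K)) (fun x => f (x + K)).
  have Dt : D1 (fun x : R => x + K) (fun=> 1) by derive; rewrite addr0.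
  by apply: D1_eq (D1_comp Ff Dt) _ => y /=; rewrite mulr1.
have e : (fun x => F (x + K)) = F by apply/funext.
rewrite e in h; have [_ <-] := h x; have [_ <-] := Ff x; by [].
Qed.

Lemma test_fun_px K1 K2 psi : test_fun K1 K2 psi -> test_fun K1 K2 (px psi).
Proof.
move=> [sm per]; split => [n|x y].
  by have [_ [_ _ + _]] := sm n.+1.
have [_ [dx dy _ _]] := sm 1%N; split.
  by apply: (D1_periodic (slice1_D1 dx y)) => t; exact: (per t y).1.
have e : (fun x => psi (x, y + K2)) = (fun x => psi (x, y)).
  by apply/funext => t; exact: (per t y).2.
have [_ <-] := slice1_D1 dx (y + K2) x; have [_ <-] := slice1_D1 dx y x.
by rewrite e.
Qed.

Lemma test_fun_py K1 K2 psi : test_fun K1 K2 psi -> test_fun K1 K2 (py psi).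
Proof.
move=> [sm per]; split => [n|x y].
  by have [_ [_ _ _ +]] := sm n.+1.
have [_ [dx dy _ _]] := sm 1%N; split; last first.
  by apply: (D1_periodic (slice2_D1 dy x)) => t; exact: (per x t).2.
have e : (fun y => psi (x + K1, y)) = (fun y => psi (x, y)).
  by apply/funext => t; exact: (per x t).1.
have [_ <-] := slice2_D1 dy (x + K1) y; have [_ <-] := slice2_D1 dy x y.
by rewrite e.
Qed.

Lemma test_fun_continuous K1 K2 psi : test_fun K1 K2 psi -> continuous psi.
Proof. by move=> [sm _]; have [] := sm 0%N. Qed.

Lemma test_fun_D1x K1 K2 psi : test_fun K1 K2 psi ->
  forall y, D1 (fun x => psi (x, y)) (fun x => px psi (x, y)).
Proof. by move=> [sm _]; have [_ [dx _ _ _]] := sm 1%N; exact: slice1_D1. Qed.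

Lemma test_fun_D1y K1 K2 psi : test_fun K1 K2 psi ->
  forall x, D1 (fun y => psi (x, y)) (fun y => py psi (x, y)).
Proof. by move=> [sm _]; have [_ [_ dy _ _]] := sm 1%N; exact: slice2_D1. Qed.

Lemma test_fun_periodic K1 K2 psi : test_fun K1 K2 psi ->
  (forall y, psi (K1, y) = psi (0, y)) /\ (forall x, psi (x, K2) = psi (x, 0)).
Proof.
move=> [_ per]; split => [y|x]; first by have := (per 0 y).1; rewrite add0r.
by have := (per x 0).2; rewrite add0r.
Qed.
End TestFunctions.

(** * The transverse eigenfunction *)

Section Factors.
Context {R : realType}.

Definition fst1 (g : R -> R) (t : R * R) : R := g t.1.

Lemma fst1_continuous g : continuous g -> continuous (fst1 g).
Proof. by move=> cg t; apply: (cvg_comp fst g _ (cg t.1)); exact: cvg_fst. Qed.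

Variable k : R.

Definition cosy (t : R * R) : R := cos (k * t.2).

Lemma cosky_continuous : continuous (fun y : R => cos (k * y)).
Proof.
have Dk : D1 (fun y => k * y) (fun=> k) by derive; ring.
exact: D1_continuous (D1_comp D1_cos Dk).
Qed.

Lemma cosy_continuous : continuous cosy.
Proof.
move=> t; rewrite /cosy.
apply: (cvg_comp snd (fun y => cos (k * y)) _ (@cosky_continuous t.2)).
exact: cvg_snd.
Qed.
End Factors.

Section Packet.
Context {R : realType}.
Variables (T k : R) (T_gt0 : 0 < T) (k_gt0 : 0 < k).
Notation I := (period_int T).
Notation ip := (period_ip T).
Notation mu := (@lebesgue_measure R).
Notation R2 := (measurableTypeR R * measurableTypeR R)%type.
Let K2 := pi *+ 2 / k.
Notation J := (cell_int T K2).

Lemma K2_gt0 : 0 < K2.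
Proof. by rewrite divr_gt0// pmulrn_lgt0// pi_gt0. Qed.

(** Only the values of g on [0, T] matter; its periodization makes the product
    an element of the space of periodic functions. *)
Definition packet (g : R -> R) : cfun2 R :=
  fun t => (periodize T g t.1 * cos (k * t.2))%:C%C.

Lemma packetZ a g : a%:C%C *: packet g = packet (fun x => a * g x).
Proof.
apply/funext => t; rewrite /packet.
have -> : (a%:C%C *: (fun t : R * R => (periodize T g t.1 * cos (k * t.2))%:C%C) : cfun2 R) t =
  a%:C%C * (periodize T g t.1 * cos (k * t.2))%:C%C by [].
by rewrite -rmorphM/= /periodize mulrA.
Qed.

Section OnePacket.
Variable g : R -> R.
Hypotheses (cg : continuous g) (gT : g T = g 0).

Lemma packetE x y : 0 <= x <= T -> packet g (x, y) = (g x * cos (k * y))%:C%C.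
Proof. by move=> xT; rewrite /packet /= (periodizeE T_gt0 gT). Qed.

Lemma packet_L2 : L2periodic T K2 (packet g).
Proof.
have mw := measurable_periodize T_gt0 cg.
have mRe : measurable_fun [set: R2] (fun z => complex.Re (packet g z) : R).
  apply: measurable_funM.
    by apply: (@measurableT_comp _ _ _ _ _ _ (periodize T g)) => //; exact: measurable_fst.
  apply: (@measurableT_comp _ _ _ _ _ _ (fun y : measurableTypeR R => cos (k * y))).
    by apply: continuous_measurable_fun; exact: (@cosky_continuous _ k).
  exact: measurable_snd.
split => //.
- move=> x y; rewrite /packet /= (periodize_periodic T_gt0); split => //.
  congr ((_ * _)%:C%C); rewrite mulrDr mulrC -/(GRing.mul _ _) [k * K2]mulrC divfK ?gt_eqF//.
  by rewrite mulrC cosD2pi.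
have cF : continuous (fun t => (fst1 g t * cosy k t) ^+ 2).
  have h1 := fst1_continuous cg; have h2 := @cosy_continuous _ k; cts.
have /integrableP[_] := cell_integrable T_gt0 K2_gt0 cF; apply: le_lt_trans.
rewrite le_eqVlt; apply/orP; left; apply/eqP; apply: eq_integral => -[x y].
rewrite inE /cell /= !in_itv/= => -[xT yK]; rewrite (periodizeE T_gt0 gT)//.
by rewrite expr0n/= addr0 ger0_norm ?sqr_ge0.
Qed.

Lemma packet_X0 : I g = 0 -> X0 T K2 (packet g).
Proof.
move=> g0; split; first exact: packet_L2.
apply: aeW => y; split; last by rewrite /Rintegral integral0.
have -> : \int[mu]_(x in `[0, T]) complex.Re (packet g (x, y)) = I (fun x => cos (k * y) * g x).
  by apply: eq_I => x xT; rewrite packetE//= mulrC.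
by rewrite IZ// g0 mulr0.
Qed.

Definition pairing (psi : R * R -> R) : R := J (fun t => fst1 g t * cosy k t * psi t).

Lemma dist_packet psi : dist_of T K2 (packet g) psi = (pairing psi)%:C%C.
Proof.
rewrite /dist_of; congr Complex.
  by apply: (@eq_J _ T K2) => x y xT yK; rewrite packetE.
rewrite (_ : \int[_]_(z in _) _ = \int[@lebesgue2 R]_(z in cell T K2) 0).
  by rewrite /Rintegral integral0.
by apply: eq_Rintegral => z _; rewrite mul0r.
Qed.
End OnePacket.

Lemma packet_norm g : continuous g -> g T = g 0 -> 0 < ip g g -> 0 < L2norm T K2 (packet g).
Proof.
move=> cg gT gg; rewrite sqrtr_gt0.
have cc := @cosky_continuous _ k.
have -> : \int[@lebesgue2 R]_(z in cell T K2) (complex.Re (packet g z) ^+ 2 + complex.Im (packet g z) ^+ 2)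
    = J (fun t => (fst1 g t * cosy k t) ^+ 2).
  by apply: (@eq_J _ T K2) => x y xT yK; rewrite (packetE gT)//= expr0n addr0.
have cF : continuous (fun t => (fst1 g t * cosy k t) ^+ 2).
  have h1 := fst1_continuous cg; have h2 := @cosy_continuous _ k; cts.
rewrite /cell_int (cell_integral21 T_gt0 K2_gt0 cF).
have -> : \int[mu]_(y in `[0, K2]) \int[mu]_(x in `[0, T]) (fst1 g (x, y) * cosy k (x, y)) ^+ 2
   = period_int K2 (fun y => ip g g * cos (k * y) ^+ 2).
  apply: (@eq_I _ K2) => y _; rewrite mulrC -IZ; last by cts.
  by apply: eq_I => x _; rewrite /fst1 /cosy /=; ring.
rewrite IZ; last by cts.
rewrite mulr_gt0// lt0r I_ge0 ?andbT; last by move=> y _; exact: sqr_ge0.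
apply/eqP => c0.
have := @I_eq0 _ K2 K2_gt0 (fun y => cos (k * y) ^+ 2) _ _ c0 0.
rewrite mulr0 cos0 expr1n lexx (ltW K2_gt0) => H.
have : (1 : R) = 0 by apply: H => //; [cts|move=> y _; exact: sqr_ge0].
by move/eqP; rewrite oner_eq0.
Qed.

(** Two integrations by parts in y, on each line where x is fixed. *)
Lemma pair_pyy g psi : continuous g -> test_fun T K2 psi ->
  pairing g (py (py psi)) = - k ^+ 2 * pairing g psi.
Proof.
move=> cg tpsi; have t1 := test_fun_py tpsi; have t2 := test_fun_py t1.
have c0 := test_fun_continuous tpsi; have c2 := test_fun_continuous t2.
have h1 := fst1_continuous cg; have h2 := @cosy_continuous _ k.
apply/eqP; rewrite -subr_eq0 mulNr opprK; apply/eqP.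
rewrite /pairing -(JZ T_gt0 K2_gt0); last by cts.
rewrite -(JD T_gt0 K2_gt0); [|by cts..].
apply: (J0_y T_gt0 K2_gt0) => [|x]; first by cts.
have Dk : D1 (fun y => k * y) (fun=> k) by derive; ring.
have Dc := D1_comp D1_cos Dk; have Ds := D1_comp D1_sin Dk.
have D0 := test_fun_D1y tpsi x; have D1' := test_fun_D1y t1 x.
have cs := D1_continuous Ds; have cc := D1_continuous Dc.
have s0 := @slice2_continuous _ _ x c0; have s2 := @slice2_continuous _ _ x c2.
have DF : D1 (fun y => g x * (cos (k * y) * py psi (x, y) + k * sin (k * y) * psi (x, y)))
    (fun y => g x * cos (k * y) * py (py psi) (x, y) + k ^+ 2 * (g x * cos (k * y) * psi (x, y))).
  by derive; ring.
rewrite (FTC2 (ltW K2_gt0) DF); last by cts.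
have [_ p0] := test_fun_periodic tpsi; have [_ p1] := test_fun_periodic t1.
have kK : k * K2 = pi *+ 2 by rewrite /K2 mulrC divfK// gt_eqF.
by rewrite p0 p1 kK cos2pi sin2pi mulr0 cos0 sin0; ring.
Qed.
End Packet.

Section Eigenfunction.
Context {R : realType}.
Variables (T c b : R) (f f' phi : R -> R).
Hypothesis W : dnoidal_wave T c b f f'.
Hypothesis phi2 : forall x, phi x ^+ 2 = f x ^+ 2.
Variables (lam sg : R) (z w p r : R -> R).
Hypotheses (lam_gt0 : 0 < lam) (sg_gt0 : 0 < sg).
Hypothesis M : forced_mode T c f f' sg lam 0 z w p r.
Hypothesis n : period_ip T (chi' f f') z = 1.
Notation I := (period_int T).
Let k := Num.sqrt sg.
Let K2 := pi *+ 2 / k.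
Notation J := (cell_int T K2).
Notation packet := (packet T k).
Notation pairing := (pairing T k).
Let T_gt0 := wave_T W.

Let k_gt0 : 0 < k. Proof. by rewrite sqrtr_gt0. Qed.
Let k2 : k ^+ 2 = sg. Proof. by rewrite sqr_sqrtr// ltW. Qed.
Let K2_gt0 : 0 < K2. Proof. exact: (K2_gt0 k_gt0). Qed.

Let Dr : D1 r (fun x => sg * z x + lam * w x).
Proof. by apply: D1_eq (mode_r M) _ => x; rewrite mul0r subr0. Qed.

Lemma eigen_mean_w : I w = 0.
Proof.
have [cz cw cp cr] := mode_continuous M.
exact: (I_D1_periodic W (mode_z M) cw (mode_zT M)).
Qed.

(** r and z are periodic, r' = sg z + lam w and z' = w. *)
Lemma eigen_mean_z : I z = 0.
Proof.
have [cz cw cp cr] := mode_continuous M.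
have cd : continuous (fun x => sg * z x + lam * w x) by cts.
have := I_D1_periodic W Dr cd (mode_rT M).
rewrite ID ?IZ//; [|by cts..].
by rewrite eigen_mean_w mulr0 addr0 => /eqP; rewrite mulf_eq0 gt_eqF//= => /eqP.
Qed.

(** If w vanished, so would <h, z> = - <f^2, w>. *)
Lemma eigen_w_neq0 : 0 < period_ip T w w.
Proof.
have [cz cw cp cr] := mode_continuous M.
rewrite lt0r ip_ge0 andbT; apply/eqP => ww.
have w0 := ip_eq0 T_gt0 cw ww.
have Df := wave_D1 W; have cf := D1_continuous Df; have cf' := D1_continuous (wave_D1' W).
have Dh : D1 (fun x => f x ^+ 2) (chi' f f') by rewrite /chi'; derive; ring.
have ch : continuous (chi' f f') by rewrite /chi'; cts.
have := ip_D1 T_gt0 Dh (mode_z M) ch cw _ (mode_zT M); rewrite (wave_period W) n => /(_ erefl).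
rewrite (_ : period_ip T _ w = 0); first by move/eqP; rewrite oppr0 oner_eq0.
rewrite (_ : period_ip T _ w = I (fun=> 0)); first by rewrite /period_int /Rintegral integral0.
by apply: eq_I => x xT; rewrite w0// mulr0.
Qed.

(** - sg z cos (k y) is an antiderivative in x of the second derivative in y of
    w cos (k y). *)
Lemma eigen_x psi : test_fun T K2 psi ->
  pairing (fun x => - sg * z x) (px psi) = - pairing (fun x => - sg * w x) psi.
Proof.
move=> tpsi; have t1 := test_fun_px tpsi.
have [cz cw cp cr] := mode_continuous M.
have c0 := test_fun_continuous tpsi; have c1 := test_fun_continuous t1.
have h1 := fst1_continuous cz; have h2 := @cosy_continuous _ k; have h3 := fst1_continuous cw.
apply/eqP; rewrite -subr_eq0 opprK; apply/eqP.
have e1 : continuous (fst1 (fun x => - sg * z x)) by rewrite /fst1; cts.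
have e2 : continuous (fst1 (fun x => - sg * w x)) by rewrite /fst1; cts.
rewrite /pairing -(JD T_gt0 K2_gt0); [|by cts..].
apply: (J0_x T_gt0 K2_gt0) => [|y]; first by cts.
have D0 := test_fun_D1x tpsi y.
have s0 := @slice1_continuous _ _ y c0; have s1 := @slice1_continuous _ _ y c1.
have Dz := mode_z M.
have DF : D1 (fun x => - sg * z x * cos (k * y) * psi (x, y))
  (fun x => - sg * z x * cos (k * y) * px psi (x, y) + - sg * w x * cos (k * y) * psi (x, y)).
  by derive; ring.
rewrite (FTC2 (ltW T_gt0) DF); last by cts.
have [p0 _] := test_fun_periodic tpsi.
by rewrite p0 (mode_zT M) subrr.
Qed.

(** On each line where y is fixed, the equation of the mode is integrated by
    parts against psi, with w psi_xx - p psi_x - r psi as the primitive of the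
    difference of the two sides. *)
Lemma eigen_eq psi : test_fun T K2 psi ->
  pairing (fun x => lam * w x) psi =
  pairing w (px (px (px psi))) - pairing w (fun t => (c - 3 * phi t.1 ^+ 2) * px psi t)
  + pairing (fun x => - sg * z x) psi.
Proof.
move=> tpsi; have t1 := test_fun_px tpsi; have t2 := test_fun_px t1; have t3 := test_fun_px t2.
have [cz cw cp cr] := mode_continuous M.
have c0 := test_fun_continuous tpsi; have c1 := test_fun_continuous t1.
have c3 := test_fun_continuous t3; have c2 := test_fun_continuous t2.
have h2 := @cosy_continuous _ k; have h3 := fst1_continuous cw.
have e1 : continuous (fst1 (fun x => - sg * z x)) by rewrite /fst1; have h1 := fst1_continuous cz; cts.
have e2 : continuous (fst1 (fun x => lam * w x)) by rewrite /fst1; cts.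
have cq := q_continuous W; have e3 := fst1_continuous cq.
have -> : pairing w (fun t => (c - 3 * phi t.1 ^+ 2) * px psi t) =
    J (fun t => fst1 w t * cosy k t * (fst1 (potential c f) t * px psi t)).
  by apply: (@eq_J _ T K2) => x y _ _; rewrite phi2.
apply/eqP; rewrite eq_sym -subr_eq0; apply/eqP.
have cpair g F : continuous (fst1 g) -> continuous F ->
    continuous (fun t => fst1 g t * cosy k t * F t).
  by move=> cg cF; exact: (cM (cM cg h2) cF).
have k1 := cpair _ _ h3 c3; have k2' := cpair _ _ h3 (cM e3 c1).
have k3 := cpair _ _ e1 c0; have k4 := cpair _ _ e2 c0.
have cm : continuous (fun _ : R * R => -1 : R) by exact: cst_continuous.
have JE A B C E : continuous A -> continuous B -> continuous C -> continuous E ->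
    J A - J B + J C - J E = J (fun t => A t + -1 * B t + C t + -1 * E t).
  move=> cA cB cC cE; have cB' := cM cm cB.
  have cE' := cM cm cE.
  rewrite (JD T_gt0 K2_gt0 (cD (cD cA cB') cC) cE').
  rewrite (JD T_gt0 K2_gt0 (cD cA cB') cC) (JD T_gt0 K2_gt0 cA cB').
  by rewrite (JZ T_gt0 K2_gt0 _ cB) (JZ T_gt0 K2_gt0 _ cE) !mulN1r.
rewrite /pairing (JE _ _ _ _ k1 k2' k3 k4).
apply: (J0_x T_gt0 K2_gt0) => [|y].
  have k2'' := cM cm k2'.
  exact: (cD (cD (cD k1 k2'') k3) (cM cm k4)).
have D0 := test_fun_D1x tpsi y; have D1' := test_fun_D1x t1 y; have D2 := test_fun_D1x t2 y.
have s0 := @slice1_continuous _ _ y c0; have s1 := @slice1_continuous _ _ y c1.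
have s2 := @slice1_continuous _ _ y c2; have s3 := @slice1_continuous _ _ y c3.
have Dw := mode_w M; have Dp := mode_p M; have Dr' := Dr.
have DF : D1 (fun x => cos (k * y) * (w x * px (px psi) (x, y) - p x * px psi (x, y) - r x * psi (x, y)))
  (fun x => w x * cos (k * y) * px (px (px psi)) (x, y)
   + -1 * (w x * cos (k * y) * (potential c f x * px psi (x, y)))
   + - sg * z x * cos (k * y) * psi (x, y) + -1 * (lam * w x * cos (k * y) * psi (x, y))).
  apply: D1_eq (D1M (D1_cst (cos (k * y)))
    (D1D (D1D (D1M Dw D2) (D1N (D1M Dp D1'))) (D1N (D1M Dr' D0)))) _ => x /=.
  by ring.
rewrite (FTC2 (ltW T_gt0) DF); last by cts.
have [p0 _] := test_fun_periodic tpsi; have [p1 _] := test_fun_periodic t1.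
have [p2 _] := test_fun_periodic t2.
by rewrite p0 p1 p2 (mode_wT M) (mode_pT M) (mode_rT M) subrr.
Qed.

Lemma eigen_linKP : linKP c phi T K2 (packet w) (lam%:C%C *: packet w).
Proof.
have [cz cw cp cr] := mode_continuous M.
have wT := mode_wT M; have zT := mode_zT M.
have clw : continuous (fun x => lam * w x) by cts.
have lwT : lam * w T = lam * w 0 by rewrite wT.
have csz : continuous (fun x => - sg * z x) by cts.
have szT : - sg * z T = - sg * z 0 by rewrite zT.
have h2 := @cosy_continuous _ k.
have ez := fst1_continuous csz.
rewrite packetZ; split.
- by apply: packet_X0 => //; exact: eigen_mean_w.
- by apply: packet_X0 => //; rewrite IZ// eigen_mean_w mulr0.
exists (dist_of T K2 (packet (fun x => - sg * z x))).
- split.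
  + move=> a psi chi tpsi tchi.
    have c1 := test_fun_continuous tpsi; have c2 := test_fun_continuous tchi.
    rewrite !dist_packet// -rmorphM -rmorphD/=; congr (_%:C%C).
    rewrite /pairing -(JZ T_gt0 K2_gt0); last by cts.
    rewrite -(JD T_gt0 K2_gt0); [|by cts..].
    by apply: (@eq_J _ T K2) => x y _ _; ring.
  + move=> psi tpsi; rewrite /ddx /ddy !dist_packet// opprK -rmorphN/=; congr (_%:C%C).
    rewrite eigen_x// pair_pyy// k2 opprK /pairing.
    have c1 := test_fun_continuous tpsi; have e3 := fst1_continuous cw.
    rewrite -(JZ T_gt0 K2_gt0); last by cts.
    by apply: (@eq_J _ T K2) => x y _ _; rewrite /fst1 /=; ring.
  + move=> psi tpsi indep; have c1 := test_fun_continuous tpsi.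
    rewrite dist_packet// /pairing (J0_x T_gt0 K2_gt0) ?rmorph0//; first by cts.
    move=> y; transitivity (I (fun x => (- sg * cos (k * y) * psi (0, y)) * z x)).
      by apply: eq_I => x _; rewrite (indep x 0 y) /fst1 /cosy /=; ring.
    by rewrite IZ// eigen_mean_z mulr0.
move=> psi tpsi; rewrite /ddx /dmul !dist_packet//.
rewrite (eigen_eq tpsi) rmorphD rmorphB/=; congr (_ + _).
by rewrite !opprK opprD opprK.
Qed.

Lemma eigen_unstable : spectrally_unstable c phi T K2 /\ linearly_unstable c phi T K2.
Proof.
have [cz cw cp cr] := mode_continuous M.
have Xlin := @X0_lin R T K2 T_gt0 K2_gt0.
have nD (u v : cfun2 R) : X0 T K2 u -> X0 T K2 v ->
  L2norm T K2 (u + v) <= L2norm T K2 u + L2norm T K2 v.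
  by move=> [Lu _] [Lv _]; exact: L2norm_triangle.
have nZ (t : R) (u : cfun2 R) : X0 T K2 u -> L2norm T K2 (t%:C%C *: u) = `|t| * L2norm T K2 u.
  by move=> [Lu _]; exact: L2normZ.
have n0 (u : cfun2 R) : 0 <= L2norm T K2 u by exact: sqrtr_ge0.
have Xw : X0 T K2 (packet w) by apply: packet_X0 => //; [exact: mode_wT M|exact: eigen_mean_w].
have nw : 0 < L2norm T K2 (packet w).
  by apply: packet_norm => //; [exact: mode_wT M|exact: eigen_w_neq0].
split.
- exact: (spectrally_unstable_eigen nZ lam_gt0 Xw nw eigen_linKP).
- exact: (linearly_unstable_eigen Xlin n0 nD nZ lam_gt0 Xw nw eigen_linKP).
Qed.
End Eigenfunction.

(** * The parameters of the wave, and its instability *)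

Section WaveData.
Context {R : realType}.
Variables (c b phi0 phi1 kappa alpha T : R).
Hypotheses (c_gt0 : 0 < c) (b_range : - (2^-1 * c ^+ 2) < b < 0)
  (phi01 : 0 < phi0 < phi1)
  (root0 : phi0 ^+ 4 / 2 - c * phi0 ^+ 2 - b = 0)
  (root1 : phi1 ^+ 4 / 2 - c * phi1 ^+ 2 - b = 0)
  (kappa01 : 0 < kappa < 1)
  (kappaE : kappa ^+ 2 = (phi1 ^+ 2 - phi0 ^+ 2) / phi1 ^+ 2)
  (alphaE : alpha = phi1 / Num.sqrt 2)
  (TE : T = 2 * ellK kappa / alpha).

Let phi1_gt0 : 0 < phi1. Proof. by case/andP: phi01 => /lt_trans; exact. Qed.

(** phi0^2 and phi1^2 are the two roots of v^2 / 2 - c v - b. *)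
Lemma roots_vieta : phi0 ^+ 2 + phi1 ^+ 2 = 2 * c /\ phi0 ^+ 2 * phi1 ^+ 2 = - 2 * b.
Proof.
have /andP[p0 p01] := phi01.
have ne : phi1 ^+ 2 - phi0 ^+ 2 != 0.
  by rewrite subr_eq0 gt_eqF// ltr_pXn2r// ?nnegrE// ltW.
have s : phi0 ^+ 2 + phi1 ^+ 2 = 2 * c.
  apply: (mulfI ne); move: root0 root1; rewrite (exprM phi0 2 2) (exprM phi1 2 2).
  set u := phi0 ^+ 2; set v := phi1 ^+ 2 => h0 h1.
  have -> : (v - u) * (u + v) = 2 * ((v ^+ 2 / 2 - c * v - b) - (u ^+ 2 / 2 - c * u - b))
    + (v - u) * (2 * c) by field.
  by rewrite h0 h1 subrr mulr0 add0r.
split=> //; move: root0 s; rewrite (exprM phi0 2 2).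
set u := phi0 ^+ 2; set v := phi1 ^+ 2 => h0 s.
have -> : - 2 * b = 2 * (u ^+ 2 / 2 - c * u - b) - u ^+ 2 + u * (2 * c) by field.
by rewrite h0 -s; ring.
Qed.

Lemma modulus_compl : phi1 ^+ 2 * (1 - kappa ^+ 2) = phi0 ^+ 2.
Proof. by rewrite kappaE; field; rewrite gt_eqF. Qed.

Lemma wave_speed : alpha ^+ 2 * (2 - kappa ^+ 2) = c.
Proof.
have [s _] := roots_vieta; rewrite (alpha2 alphaE).
have := modulus_compl; lra.
Qed.

Lemma dnoidal_waveP : dnoidal_wave T c b (dnoidal kappa phi1 alpha) (dnoidal' kappa phi1 alpha).
Proof.
have [s p] := roots_vieta; have cE := wave_speed; have mE := modulus_compl.
have /andP[p0 p01] := phi01.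
split; [|exact: c_gt0|exact: b_range|..].
- exact: (period_gt0 kappa01 phi1_gt0 alphaE TE).
- exact: D1_dnoidal.
- by rewrite -cE; exact: D1_dnoidal'.
- move=> x; rewrite (dnoidal'_sqr kappa01 alphaE) cE (exprM phi1 2 2).
  have -> : (1 - kappa ^+ 2) * (phi1 ^+ 2) ^+ 2 = - 2 * b.
    by rewrite -p -mE; ring.
  by field.
- exact: dnoidal_gt0.
- exact: dnoidal_T.
- exact: dnoidal'_T.
- exact: dnoidal_reflect.
- exact: dnoidal'_reflect.
move=> v hv; apply: dnoidal_level => //; rewrite mE.
have : (v - phi0 ^+ 2) * (v - phi1 ^+ 2) < 0.
  have -> : (v - phi0 ^+ 2) * (v - phi1 ^+ 2) = 2 * (v ^+ 2 / 2 - c * v - b).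
    have -> : (v - phi0 ^+ 2) * (v - phi1 ^+ 2) =
       v ^+ 2 - (phi0 ^+ 2 + phi1 ^+ 2) * v + phi0 ^+ 2 * phi1 ^+ 2 by ring.
    by rewrite s p; field.
  by rewrite pmulr_rlt0.
have : phi0 ^+ 2 < phi1 ^+ 2 by rewrite ltr_pXn2r// ?nnegrE// ltW.
by set u := phi0 ^+ 2; set w := phi1 ^+ 2; nra.
Qed.
End WaveData.

Theorem theorem2 (R : realType) (c b phi0 phi1 kappa alpha T : R)
    (phi : R -> R)
    (c_gt0 : 0 < c)
    (b_range : - (2^-1 * c ^+ 2) < b < 0)
    (phi01 : 0 < phi0 < phi1)
    (root0 : phi0 ^+ 4 / 2 - c * phi0 ^+ 2 - b = 0)
    (root1 : phi1 ^+ 4 / 2 - c * phi1 ^+ 2 - b = 0)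
    (kappa_range : 0 < kappa < 1)
    (kappaE : kappa ^+ 2 = (phi1 ^+ 2 - phi0 ^+ 2) / phi1 ^+ 2)
    (alphaE : alpha = phi1 / Num.sqrt 2)
    (TE : T = 2 * ellK kappa / alpha)
    (phiE : (forall z, phi z = - (phi1 * jacobi_dn kappa (alpha * z))) \/
            (forall z, phi z = phi1 * jacobi_dn kappa (alpha * z))) :
  exists K2 : R,
    [/\ 0 < K2, spectrally_unstable c phi T K2 & linearly_unstable c phi T K2].
Proof.
have W := dnoidal_waveP c_gt0 b_range phi01 root0 root1 kappa_range kappaE alphaE TE.
have phi2 x : phi x ^+ 2 = dnoidal kappa phi1 alpha x ^+ 2.
  by case: phiE => ->; rewrite ?sqrrN.
have [lam [sg [z [w [p [r [lam0 sg0 M n]]]]]]] := growing_mode W.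
have [s l] := eigen_unstable W phi2 lam0 sg0 M n.
exists (pi *+ 2 / Num.sqrt sg); split=> //.
by apply: K2_gt0; rewrite sqrtr_gt0.
Qed.
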